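(* Let $\mathcal R=(\mathbb R,<,+,\dots)$ be an expansion of the ordered additive group of real numbers. The following are equivalent: (1) $\mathcal R$ is of field-type; (2) there is a nonempty bounded open interval $I\subseteq\mathbb R$ and a continuous definable function $f:I\to\mathbb R$ that is not repetitious; (3) there is a nonempty bounded open interval $I\subseteq\mathbb R$ and a definable $C^2$ function $f:I\to\mathbb R$ that is not affine.
   Context: ''Definable'' means definable in $\mathcal R$ with parameters. $\mathcal R$ is of field-type if there are a nonempty bounded open interval $I\subseteq\mathbb R$ and definable functions $\oplus,\otimes:I^2\to I$ such that $(I,<,\oplus,\otimes)$ is an ordered field isomorphic to $(\mathbb R,<,+,\cdot)$. A function $f:I\to\mathbb R$ is repetitious if for every open subinterval $J\subseteq I$ there are $\delta>0$ and $x,y\in J$ with $\delta<y-x$ such that $f(x+\epsilon)-f(x)=f(y+\epsilon)-f(y)$ for all $0\le\epsilon<\delta$. *)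

(* Defs.v *)
From HB Require Import structures.
From mathcomp Require Export all_boot all_order all_algebra.
From mathcomp Require Export all_classical all_reals all_analysis.
Export Order.TTheory GRing.Theory Num.Theory numFieldNormedType.Exports.

Set Implicit Arguments.
Unset Strict Implicit.
Unset Printing Implicit Defensive.

Global Open Scope classical_set_scope.
Global Open Scope ring_scope.

(** The extra symbols, with their interpretations, of a first-order structure
    on [R] expanding [(R, <, +)].  The symbols [<] and [+] themselves (and
    equality) are built into the syntax below. *)
Record expansion (R : realType) : Type := Expansion {
  fsym : Type;
  farity : fsym -> nat;
  finterp : forall s : fsym, 'rV[R]_(farity s) -> R;
  rsym : Type;
  rarity : rsym -> nat;
  rinterp : forall s : rsym, set 'rV[R]_(rarity s)
}.

Section FirstOrder.
Variables (R : realType) (M : expansion R).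

Inductive term : Type :=
| Var of nat
| Add of term & term
| Fun (s : fsym M) of ('I_(farity s) -> term).

Inductive formula : Type :=
| Eq of term & term
| Lt of term & term
| Rel (s : rsym M) of ('I_(rarity s) -> term)
| Not of formula
| And of formula & formula
| Exists of formula.

Fixpoint eval (e : nat -> R) (t : term) : R :=
  match t with
  | Var i => e i
  | Add t u => eval e t + eval e u
  | Fun s ts => finterp (\row_i eval e (ts i))
  end.

Definition push (x : R) (e : nat -> R) : nat -> R :=
  fun i => if i is j.+1 then e j else x.

(** Variables are de Bruijn indices: [Exists p] binds variable [0] of [p]. *)
Fixpoint sat (e : nat -> R) (p : formula) : Prop :=
  match p with
  | Eq t u => eval e t = eval e u
  | Lt t u => eval e t < eval e u
  | Rel s ts => rinterp (\row_i eval e (ts i))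
  | Not p => ~ sat e p
  | And p q => sat e p /\ sat e q
  | Exists p => exists x, sat (push x e) p
  end.

(** Variables [0, ..., n-1] are read in [v] and variable [n + k] in [e k]. *)
Definition valuation n (v : 'rV[R]_n) (e : nat -> R) : nat -> R :=
  fun i => if insub i is Some j then v 0 j else e (i - n)%N.

(** Definability with parameters: the parameters are the values that [e] gives
    to the (finitely many) variables of [p] beyond the first [n]. *)
Definition definable n (X : set 'rV[R]_n) : Prop :=
  exists (p : formula) (e : nat -> R),
    forall v : 'rV[R]_n, X v <-> sat (valuation v e) p.

(** A function on a subset of [R] (or of [R^2]) is represented by a total
    function, of which only the values on that subset are used. *)
Definition definable_fun1 (I : set R) (f : R -> R) : Prop :=
  definable [set v : 'rV[R]_2 | I (v 0 0) /\ v 0 1 = f (v 0 0)].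

Definition definable_fun2 (I : set R) (op : R -> R -> R) : Prop :=
  definable [set v : 'rV[R]_3 |
    [/\ I (v 0 0), I (v 0 1) & v 0 2 = op (v 0 0) (v 0 1)]].

End FirstOrder.

Definition bounded_open_interval (R : realType) (I : set R) : Prop :=
  exists a b : R, a < b /\ I = `]a, b[%classic.

(** [phi] is an isomorphism from [(I, <, oplus, otimes)] onto the ordered field
    of real numbers; the ordered field axioms for the former follow. *)
Definition isomorphic_to_reals (R : realType) (I : set R)
    (oplus otimes : R -> R -> R) : Prop :=
  exists phi : R -> R,
    [/\ set_bij I [set: R] phi,
        forall x y, I x -> I y -> (x < y <-> phi x < phi y),
        forall x y, I x -> I y -> phi (oplus x y) = phi x + phi y
      & forall x y, I x -> I y -> phi (otimes x y) = phi x * phi y].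

Definition field_type (R : realType) (M : expansion R) : Prop :=
  exists (I : set R) (oplus otimes : R -> R -> R),
    [/\ bounded_open_interval I,
        forall x y, I x -> I y -> I (oplus x y) /\ I (otimes x y),
        definable_fun2 M I oplus,
        definable_fun2 M I otimes
      & isomorphic_to_reals I oplus otimes].

(** For the equality to make sense both [x + eps] and [y + eps] have to lie in
    the domain [I] of [f]; this is made explicit. *)
Definition repetitious (R : realType) (I : set R) (f : R -> R) : Prop :=
  forall J : set R, bounded_open_interval J -> J `<=` I ->
    exists delta x y : R,
      [/\ 0 < delta, J x, J y, delta < y - x
        & forall eps, 0 <= eps -> eps < delta ->
            [/\ I (x + eps), I (y + eps)
              & f (x + eps) - f x = f (y + eps) - f y]].

Definition C2 (R : realType) (I : set R) (f : R -> R) : Prop :=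
  [/\ forall x, I x -> derivable f x 1,
      forall x, I x -> derivable f^`()%classic x 1
    & {within I, continuous f^`(2)%classic}].

Definition affine_on (R : realType) (I : set R) (f : R -> R) : Prop :=
  exists m c : R, forall x, I x -> f x = m * x + c.

(* Main.v *)
(** (1) => (3).  Let [Phi] be the isomorphism from [I] to the reals.  It suffices to find
    a subinterval on which [Phi] is C2 with positive derivative: a conjugate by [Phi] of a
    quartic close to the identity is then C2 and not affine.  Both this and (2) => (3)
    rest on a dichotomy for a continuous [g] (such as a definable function, [Phi], or a
    quotient of two values of the derivative of [Phi]) whose sums can be compared
    definably.
    - The points at which all second differences of step less than [t] are nonpositive
      form a closed set [B_t].  If [g] is convex on no subinterval, the union of the [B_t]
      is dense: subtract a chord and take a local maximum.  If moreover no [B_t] has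
      interior (else [g] is somewhere concave), the points of locally highest level form
      a dense set with a definable order of type omega.
    - If [g] is convex, its kinks of size at least [g'(y+) - g'(z+)] form a finite set,
      definable by comparing second differences of [g] at [x] with increments of [g] at
      [y] and [z].  So either, letting [y] tend to [z], the kinks again provide a dense
      definable order of type omega, or [g] is C1 on a subinterval.

    A dense definable order of type omega, together with a definable family [G_eps]
    tending to 0 with [eps] and injective on finite sets for arbitrarily small [eps],
    makes every relation on the dense set definable: finitely many real parameters
    approximated from within the dense set code an arbitrary sequence of pairs.  In
    particular a quadratic function is definable.  For (1) take
    [G_eps x = ((0 + eps) * x) - 0], with the product and the zero of the field and the
    sum and difference of the reals; for (2) take [G_eps x = f (x + eps) - f x].

    In the other case of (2), [f] is C1 with strictly monotone derivative on a
    subinterval, and this gives (1), as does (3): the points [x] of the subinterval code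
    the slopes [f' x - f' p] of the germs [h |-> f (x + h) - f x - (f (p + h) - f p)] at 0,
    and the order on germs, with their addition and composition, defines the field
    operations on slopes near 0.  The bijection [X |-> X / (eta^2 - X^2)] extends these to
    a whole field. *)

From mathcomp Require Import ring lra.
Require Import Defs.

Set Implicit Arguments.
Unset Strict Implicit.
Unset Printing Implicit Defensive.

(** * Closure properties of definable predicates and terms *)

Section Definability.
Variables (R : realType) (M : expansion R).

Implicit Types (v w e : nat -> R) (P Q : (nat -> R) -> Prop).

Fixpoint ren_term (r : nat -> nat) (t : term M) : term M :=
  match t with
  | Var i => Var M (r i)
  | Add t u => Add (ren_term r t) (ren_term r u)
  | Fun s ts => Fun (fun i => ren_term r (ts i))
  end.

Definition ren_up (r : nat -> nat) : nat -> nat :=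
  fun i => if i is j.+1 then (r j).+1 else 0%N.

Fixpoint ren (r : nat -> nat) (p : formula M) : formula M :=
  match p with
  | Eq t u => Eq (ren_term r t) (ren_term r u)
  | Lt t u => Lt (ren_term r t) (ren_term r u)
  | Rel s ts => Rel (fun i => ren_term r (ts i))
  | Not p => Not (ren r p)
  | And p q => And (ren r p) (ren r q)
  | Exists p => Exists (ren (ren_up r) p)
  end.

Lemma eval_ren r e t : eval e (ren_term r t) = eval (e \o r) t.
Proof.
elim: t => //= [t -> u ->//|s ts IH].
by congr finterp; apply/rowP => i; rewrite !mxE.
Qed.

Lemma sat_ren p r e : sat e (ren r p) <-> sat (e \o r) p.
Proof.
elim: p r e => /= [t u|t u|s ts|p IH|p IHp q IHq|p IH] r e.
- by rewrite !eval_ren.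
- by rewrite !eval_ren.
- suff -> : \row_i eval e (ren_term r (ts i)) = \row_i eval (e \o r) (ts i) by [].
  by apply/rowP => i; rewrite !mxE eval_ren.
- by split=> h /IH.
- by rewrite IHp IHq.
- have E x : push x e \o ren_up r = push x (e \o r) by apply/funext => -[|i].
  by split=> -[x hx]; exists x; move: hx; rewrite IH E.
Qed.

(* Even positions carry the free variables of a predicate, odd positions its parameters. *)
Definition mix v e : nat -> R := fun i => if odd i then e i./2 else v i./2.

Lemma mix_even v e i : mix v e i.*2 = v i.
Proof. by rewrite /mix odd_double doubleK. Qed.

Lemma mix_odd v e i : mix v e i.*2.+1 = e i.
Proof. by rewrite /mix /= odd_double /= uphalf_double. Qed.

Lemma mix_comp v e (a b : nat -> nat) w :
  (forall i, w (a i) = v i) -> (forall i, w (b i) = e i) ->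
  w \o (fun i => if odd i then b i./2 else a i./2) = mix v e.
Proof. by move=> ha hb; apply/funext => i /=; rewrite /mix; case: odd. Qed.

(** Predicates on infinite valuations carry no arity, so substitution is a mere reindexing. A
    formula mentions only finitely many odd positions, hence finitely many parameters. *)
Definition dfn P : Prop :=
  exists (p : formula M) (e : nat -> R), forall v, P v <-> sat (mix v e) p.

Lemma dfn_ext P Q : (forall v, P v <-> Q v) -> dfn Q -> dfn P.
Proof. by move=> h [p [e H]]; exists p, e => v; rewrite h. Qed.

Lemma dfn_not P : dfn P -> dfn (fun v => ~ P v).
Proof. by move=> [p [e H]]; exists (Not p), e => v /=; rewrite H. Qed.

Lemma dfn_and P Q : dfn P -> dfn Q -> dfn (fun v => P v /\ Q v).
Proof.
move=> [p [e He]] [q [e' He']].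
(* The parameters of both formulas are merged into [mix e e']: parameter [k] of [p] becomes
   parameter [2 k], and parameter [k] of [q] becomes parameter [2 k + 1]. *)
pose rp i := if odd i then (i./2).*2.*2.+1 else (i./2).*2.
pose rq i := if odd i then (i./2).*2.+1.*2.+1 else (i./2).*2.
exists (And (ren rp p) (ren rq q)), (mix e e') => v /=.
rewrite !sat_ren He He'.
rewrite (@mix_comp v e double (fun i => i.*2.*2.+1)); first last.
- by move=> i; rewrite mix_odd mix_even.
- by move=> i; rewrite mix_even.
rewrite (@mix_comp v e' double (fun i => i.*2.+1.*2.+1)) //.
- by move=> i; rewrite mix_even.
- by move=> i; rewrite mix_odd mix_odd.
Qed.

Lemma dfn_or P Q : dfn P -> dfn Q -> dfn (fun v => P v \/ Q v).
Proof.
move=> dP dQ; apply: dfn_ext (dfn_not (dfn_and (dfn_not dP) (dfn_not dQ))) => v.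
split=> [[p|q] []//|h]; apply: contrapT => /not_orP[np nq]; exact: h.
Qed.

Lemma dfn_imp P Q : dfn P -> dfn Q -> dfn (fun v => P v -> Q v).
Proof.
move=> dP dQ; apply: dfn_ext (dfn_or (dfn_not dP) dQ) => v.
split=> [h|[]//]; have [p|np] := pselect (P v); [right; exact: h|by left].
Qed.

Lemma dfn_ex (P : R -> (nat -> R) -> Prop) :
  dfn (fun v => P (v 0%N) (fun i => v i.+1)) -> dfn (fun v => exists x, P x v).
Proof.
move=> [p [e H]].
(* Below the quantifier, index [0] is the bound variable and every position of [mix v e] is shifted
   by one. *)
pose a i := if i is j.+1 then j.*2.+1 else 0%N.
pose b i := i.*2.+2.
exists (Exists (ren (fun i => if odd i then b i./2 else a i./2) p)), e => v /=.
suff E x : P x v <-> sat (push x (mix v e)) (ren (fun i => if odd i then b i./2 else a i./2) p).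
  by split=> -[x /E]; exists x.
rewrite sat_ren (@mix_comp (push x v) e a b); first last.
- by move=> i; rewrite /= mix_odd.
- by case=> //= i; rewrite mix_even.
by rewrite -H.
Qed.

Lemma dfn_all (P : R -> (nat -> R) -> Prop) :
  dfn (fun v => P (v 0%N) (fun i => v i.+1)) -> dfn (fun v => forall x, P x v).
Proof.
move=> dP; apply: dfn_ext (dfn_not (dfn_ex (P := fun x v => ~ P x v) (dfn_not dP))) => v.
by split=> [h [x]|h x]; [apply|apply: contrapT => nP; apply: h; exists x].
Qed.

Lemma dfn_subst P (s : nat -> nat) : dfn P -> dfn (fun v => P (fun i => v (s i))).
Proof.
move=> [p [e H]].
pose a i := (s i).*2.
exists (ren (fun i => if odd i then i./2.*2.+1 else a i./2) p), e => v.
rewrite sat_ren (@mix_comp (v \o s) e a (fun i => i.*2.+1)) ?H //.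
- by move=> i; rewrite mix_even.
- by move=> i; rewrite mix_odd.
Qed.

Definition dterm (t : (nat -> R) -> R) : Prop :=
  dfn (fun v => v 0%N = t (fun i => v i.+1)).

Lemma dterm_var k : dterm (fun v => v k).
Proof. by exists (Eq (Var M 0) (Var M k.+1.*2)), (fun=> 0) => v /=; rewrite (mix_even _ _ 0%N) mix_even. Qed.

Lemma dterm_const (c : R) : dterm (fun=> c).
Proof. by exists (Eq (Var M 0) (Var M 1)), (fun=> c) => v /=. Qed.

Lemma dfn_subst1 (P : R -> (nat -> R) -> Prop) t :
  dterm t -> dfn (fun v => P (v 0%N) (fun i => v i.+1)) -> dfn (fun v => P (t v) v).
Proof.
move=> dt dP.
apply: (@dfn_ext _ (fun v => exists x, x = t v /\ P x v)).
  by move=> v; split=> [h|[x [->]]//]; exists (t v).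
by apply: dfn_ex; apply: dfn_and.
Qed.

Lemma dterm_subst t (s : nat -> nat) : dterm t -> dterm (fun v => t (fun i => v (s i))).
Proof.
by move/(@dfn_subst _ (ren_up s)).
Qed.

Lemma dterm_S t : dterm t -> dterm (fun v => t (fun i => v i.+1)).
Proof. exact: dterm_subst. Qed.

Lemma dfn_rel1 (Q : R -> Prop) t :
  dfn (fun v => Q (v 0%N)) -> dterm t -> dfn (fun v => Q (t v)).
Proof. by move=> dQ dt; apply: (@dfn_subst1 (fun x v => Q x)). Qed.

Lemma dfn_rel2 (Q : R -> R -> Prop) t u :
  dfn (fun v => Q (v 0%N) (v 1%N)) -> dterm t -> dterm u ->
  dfn (fun v => Q (t v) (u v)).
Proof.
move=> dQ dt du; apply: (@dfn_subst1 (fun x v => Q x (u v))) => //=.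
apply: (@dfn_subst1 (fun y v => Q (v 0%N) y)); first exact: dterm_S.
exact: (@dfn_subst (fun v => Q (v 0%N) (v 1%N)) (fun i => if i is 0 then 1 else 0)%N).
Qed.

Lemma dfn_rel3 (Q : R -> R -> R -> Prop) t u z :
  dfn (fun v => Q (v 0%N) (v 1%N) (v 2%N)) -> dterm t -> dterm u -> dterm z ->
  dfn (fun v => Q (t v) (u v) (z v)).
Proof.
move=> dQ dt du dw; apply: (@dfn_subst1 (fun x v => Q x (u v) (z v))) => //=.
apply: (@dfn_subst1 (fun y v => Q (v 0%N) y (z (fun i => v i.+1)))).
  exact: dterm_S.
apply: (@dfn_subst1 (fun x v => Q (v 1%N) (v 0%N) x)).
  by apply: (dterm_S (t := fun v => z (fun i => v i.+1))); apply: dterm_S.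
exact: (@dfn_subst (fun v => Q (v 0%N) (v 1%N) (v 2%N))
  (fun i => match i with 0 => 2 | 1 => 1 | _ => 0 end)%N).
Qed.

Lemma dfn_eq t u : dterm t -> dterm u -> dfn (fun v => t v = u v).
Proof.
apply: dfn_rel2.
by exists (Eq (Var M 0) (Var M 2)), (fun=> 0) => v.
Qed.

Lemma dfn_lt t u : dterm t -> dterm u -> dfn (fun v => is_true (t v < u v)).
Proof.
apply: dfn_rel2 (fun x y => is_true (x < y)) _ _ _.
by exists (Lt (Var M 0) (Var M 2)), (fun=> 0) => v.
Qed.

Lemma dfn_le t u : dterm t -> dterm u -> dfn (fun v => is_true (t v <= u v)).
Proof.
move=> dt du; apply: dfn_ext (dfn_not (dfn_lt du dt)) => v.
by rewrite leNgt; split=> /negP.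
Qed.

Lemma dfn_ltlt t u z : dterm t -> dterm u -> dterm z ->
  dfn (fun v => is_true (t v < u v < z v)).
Proof.
move=> dt du dw; apply: dfn_ext (dfn_and (dfn_lt dt du) (dfn_lt du dw)) => v.
by split=> /andP.
Qed.

Lemma dfn_cst (A : Prop) : dfn (fun=> A).
Proof.
have [a|na] := pselect A.
  by exists (Eq (Var M 0) (Var M 0)), (fun=> 0).
by exists (Not (Eq (Var M 0) (Var M 0))), (fun=> 0) => v /=; split.
Qed.

Lemma dterm_add t u : dterm t -> dterm u -> dterm (fun v => t v + u v).
Proof.
move=> dt du.
apply: (@dfn_rel3 (fun z x y => z = x + y)); [|exact: dterm_var|exact: dterm_S|exact: dterm_S].
by exists (Eq (Var M 0) (Add (Var M 2) (Var M 4))), (fun=> 0) => v.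
Qed.

Lemma dterm_opp t : dterm t -> dterm (fun v => - t v).
Proof.
move=> dt; apply: (@dfn_ext _ (fun v => v 0%N + t (fun i => v i.+1) = 0)).
  by move=> v; split=> [->|/eqP]; [rewrite addNr|rewrite addr_eq0 => /eqP].
by apply: dfn_eq; [apply: dterm_add; [exact: dterm_var|exact: dterm_S]|exact: dterm_const].
Qed.

Lemma dterm_ite P t u : dfn P -> dterm t -> dterm u ->
  dterm (fun v => if `[< P v >] then t v else u v).
Proof.
move=> dP dt du.
have dP' := dfn_subst S dP.
apply: (@dfn_ext _ (fun v => (P (fun i => v i.+1) /\ v 0%N = t (fun i => v i.+1))
  \/ (~ P (fun i => v i.+1) /\ v 0%N = u (fun i => v i.+1)))).
  move=> v; case: asboolP => h; split; tauto.
by apply: dfn_or; apply: dfn_and => //; apply: dfn_not.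
Qed.

Lemma dterm_app1 (F : R -> R) t : dfn (fun v => v 0%N = F (v 1%N)) -> dterm t ->
  dterm (fun v => F (t v)).
Proof.
move=> dF dt; apply: (@dfn_rel2 (fun y x => y = F x)) => //; first exact: dterm_var.
exact: dterm_S.
Qed.

Lemma dterm_app2 (F : R -> R -> R) t u :
  dfn (fun v => v 0%N = F (v 1%N) (v 2%N)) -> dterm t -> dterm u ->
  dterm (fun v => F (t v) (u v)).
Proof.
move=> dF dt du; apply: (@dfn_rel3 (fun z x y => z = F x y)) => //;
  [exact: dterm_var|exact: dterm_S|exact: dterm_S].
Qed.

Lemma dfn_definable n (X : set 'rV[R]_n) :
  definable M X <-> dfn (fun v => X (\row_(i < n) v i)).
Proof.
split=> [[p [e H]]|[p [e H]]].
  pose r i := if (i < n)%N then i.*2 else (i - n)%N.*2.+1.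
  exists (ren r p), e => v; rewrite H sat_ren.
  suff -> : valuation (\row_(i < n) v i) e = mix v e \o r by [].
  apply/funext => i; rewrite /valuation /r /=; case: insubP => [j|].
    by move=> ji jE; rewrite ji mxE mix_even jE.
  by move/negbTE => ->; rewrite mix_odd.
(* All coordinates from [n] on are read at the single index [n], where [push 0 e] supplies the dummy
   value [0]; the genuine parameters start one index later. *)
pose a i := if (i < n)%N then i else n.
pose b i := (n + i).+1.
exists (ren (fun i => if odd i then b i./2 else a i./2) p), (push 0 e) => v.
pose w i := if insub i is Some j then v 0 j else 0.
have wE : \row_(i < n) w i = v.
  by apply/rowP => i; rewrite mxE /w valK.
rewrite -{1}wE H sat_ren (@mix_comp w e a b) // => i; rewrite /valuation /a /b /w.
  case: ltnP => h; first by rewrite insubT.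
  by rewrite !insubF ?ltnn ?ltnNge ?h // subnn.
by rewrite insubF ?ltnNge -?addnS ?leq_addr // addKn.
Qed.

End Definability.

Lemma dterm_abs (R : realType) (M : expansion R) t :
  dterm M t -> dterm M (fun v => `|t v|).
Proof.
move=> dt; suff -> : (fun v => `|t v|) = (fun v => if `[< 0 <= t v >] then t v else - t v).
  by apply: dterm_ite => //; [apply: dfn_le => //; exact: dterm_const|exact: dterm_opp].
apply/funext => v; case: asboolP => [/ger0_norm//|/negP].
by rewrite -ltNge => /ltr0_norm.
Qed.

(** Decomposes a predicate or term along its syntax; definability of the atoms is looked up in the
    context. *)
Ltac ddec := repeat
  match goal with
  | H : dfn ?M ?P |- dfn ?M ?P => exact: H
  | H : dfn ?M (fun v => ?Q (v 0%N)) |- dfn ?M (fun v => ?Q _) =>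
      apply: (dfn_rel1 (Q := Q) H)
  | H : dfn ?M (fun v => ?Q (v 0%N) (v 1%N)) |- dfn ?M (fun v => ?Q _ _) =>
      apply: (dfn_rel2 (Q := Q) H)
  | H : dfn ?M (fun v => ?Q (v 0%N) (v 1%N) (v 2%N)) |- dfn ?M (fun v => ?Q _ _ _) =>
      apply: (dfn_rel3 (Q := Q) H)
  | H : dfn ?M (fun v => v 0%N = ?F (v 1%N)) |- dterm ?M (fun v => ?F _) =>
      apply: (dterm_app1 (F := F) H)
  | H : dfn ?M (fun v => v 0%N = ?F (v 1%N) (v 2%N)) |- dterm ?M (fun v => ?F _ _) =>
      apply: (dterm_app2 (F := F) H)
  | |- dfn _ (fun v => ?c) => exact: dfn_cst
  | |- dfn _ (fun v => _ /\ _) => apply: dfn_and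
  | |- dfn _ (fun v => _ \/ _) => apply: dfn_or
  | |- dfn _ (fun v => ~ _) => apply: dfn_not
  | |- dfn _ (fun v => exists x, @?P v x) =>
      refine (@dfn_ex _ _ (fun x v => P v x) _); cbv beta
  | |- dfn _ (fun v => _ = _) => apply: dfn_eq
  | |- dfn _ (fun v => is_true (_ < _ < _)) => apply: dfn_ltlt
  | |- dfn _ (fun v => is_true (_ < _)) => apply: dfn_lt
  | |- dfn _ (fun v => is_true (_ <= _)) => apply: dfn_le
  | |- dfn _ (fun v => @?A v -> @?B v) => apply: (@dfn_imp _ _ A B)
  | |- dfn _ (fun v => forall x, @?P v x) =>
      refine (@dfn_all _ _ (fun x v => P v x) _); cbv beta
  | |- dterm _ (fun v => v _) => exact: dterm_var
  | |- dterm _ (fun v => ?c) => exact: dterm_const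
  | |- dterm _ (fun v => _ + _) => apply: dterm_add
  | |- dterm _ (fun v => - _) => apply: dterm_opp
  | |- dterm _ (fun v => `| _ |) => apply: dterm_abs
  end.

(** * Eventual properties at [0] from the right, finite minima, nested intervals *)

Section Auxiliary.
Variable R : realType.

(** Eventuality at [0] from the right, written with quantifiers over reals instead of filters so
    that it is visibly first-order. *)
Definition small (P : R -> Prop) := exists d : R, 0 < d /\ forall e, 0 < e < d -> P e.

Lemma small_and (P Q : R -> Prop) : small P -> small Q -> small (fun e => P e /\ Q e).
Proof.
move=> [d [d0 Hd]] [d' [d'0 Hd']]; exists (Num.min d d'); split.
  by rewrite lt_min d0.
by move=> e /andP[e0]; rewrite lt_min => /andP[ed ed']; split; [apply: Hd|apply: Hd']; rewrite e0.
Qed.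

Lemma small_mono (P Q : R -> Prop) : (forall e, 0 < e -> P e -> Q e) -> small P -> small Q.
Proof. by move=> PQ [d [d0 Hd]]; exists d; split=> // e e0; apply: PQ; [case/andP: e0|exact: Hd]. Qed.

Lemma small_true (P : R -> Prop) : (forall e, P e) -> small P.
Proof. by move=> h; exists 1; split. Qed.

Lemma small_lt c : 0 < c -> small (fun e => e < c).
Proof. by move=> c0; exists c; split=> // e /andP[]. Qed.

Lemma small_ex (P : R -> Prop) : small P -> exists e, 0 < e /\ P e.
Proof. by move=> [d [d0 Hd]]; exists (d / 2); split; [lra|apply: Hd; lra]. Qed.

Lemma small_seq (T : eqType) (s : seq T) (P : T -> R -> Prop) :
  (forall x, x \in s -> small (P x)) -> small (fun e => forall x, x \in s -> P x e).
Proof.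
elim: s => [|y s IH] h; first exact: small_true.
have [//|x xs|d [d0 Hd]] := small_and (h y _) (IH _).
- by rewrite mem_head.
- by apply: h; rewrite inE xs orbT.
exists d; split=> // e /Hd[Py Ps] x; rewrite inE => /orP[/eqP->//|]; exact: Ps.
Qed.

Lemma seq_minimal (T : eqType) (P : T -> Prop) (le : T -> T -> Prop) (s : seq T) :
  (forall x y z, le x y -> le y z -> le x z) ->
  (forall x y, P x -> P y -> le x y \/ le y x) ->
  (exists2 x, x \in s & P x) ->
  exists y, [/\ y \in s, P y & forall z, z \in s -> P z -> le y z].
Proof.
move=> tr tot; elim: s => [[]//|y s IH] [x xs Px].
have rf z : P z -> le z z by move=> Pz; case: (tot z z).
have [[x' x's Px']|none] := pselect (exists2 x, x \in s & P x); last first.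
  exists y; have xy : x = y.
    by move: xs; rewrite inE => /orP[/eqP//|xs]; case: none; exists x.
  split; first by rewrite mem_head.
    by rewrite -xy.
  move=> z; rewrite inE => /orP[/eqP -> ? |zs Pz]; first by apply: rf; rewrite -xy.
  by case: none; exists z.
have [|w [ws Pw Hw]] := IH; first by exists x'.
have [Py|nPy] := pselect (P y); last first.
  exists w; split=> //; first by rewrite inE ws orbT.
  by move=> z; rewrite inE => /orP[/eqP ->//|]; exact: Hw.
case: (tot y w Py Pw) => h.
  exists y; split=> //; first by rewrite mem_head.
  move=> z; rewrite inE => /orP[/eqP -> _|zs Pz]; first exact: rf.
  exact: tr h (Hw _ zs Pz).
exists w; split=> //; first by rewrite inE ws orbT.
by move=> z; rewrite inE => /orP[/eqP ->//|]; exact: Hw.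
Qed.

(** The point is the supremum of the left ends. Strict nesting puts it inside every open interval,
    and the last clause says that the left ends converge to it. *)
Lemma nested_point (l m : nat -> R) :
  (forall k, l k < l k.+1) -> (forall k, m k.+1 < m k) -> (forall k, l k < m k) ->
  exists a, (forall k, l k < a < m k) /\ forall z, z < a -> exists k, z < l k.
Proof.
move=> hl hm hlm.
have ml i j : (i <= j)%N -> l i <= l j.
  by apply: (nondecreasing_seqP l).1 => k; exact: ltW.
have mm i j : (i <= j)%N -> m j <= m i.
  by apply: (nonincreasing_seqP m).1 => k; exact: ltW.
have lm i j : l i < m j.
  have [ij|/ltnW ji] := leqP i j; first exact: le_lt_trans (ml _ _ ij) (hlm j).
  exact: lt_le_trans (hlm i) (mm _ _ ji).
have hs : has_sup (range l).
  split; first by exists (l 0%N), 0%N.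
  by exists (m 0%N) => _ [i _ <-]; exact: ltW.
exists (sup (range l)); have ne : range l !=set0 by exists (l 0%N), 0%N.
split=> [k|z /(sup_gt ne)[_ [k _ <-] zk]]; last by exists k.
apply/andP; split.
  by apply: lt_le_trans (hl k) _; apply: ub_le_sup; [case: hs|exists k.+1].
apply: le_lt_trans (hm k); apply: ge_sup; first by exists (l 0%N), 0%N.
by move=> _ [i _ <-]; exact: ltW.
Qed.

End Auxiliary.

(** * Coding relations on a dense set of order type omega by finitely many reals *)

Section Coding.
Variables (R : realType) (M : expansion R).

(* Plays the role of a definable dense set with a definable order of type omega: the
   smaller [t] has to be for [A t x], the later [x] comes in the order. *)
Definition dense_family (u0 u1 : R) (A : R -> R -> Prop) : Prop :=
  u0 < u1 /\
  [/\ dfn M (fun v => A (v 0%N) (v 1%N)),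
      forall t, exists s : seq R, forall x, A t x -> x \in s,
      forall s t x, 0 < s <= t -> A t x -> A s x,
      forall t x, A t x -> 0 < t /\ u0 < x < u1
    & forall p q, u0 <= p -> p < q -> q <= u1 -> exists t x, A t x /\ p < x < q].

Definition appears (A : R -> R -> Prop) (x : R) : Prop := exists t, A t x.

Definition no_later (A : R -> R -> Prop) (y x : R) : Prop :=
  appears A y /\ forall t, A t x -> A t y.

(** Among the finitely many points not later than [x], [v] is the nearest one to the left of [e]. *)
Definition left_record (A : R -> R -> Prop) (x e v : R) : Prop :=
  [/\ no_later A v x, v < e & forall w, no_later A w x -> ~ (v < w < e)].

(* At stage [x], the number [b] singles out the point [p] not later than [x] for which
   [G eps p] best approximates the difference of [b] and a point not later than [x]. *)
Definition pointer (A : R -> R -> Prop) (G : R -> R -> R) (x eps b p : R) : Prop :=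
  no_later A p x /\ exists y, no_later A y x /\
    forall y' p', no_later A y' x -> no_later A p' x -> p' <> p ->
      `|b - y - G eps p| < `|b - y' - G eps p'|.

(* The records [x >= x0] of [a] are the stages; at each of them [eps] is read off [e],
   and [b] and [c] point to the two components of a pair. *)
Definition decode A G (a e b c x0 p q : R) : Prop :=
  exists x, appears A x /\ x0 <= x /\ left_record A x a x /\
    exists v, left_record A x e v /\ pointer A G x (e - v) b p
                /\ pointer A G x (e - v) c q.

Section Fixed.
Variables (u0 u1 : R) (A : R -> R -> Prop) (G : R -> R -> R).
Hypothesis dA : dense_family u0 u1 A.
Hypothesis dG : dfn M (fun v => v 0%N = G (v 1%N) (v 2%N)).
Hypothesis G0 : forall x, u0 < x < u1 -> forall k, 0 < k ->
  small (fun eps => `|G eps x| < k).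
Hypothesis Gc : forall x, u0 < x < u1 -> small (fun eps =>
  forall k, 0 < k -> small (fun d => forall eps', `|eps' - eps| < d ->
    `|G eps' x - G eps x| < k)).
Hypothesis Gi : forall s : seq R, (forall x, x \in s -> u0 < x < u1) ->
  forall d, 0 < d -> exists eps, 0 < eps < d /\
    forall x y, x \in s -> y \in s -> x <> y -> G eps x <> G eps y.

Lemma dfn_appears : dfn M (fun v => appears A (v 0%N)).
Proof. by case: dA => _ [dfA _ _ _ _]; rewrite /appears; ddec. Qed.

Lemma dfn_no_later : dfn M (fun v => no_later A (v 0%N) (v 1%N)).
Proof.
have d1 := dfn_appears; case: dA => _ [dfA _ _ _ _]; rewrite /no_later; ddec.
Qed.

Lemma dfn_left_record : dfn M (fun v => left_record A (v 0%N) (v 1%N) (v 2%N)).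
Proof.
have d1 := dfn_no_later.
apply: (@dfn_ext _ _ _ (fun v => no_later A (v 2%N) (v 0%N) /\ v 2%N < v 1%N /\
  forall w, no_later A w (v 0%N) -> ~ (v 2%N < w < v 1%N))).
  by move=> v; split=> [[]|[? []]].
by ddec.
Qed.

Lemma dfn_decode a e b c x0 : dfn M (fun v => decode A G a e b c x0 (v 0%N) (v 1%N)).
Proof.
have d1 := dfn_no_later; have d2 := dfn_left_record; have d3 := dfn_appears.
by rewrite /decode /pointer; ddec.
Qed.


Lemma no_later_appears y x : no_later A y x -> appears A y.
Proof. by case. Qed.

Lemma appears_bd y : appears A y -> u0 < y < u1.
Proof. by case: dA => _ [_ _ _ hU _] [t /hU[]]. Qed.

Lemma no_later_bd y x : no_later A y x -> u0 < y < u1.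
Proof. by move/no_later_appears/appears_bd. Qed.

Lemma no_later_trans x y z : no_later A x y -> no_later A y z -> no_later A x z.
Proof. by move=> [ax hx] [ay hy]; split=> // t /hy/hx. Qed.

(** The levels [t] with [A t x] form an initial segment of the positive reals, and initial segments
    are nested. *)
Lemma no_later_total x y : appears A x -> appears A y -> no_later A x y \/ no_later A y x.
Proof.
move=> ax ay.
have [h|] := pselect (forall t, A t y -> A t x); first by left.
move=> /existsNP[t /not_implyP[ty tx]]; right; split=> // t' t'x.
case: (dA) => _ [_ _ anti hU _].
have [[t0 _] [t'0 _]] := (hU _ _ ty, hU _ _ t'x).
apply: (anti _ _ _ _ ty); rewrite t'0 leNgt; apply/negP => /ltW tt'.
by apply: tx; apply: anti t'x; rewrite t0.
Qed.

Lemma no_later_seq x : appears A x ->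
  exists s : seq R, forall y, (y \in s) <-> no_later A y x.
Proof.
case: dA => _ [_ fin _ _ _] [t tx]; have [s hs] := fin t.
exists [seq y <- s | `[< no_later A y x >]] => y.
rewrite mem_filter; split=> [/andP[/asboolP//]|h].
by apply/andP; split; [apply/asboolP|apply: hs; apply h.2].
Qed.

Definition separating x eps :=
  (forall y p y' p', no_later A y x -> no_later A p x -> no_later A y' x ->
    no_later A p' x -> p' <> p -> y + G eps p <> y' + G eps p') /\
  forall p, no_later A p x -> forall k, 0 < k -> small (fun d =>
    forall eps', `|eps' - eps| < d -> `|G eps' p - G eps p| < k).

(** The sums with [p' <> p] are more than [r] away from [y + G eps p]. Moving [b] and all values of
    [G] by less than [r / 4] leaves the distance to the right sum below [r / 2] and the other
    distances above it. *)
Lemma pointer_near x eps y p : appears A x -> separating x eps ->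
  no_later A y x -> no_later A p x ->
  small (fun d => forall eps' b, `|eps' - eps| < d -> `|b - (y + G eps p)| < d ->
    pointer A G x eps' b p).
Proof.
move=> ax [inj cont] yx px; have [s hs] := no_later_seq ax.
have [r [r0 Hr]] : exists r, 0 < r /\ forall y', y' \in s -> forall p', p' \in s ->
    p' <> p -> r < `|y + G eps p - (y' + G eps p')|.
  apply: small_ex; apply: small_seq => y' y's; apply: small_seq => p' p's.
  have [->|ne] := pselect (p' = p); first exact: small_true.
  apply: (small_mono (P := fun e => e < `|y + G eps p - (y' + G eps p')|)).
    by move=> e.
  apply: small_lt; rewrite normr_gt0 subr_eq0; apply/eqP.
  by apply: inj => //; apply/hs.
have r4 : 0 < r / 4 by lra.
have sm : small (fun d => forall p', p' \in s -> forall eps', `|eps' - eps| < d ->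
    `|G eps' p' - G eps p'| < r / 4).
  by apply: small_seq => p' /hs p's; exact: cont.
apply: small_mono (small_and sm (small_lt r4)) => d _ [Hd dr] eps' b he hb.
split=> //; exists y; split=> // y' p' y'x p'x ne.
have /hs y's := y'x; have /hs p's := p'x; have /hs ps := px.
have := Hr _ y's _ p's ne; have := Hd _ p's _ he; have := Hd _ ps _ he.
have {hb} : `|b - (y + G eps p)| < r / 4 by lra.
set g := G eps p; set g' := G eps' p; set k := G eps p'; set k' := G eps' p'.
move=> /ltr_normlP[a1 a2] /ltr_normlP[b1 b2] /ltr_normlP[c1 c2].
rewrite ltr_normr => h.
apply: (@lt_trans _ _ (r / 2)).
  by rewrite ltr_norml; lra.
by rewrite ltr_normr; case/orP: h => h; apply/orP; [left|right]; lra.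
Qed.

(** Let [r] be a lower bound for the gaps between points not later than [x]. Once all [|G eps p|]
    are below [r / 2], equal sums [y + G eps p] have equal [y], and injectivity of [G eps] on the
    finite set gives equal [p]. *)
Lemma separating_ex x d : appears A x -> 0 < d ->
  exists eps, [/\ 0 < eps < d, separating x eps & forall p, no_later A p x -> `|G eps p| < d].
Proof.
move=> ax d0; have [s hs] := no_later_seq ax.
have [r [r0 Hr]] : exists r, 0 < r /\ forall y, y \in s -> forall y', y' \in s ->
    y <> y' -> r < `|y - y'|.
  apply: small_ex; apply: small_seq => y' y's; apply: small_seq => p' p's.
  have [->|ne] := pselect (y' = p'); first exact: small_true.
  apply: (small_mono (P := fun e => e < `|y' - p'|)) => //.
  by apply: small_lt; rewrite normr_gt0 subr_eq0; apply/eqP.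
have r2 : 0 < r / 2 by lra.
have s1 : small (fun e => forall p, p \in s -> `|G e p| < r / 2).
  by apply: small_seq => p /hs/no_later_bd px; apply: G0.
have s2 : small (fun e => forall p, p \in s -> `|G e p| < d).
  by apply: small_seq => p /hs/no_later_bd px; apply: G0.
have s3 : small (fun e => forall p, p \in s -> forall k, 0 < k -> small (fun d =>
    forall eps', `|eps' - e| < d -> `|G eps' p - G e p| < k)).
  by apply: small_seq => p /hs/no_later_bd px; apply: Gc.
have [t [t0 Ht]] := small_and s1 (small_and s2 (small_and s3 (small_lt d0))).
have [|eps [/andP[e0 et] inj]] := Gi (s := s) _ t0.
  by move=> y /hs/no_later_bd.
have [|h1 [h2 [h3 h4]]] := Ht eps; first by rewrite e0.
exists eps; split; first by rewrite e0.
  split=> [y p y' p' /hs ys /hs ps /hs y's /hs p's ne|p /hs]; last exact: h3.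
  have [<- /addrI/inj|yy'] := pselect (y = y').
    by move=> h; apply: ne; apply: contrapT => ne; apply: (h ps p's) => // ?; apply: ne.
  have := Hr _ ys _ y's yy'; have := h1 _ ps; have := h1 _ p's.
  move=> /ltr_normlP[a1 a2] /ltr_normlP[b1 b2].
  by rewrite ltr_normr => /orP[h|h] h'; lra.
by move=> p /hs; exact: h2.
Qed.

(** Take [e] near [v + eps], [b] near [y2 + G eps p] and [c] near [y3 + G eps q] for a small
    separating [eps]. No point not later than [x] lies between [v] and [e], so [v] is read off [e],
    then [e - v] approximates [eps], and [b] and [c] point to [p] and [q]. All of this survives
    small changes of the three parameters. *)
Lemma readout x l1 m1 l2 m2 l3 m3 v y2 y3 p q : appears A x ->
  no_later A v x -> l1 < v < m1 ->
  no_later A y2 x -> l2 < y2 < m2 ->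
  no_later A y3 x -> l3 < y3 < m3 ->
  no_later A p x -> no_later A q x ->
  exists l1' m1' l2' m2' l3' m3', [/\ l1 < l1' /\ l1' < m1' < m1,
      l2 < l2' /\ l2' < m2' < m2, l3 < l3' /\ l3' < m3' < m3 &
    forall e b c, l1' < e < m1' -> l2' < b < m2' -> l3' < c < m3' ->
      exists v', left_record A x e v' /\
        pointer A G x (e - v') b p /\ pointer A G x (e - v') c q].
Proof.
move=> ax vx /andP[lv vm] y2x /andP[ly2 ym2] y3x /andP[ly3 ym3] px qx.
have [s hs] := no_later_seq ax.
have sp (a b : R) : a < b -> 0 < b - a by lra.
have sg : small (fun d => forall w, w \in s -> v < w -> v + 2 * d < w).
  apply: small_seq => w ws; have [vw|vw] := ltP v w; last exact: small_true.
  have /small_lt : 0 < (w - v) / 2 by lra.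
  by apply: small_mono => e e0 h _; lra.
have [th [th0 [g [h1 [h2 [h3 [h4 h5]]]]]]] := small_ex (small_and sg (small_and
  (small_lt (sp _ _ vm)) (small_and (small_lt (sp _ _ ly2)) (small_and (small_lt (sp _ _ ym2))
  (small_and (small_lt (sp _ _ ly3)) (small_lt (sp _ _ ym3))))))).
have [eps [/andP[e0 eth] sep Gsm]] := separating_ex ax th0.
have gp := Gsm _ px; have gq := Gsm _ qx.
move/ltr_normlP: gp => [gp1 gp2]; move/ltr_normlP: gq => [gq1 gq2].
pose b0 := y2 + G eps p; pose c0 := y3 + G eps q.
have e1 : 0 < m1 - v - eps by lra.
have b1 : 0 < b0 - l2 by rewrite /b0; lra.
have b2 : 0 < m2 - b0 by rewrite /b0; lra.
have c1 : 0 < c0 - l3 by rewrite /c0; lra.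
have c2 : 0 < m3 - c0 by rewrite /c0; lra.
clear vm ly2 ym2 ly3 ym3 gp1 gp2 gq1 gq2 h2 h3 h4 h5.
have [d [d0 [P2 [P3 [k1 [k2 [k3 [k4 [k5 k6]]]]]]]]] := small_ex (small_and
  (pointer_near ax sep y2x px) (small_and (pointer_near ax sep y3x qx)
  (small_and (small_lt e0) (small_and (small_lt e1) (small_and (small_lt b1)
  (small_and (small_lt b2) (small_and (small_lt c1) (small_lt c2)))))))).
exists (v + eps - d), (v + eps + d), (b0 - d), (b0 + d), (c0 - d), (c0 + d).
split=> //; try by clear P2 P3 g Gsm sep; split; lra.
move=> e b c he hb hc; exists v; split.
  split=> //; first by lra.
  by move=> w /hs ws /andP[vw we]; have := g _ ws vw; lra.
have he' : `|e - v - eps| < d by rewrite -addrA -opprD ltr_distl.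
have hb' : `|b - b0| < d by rewrite ltr_distl.
have hc' : `|c - c0| < d by rewrite ltr_distl.
by split; [apply: P2|apply: P3].
Qed.

Lemma appears_dense a b : a < b -> u0 <= a -> b <= u1 -> exists x, appears A x /\ a < x < b.
Proof.
move=> ab a0 b1; case: dA => _ [_ _ _ _ dns].
by have [t [x [tx xab]]] := dns _ _ a0 ab b1; exists x; split=> //; exists t.
Qed.

(** Some finite level [t] contains all of [T], and [eta] is so small that no point of this level
    lies in [(x, x + eta)]. The earliest point [x'] of that interval therefore comes after all of
    [T], and no point of [(x, x')] precedes it. The bound [m'] excludes from [(x', m')] everything
    not later than [x']. *)
Lemma next_stage x m0 (T : seq R) : appears A x -> x < m0 -> m0 <= u1 ->
  (forall w, w \in T -> appears A w) ->
  exists x' m', [/\ x < x', x' < m' < m0, appears A x' &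
    [/\ forall y, no_later A y x' -> ~ (x' < y < m'),
       forall w, w \in T -> no_later A w x'
     & forall z, appears A z -> x < z < x' -> no_later A x' z]].
Proof.
move=> ax xm m0u hT; case: (dA) => u01 [_ fin anti hU _].
have [t [t0 Ht]] : exists t, 0 < t /\ forall w, w \in T -> A t w.
  apply: small_ex; apply: small_seq => w wT; have [t tw] := hT _ wT.
  have [t0 _] := hU _ _ tw; apply: small_mono (small_lt t0) => e e0 et.
  by apply: anti tw; rewrite e0 ltW.
have [s hs] := fin t.
have sp : 0 < m0 - x by lra.
have [eta [eta0 [h1 h2]]] : exists eta, 0 < eta /\ eta < m0 - x /\
    forall w, w \in s -> x < w -> x + eta < w.
  apply: small_ex; apply: small_and; first exact: small_lt.
  apply: small_seq => w ws; have [vw|vw] := ltP x w; last exact: small_true.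
  have /small_lt : 0 < (w - x) by lra.
  by apply: small_mono => e e0 h _; lra.
have [z [az /andP[xz zx]]] : exists z, appears A z /\ x < z < x + eta.
  by apply: appears_dense; try lra; have /andP[/ltW] := appears_bd ax.
have [sz hsz] := no_later_seq az.
(* An earliest point exists because only the finitely many points not later than [z] compete. *)
have [|||x' [x's [/andP[xx' x'x] ax'] hmin]] :=
    @seq_minimal R (fun w => x < w < x + eta /\ appears A w) (no_later A) sz.
- by move=> a b c; exact: no_later_trans.
- by move=> a b [_ aa] [_ ab]; exact: no_later_total.
- by exists z; [apply/hsz; split|split=> //; rewrite xz zx].
have mn w : appears A w -> x < w < x + eta -> no_later A x' w.
  move=> aw wx; have [wz|zw] := no_later_total aw az; first by apply: hmin => //; exact/hsz.
  by apply: no_later_trans zw; exact/hsz.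
have [s' hs'] := no_later_seq ax'.
have sp' : 0 < (m0 - x') by lra.
have [r [r0 [r1 r2]]] : exists r, 0 < r /\ r < m0 - x' /\
    forall w, w \in s' -> x' < w -> x' + r < w.
  apply: small_ex; apply: small_and; first exact: small_lt.
  apply: small_seq => w ws; have [vw|vw] := ltP x' w; last exact: small_true.
  have /small_lt : 0 < (w - x') by lra.
  by apply: small_mono => e e0 h _; lra.
exists x', (x' + r); split=> //; first by lra.
split.
- by move=> y /hs' ys /andP[x'y yr]; have := r2 _ ys x'y; lra.
- move=> w wT; split; first exact: hT.
  move=> t' t'x'; apply: (anti _ _ _ _ (Ht _ wT)); have [t'0 _] := hU _ _ t'x'.
  rewrite t'0 leNgt; apply/negP => /ltW tt'.
  by have := h2 x' (hs _ (anti _ _ _ _ t'x')); rewrite t0 tt' => /(_ isT xx'); lra.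
- by move=> w aw /andP[xw wx']; apply: mn => //; rewrite xw; lra.
Qed.

(** The levels [1 / (n + 1)] are finite and exhaust the points that appear, so positions in them
    give codes for pairs; codes of pairs outside [S] are sent to a default pair in [S]. *)
Lemma pairs_enum (S : R -> R -> Prop) :
  (forall p q, S p q -> appears A p /\ appears A q) -> (exists p q, S p q) ->
  exists e : nat -> R * R, (forall k, S (e k).1 (e k).2) /\
    forall p q, S p q -> exists k, e k = (p, q).
Proof.
move=> hS [p0 [q0 pq0]]; case: dA => _ [_ fin anti hU _].
have /choice[sq hsq] : forall n : nat, exists s : seq R, forall x, A (n.+1%:R^-1) x -> x \in s.
  by move=> n; exact: fin.
have ix p : appears A p -> exists i j, nth 0 (sq i) j = p.
  move=> [t tp]; have [t0 _] := hU _ _ tp.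
  have [n] := ltr_add_invr (y := 0) (x := t) t0; rewrite add0r => nt.
  have /hsq ps : A n.+1%:R^-1 p by apply: anti tp; rewrite invr_gt0 ltr0n ltW.
  by exists n, (index p (sq n)); rewrite nth_index.
pose dflt (o : R * R) := if `[< S o.1 o.2 >] then o else (p0, q0).
exists (fun n => if unpickle n is Some (i, j, (k, l))
                 then dflt (nth 0 (sq i) j, nth 0 (sq k) l) else (p0, q0)); split.
  move=> n; case: unpickle => [[[i j] [k l]]|//].
  by rewrite /dflt; case: asboolP.
move=> p q pq; have [/ix[i [j hp]] /ix[k [l hq]]] := hS _ _ pq.
exists (pickle (i, j, (k, l))); rewrite pickleK /= hp hq /dflt /=.
by case: asboolP.
Qed.

(* Nested intervals for the parameters [a], [e], [b], [c]; [lo0] is the current record of [a]. *)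
Record stage := Stage
  { lo0 : R; hi0 : R; lo1 : R; hi1 : R; lo2 : R; hi2 : R; lo3 : R; hi3 : R }.

Definition inside (st st' : stage) : Prop :=
  [/\ lo0 st < lo0 st' /\ hi0 st' < hi0 st, lo1 st < lo1 st' /\ hi1 st' < hi1 st,
      lo2 st < lo2 st' /\ hi2 st' < hi2 st & lo3 st < lo3 st' /\ hi3 st' < hi3 st].

(** The invariant under which [readout] applies: each parameter interval still contains a point not
    later than the current record, and so does the list of the two points to be coded next. *)
Definition valid (st : stage) (p q : R) : Prop :=
  [/\ appears A (lo0 st) /\ (forall y, no_later A y (lo0 st) -> ~ (lo0 st < y < hi0 st)),
      lo0 st < hi0 st <= u1,
      u0 <= lo1 st /\ hi1 st <= u1 /\ exists v, no_later A v (lo0 st) /\ lo1 st < v < hi1 st,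
      u0 <= lo2 st /\ hi2 st <= u1 /\ exists v, no_later A v (lo0 st) /\ lo2 st < v < hi2 st
    & u0 <= lo3 st /\ hi3 st <= u1 /\ exists v, no_later A v (lo0 st) /\ lo3 st < v < hi3 st] /\
  (no_later A p (lo0 st) /\ no_later A q (lo0 st)).

(** The second clause ensures that no point strictly between two consecutive records is itself a
    record of [a]. *)
Definition follows (st st' : stage) (p q : R) : Prop :=
  [/\ inside st st',
      forall z, appears A z -> lo0 st < z < lo0 st' -> no_later A (lo0 st') z
    & forall e b c, lo1 st' < e < hi1 st' -> lo2 st' < b < hi2 st' -> lo3 st' < c < hi3 st' ->
      exists v', left_record A (lo0 st) e v' /\
        pointer A G (lo0 st) (e - v') b p /\ pointer A G (lo0 st) (e - v') c q].

(* The next record is taken so close to the current one that it comes later than all the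
   points that the intervals have to contain. *)
Lemma advance st p q p' q' : valid st p q -> appears A p' -> appears A q' ->
  exists st', valid st' p' q' /\ follows st st' p q.
Proof.
case: st => x m0 l1 m1 l2 m2 l3 m3 [[/= [ax nx] /andP[xm mu] [l1u [m1u [v [vx lv]]]]
  [l2u [m2u [y2 [y2x ly2]]]] [l3u [m3u [y3 [y3x ly3]]]]] [px qx]] ap' aq'.
have [l1' [m1' [l2' [m2' [l3' [m3' [[h1 /andP[lm1 h1']] [h2 /andP[lm2 h2']]
  [h3 /andP[lm3 h3']] hr]]]]]]] := readout ax vx lv y2x ly2 y3x ly3 px qx.
have inU l l' m m' : u0 <= l -> l < l' -> l' < m' -> m' < m -> m <= u1 ->
    [/\ u0 <= l', m' <= u1 & exists w, appears A w /\ l' < w < m'].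
  move=> ul ll' lm' mm' mu1.
  have ul' : u0 <= l' by exact: le_trans ul (ltW ll').
  have mu' : m' <= u1 by exact: le_trans (ltW mm') mu1.
  by split=> //; exact: appears_dense.
have [ul1 mu1 [v' [av' hv']]] := inU _ _ _ _ l1u h1 lm1 h1' m1u.
have [ul2 mu2 [y2' [ay2' hy2']]] := inU _ _ _ _ l2u h2 lm2 h2' m2u.
have [ul3 mu3 [y3' [ay3' hy3']]] := inU _ _ _ _ l3u h3 lm3 h3' m3u.
have [|x' [m0' [xx' /andP[xm' m0'm0] ax' [n1 n2 n3]]]] :=
  @next_stage x m0 [:: v'; y2'; y3'; p'; q'] ax xm mu.
  by move=> w; rewrite !inE => /orP[/eqP->//|/orP[/eqP->//|/orP[/eqP->//|/orP[/eqP->//|/eqP->//]]]].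
exists (Stage x' m0' l1' m1' l2' m2' l3' m3'); split; last by split.
split; last by split; apply: n2; rewrite !inE eqxx ?orbT.
split=> //=; first by rewrite xm' (le_trans (ltW m0'm0)).
- by do 2 split=> //; exists v'; split=> //; apply: n2; rewrite !inE eqxx ?orbT.
- by do 2 split=> //; exists y2'; split=> //; apply: n2; rewrite !inE eqxx ?orbT.
- by do 2 split=> //; exists y3'; split=> //; apply: n2; rewrite !inE eqxx ?orbT.
Qed.

Lemma valid_start p q : appears A p -> appears A q -> exists st, valid st p q.
Proof.
move=> ap aq; have [u01 _] := dA.
have [x [ax /andP[ux xu]]] : exists x, appears A x /\ u0 < x < u1 by exact: appears_dense.
have [|x' [m0' [xx' /andP[xm' m0'm0] ax' [n1 n2 n3]]]] :=
  @next_stage x u1 [:: x; p; q] ax xu (lexx _).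
  by move=> w; rewrite !inE => /orP[/eqP->//|/orP[/eqP->//|/eqP->//]].
exists (Stage x' m0' u0 u1 u0 u1 u0 u1).
have hx : exists v, no_later A v x' /\ u0 < v < u1.
  by exists x; split; [apply: n2; rewrite mem_head|rewrite ux].
split; last by split; apply: n2; rewrite !inE eqxx ?orbT.
by split=> //=; rewrite xm' ltW.
Qed.

Lemma pointer_uniq x eps b p q : pointer A G x eps b p -> pointer A G x eps b q -> p = q.
Proof.
move=> [px [y [yx hy]]] [qx [z [zx hz]]]; apply: contrapT => ne.
have := hy _ _ zx qx (fun h => ne (esym h)).
by have := hz _ _ yx px ne => h1 h2; have := lt_trans h1 h2; rewrite ltxx.
Qed.

Lemma left_record_uniq x e v w : left_record A x e v -> left_record A x e w -> v = w.
Proof.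
move=> [vx ve hv] [wx we hw]; apply/eqP; rewrite eq_le !leNgt.
by apply/andP; split; apply/negP => h; [apply: (hw _ vx)|apply: (hv _ wx)]; rewrite h.
Qed.

(** Nested stages following an enumeration of [S] converge to four reals. The records of [a] from
    [lo0 (st 0)] on are exactly the [lo0 (st k)], and at the [k]-th of them the other three reals
    decode to the [k]-th pair. *)
Lemma coding (S : R -> R -> Prop) :
  (forall p q, S p q -> appears A p /\ appears A q) ->
  dfn M (fun v => S (v 0%N) (v 1%N)).
Proof.
move=> hS.
have [neS|eS] := pselect (exists p q, S p q); last first.
  apply: dfn_ext (dfn_cst M False) => v; split=> // s.
  by apply: eS; exists (v 0%N), (v 1%N).
have [e [eS eE]] := pairs_enum hS neS.
have [apk aqk] : (forall k, appears A (e k).1) /\ (forall k, appears A (e k).2).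
  by split=> k; have [] := hS _ _ (eS k).
have [st0 v0] := valid_start (apk 0%N) (aqk 0%N).
(* The index is part of the state because the pair to be coded depends on it. *)
pose T := {ks : nat * stage | valid ks.2 (e ks.1).1 (e ks.1).2}.
pose rel (a b : T) := (sval b).1 = (sval a).1.+1 /\
  follows (sval a).2 (sval b).2 (e (sval a).1).1 (e (sval a).1).2.
have [|f [f0 frel]] := @dependent_choice T rel _ (exist _ (0%N, st0) v0).
  move=> [[k st] /= vk].
  have /cid[st' [v' fl]] := advance vk (apk k.+1) (aqk k.+1).
  by exists (exist _ (k.+1, st') v').
have fk k : (sval (f k)).1 = k.
  by elim: k => [|k IH]; [rewrite f0|have [-> _] := frel k; rewrite IH].
pose st k := (sval (f k)).2.
have vk k : valid (st k) (e k).1 (e k).2 by have := svalP (f k); rewrite fk.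
have fl k : follows (st k) (st k.+1) (e k).1 (e k).2.
  by have [_] := frel k; rewrite fk.
have [a [ha sa]] : exists a, (forall k, lo0 (st k) < a < hi0 (st k)) /\
    forall z, z < a -> exists k, z < lo0 (st k).
  apply: nested_point => k; [|by case: (fl k) => -[[]]..|].
    by case: (fl k) => -[[]].
  by case: (vk k) => -[_ /andP[]].
have [x [hx _]] : exists a, (forall k, lo1 (st k) < a < hi1 (st k)) /\
    forall z, z < a -> exists k, z < lo1 (st k).
  apply: nested_point => k; try by case: (fl k) => -[_ []].
  by case: (vk k) => -[_ _ [_ [_ [v [_ /andP[h h']]]]]] _ _ _; exact: lt_trans h h'.
have [b [hb _]] : exists a, (forall k, lo2 (st k) < a < hi2 (st k)) /\
    forall z, z < a -> exists k, z < lo2 (st k).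
  apply: nested_point => k; try by case: (fl k) => -[_ _ []].
  by case: (vk k) => -[_ _ _ [_ [_ [v [_ /andP[h h']]]]]] _ _; exact: lt_trans h h'.
have [c [hc _]] : exists a, (forall k, lo3 (st k) < a < hi3 (st k)) /\
    forall z, z < a -> exists k, z < lo3 (st k).
  apply: nested_point => k; try by case: (fl k) => -[_ _ _ []].
  by case: (vk k) => -[_ _ _ _ [_ [_ [v [_ /andP[h h']]]]]] _; exact: lt_trans h h'.
apply: dfn_ext (dfn_decode a x b c (lo0 (st 0%N))) => w.
have rec k : left_record A (lo0 (st k)) a (lo0 (st k)).
  case: (vk k) => -[[ak nk] _ _ _ _] _; have /andP[h1 h2] := ha k.
  split=> // y /nk ny /andP[y1 y2]; apply: ny.
  by rewrite y1 (lt_trans y2).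
have mono k : lo0 (st 0%N) <= lo0 (st k).
  elim: k => // k IH; apply: le_trans IH _; apply: ltW.
  by case: (fl k) => -[[]].
have rd k : exists v', left_record A (lo0 (st k)) x v' /\
    pointer A G (lo0 (st k)) (x - v') b (e k).1 /\ pointer A G (lo0 (st k)) (x - v') c (e k).2.
  by case: (fl k) => _ _; apply.
split=> [/eE[k ek]|].
  exists (lo0 (st k)); split; first by case: (vk k) => -[[]].
  split; first exact: mono.
  by split; first exact: rec; have := rd k; rewrite ek.
move=> [z [az [s0z [zrec [v [zv [zp zq]]]]]]].
suff [k zk] : exists k, z = lo0 (st k).
  have [v' [v'r [v'p v'q]]] := rd k.
  have vv' : v = v' by apply: left_record_uniq zv _; rewrite zk.
  move: zp zq; rewrite vv' zk => zp zq.
  by rewrite (pointer_uniq zp v'p) (pointer_uniq zq v'q); exact: eS.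
(* Any other record [z] would lie above every [lo0 (st k)], by induction, whereas these converge to
   [a > z]. *)
apply: contrapT => nz.
have za : z < a by case: zrec.
have below k : lo0 (st k) < z.
  elim: k => [|k IH]; rewrite lt_neqAle; apply/andP; split => //.
  - by apply/eqP => h; apply: nz; exists 0%N.
  - by apply/eqP => h; apply: nz; exists k.+1.
  rewrite leNgt; apply/negP => zk1; case: (fl k) => _ /(_ z az) h _.
  case: zrec => _ _ /(_ (lo0 (st k.+1))) nr.
  by apply: nr; [apply: h; rewrite IH|rewrite zk1; case/andP: (ha k.+1)].
have [k zk] := sa _ za.
by have := lt_trans zk (below k); rewrite ltxx.
Qed.
End Fixed.
End Coding.

(** * A definable quadratic function from a dense order of type omega *)

Section CodingC2.
Variables (R : realType) (M : expansion R).

Lemma definable_fun1E (I : set R) f :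
  definable_fun1 M I f <-> dfn M (fun v => I (v 0%N) /\ v 1%N = f (v 0%N)).
Proof.
rewrite /definable_fun1 dfn_definable; split; apply: dfn_ext => v /=; by rewrite !mxE.
Qed.

Lemma definable_fun2E (I : set R) op : definable_fun2 M I op <->
  dfn M (fun v => [/\ I (v 0%N), I (v 1%N) & v 2%N = op (v 0%N) (v 1%N)]).
Proof.
rewrite /definable_fun2 dfn_definable; split; apply: dfn_ext => v /=; by rewrite !mxE.
Qed.

Definition has_C2_nonaffine : Prop :=
  exists (I : set R) (f : R -> R),
    [/\ bounded_open_interval I, definable_fun1 M I f, C2 I f & ~ affine_on I f].

Lemma quadratic_C2 (a b c : R) (I : set R) : C2 I (fun t => a + b * ((t - c) * (t - c))).
Proof.
set f := fun t => _.
have df (x : R) : is_derive x 1 f (b * (2 * (x - c))).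
  apply: is_derive_eq; rewrite /= /GRing.scale /=; ring.
have f1 : f^`()%classic = fun x => b * (2 * (x - c)).
  by apply/funext => x; rewrite derive1E derive_val.
have df1 (x : R) : is_derive x 1 (f^`()%classic) (b * 2).
  rewrite f1; apply: is_derive_eq; rewrite /= /GRing.scale /=; ring.
split=> [x _|x _|]; [by apply: ex_derive|by apply: ex_derive|].
have -> : f^`(2)%classic = cst (b * 2).
  by apply/funext => x; rewrite /= derive1E derive_val.
by move=> x; exact: cst_continuous.
Qed.

(** The quadratic function [f] maps [(u0, u1)] increasingly into itself. The relation [q < f p]
    between points of the dense set is definable by [coding], and [f] is recovered from it by
    monotonicity and continuity. *)
Lemma coding_C2 u0 u1 A G : dense_family M u0 u1 A ->
  dfn M (fun v => v 0%N = G (v 1%N) (v 2%N)) ->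
  (forall x, u0 < x < u1 -> forall k, 0 < k -> small (fun eps => `|G eps x| < k)) ->
  (forall x, u0 < x < u1 -> small (fun eps =>
    forall k, 0 < k -> small (fun d => forall eps', `|eps' - eps| < d ->
      `|G eps' x - G eps x| < k))) ->
  (forall s : seq R, (forall x, x \in s -> u0 < x < u1) ->
    forall d, 0 < d -> exists eps, 0 < eps < d /\
      forall x y, x \in s -> y \in s -> x <> y -> G eps x <> G eps y) ->
  has_C2_nonaffine.
Proof.
move=> dA dG G0 Gc Gi; have [u01 _] := dA.
pose w := u1 - u0.
have w0 : 0 < w by rewrite /w; lra.
pose f t := u0 + w^-1 * ((t - u0) * (t - u0)).
have fsq t : w * (f t - u0) = (t - u0) * (t - u0) by rewrite /f; field; rewrite gt_eqF.
have f_lt s t : u0 < s -> s < t -> f s < f t.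
  move=> us st; rewrite -subr_gt0 -(pmulr_rgt0 _ w0).
  have -> : w * (f t - f s) = (t - s) * ((t - u0) + (s - u0)).
    have -> : w * (f t - f s) = w * (f t - u0) - w * (f s - u0) by ring.
    by rewrite !fsq; ring.
  by apply: mulr_gt0; lra.
have f_U t : u0 < t < u1 -> u0 < f t < u1.
  move=> /andP[t0 t1]; apply/andP; split.
    by rewrite -subr_gt0 -(pmulr_rgt0 _ w0) fsq; apply: mulr_gt0; lra.
  rewrite -subr_gt0 -(pmulr_rgt0 _ w0).
  have -> : w * (u1 - f t) = (u1 - t) * (w + (t - u0)).
    have -> : w * (u1 - f t) = w * w - w * (f t - u0) by rewrite /w; ring.
    by rewrite fsq /w; ring.
  by apply: mulr_gt0; lra.
have f_cont : continuous f.
  move=> t; apply: cvgD; first exact: cvg_cst.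
  apply: cvgM; first exact: cvg_cst.
  by apply: cvgM; apply: cvgB; [exact: cvg_id|exact: cvg_cst|exact: cvg_id|exact: cvg_cst].
have f_near t k : 0 < k -> small (fun d => f (t + d) < f t + k) /\ small (fun d => f t - k < f (t - d)).
  move=> k0; have /cvgrPdist_lt/(_ _ k0)[d /= d0 hd] := f_cont t.
  split; exists d; split=> // e /andP[e0 ed].
    suff /ltr_normlP[] : `|f t - f (t + e)| < k by lra.
    by apply: hd; rewrite /ball /= opprD addNKr normrN gtr0_norm.
  suff /ltr_normlP[] : `|f t - f (t - e)| < k by lra.
  by apply: hd; rewrite /ball /= opprB addrC subrK gtr0_norm.
pose S p q := [/\ appears A p, appears A q & q < f p].
have dS : dfn M (fun v => S (v 0%N) (v 1%N)).
  by apply: (coding dA dG G0 Gc Gi) => p q [].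
have dE := dfn_appears dA.
(* [f x] is the cut determined by the values of [f] at dense points on both sides of [x]. *)
have fE x y : u0 < x < u1 -> y = f x <-> forall p q, appears A p -> appears A q ->
    (p < x -> S p q -> q < y) /\ (x < p -> ~ S p q -> y <= q).
  move=> xU; have /andP[x0 x1] := xU; have /andP[fx0 fx1] := f_U _ xU.
  split=> [-> p q ap aq|h].
    have pU := appears_bd dA ap; have /andP[p0 _] := pU.
    split=> [px [_ _ qp]|xp nS]; first exact: lt_trans qp (f_lt _ _ p0 px).
    apply: ltW; apply: lt_le_trans (f_lt _ _ x0 xp) _.
    by rewrite leNgt; apply/negP => qp; apply: nS.
  apply/eqP; rewrite eq_le !leNgt; apply/andP; split; apply/negP => lt.
    have [|||q [aq /andP[q0 q1]]] := appears_dense dA (a := f x) (b := Num.min y u1).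
    - by rewrite lt_min lt.
    - lra.
    - by rewrite ge_min lexx orbT.
    have k0 : 0 < q - f x by lra.
    have x10 : 0 < u1 - x by lra.
    have [d [d0 [hd d1]]] := small_ex (small_and (f_near x _ k0).1 (small_lt x10)).
    have xd : x < x + d by rewrite ltrDl.
    have xdu : x + d < u1 by rewrite -ltrBrDl.
    have [p [ap /andP[p0 p1]]] := appears_dense dA xd (ltW x0) (ltW xdu).
    have [_] := h p q ap aq; move=> /(_ p0) hp.
    move: q1; rewrite lt_min => /andP[q1 _]; move: q1; rewrite ltNge => /negP; apply.
    apply: hp => -[_ _ qp].
    have := f_lt p (x + d) (lt_trans x0 p0) p1; clear -qp hd; lra.
  have [|||q [aq /andP[q0 q1]]] := appears_dense dA (a := Num.max y u0) (b := f x).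
  - by rewrite gt_max lt.
  - by rewrite le_max lexx orbT.
  - lra.
  have k0 : 0 < f x - q by lra.
  have x10 : 0 < x - u0 by lra.
  have [d [d0 [hd d1]]] := small_ex (small_and (f_near x _ k0).2 (small_lt x10)).
  have xd : x - d < x by rewrite ltrBlDr ltrDl.
  have xdu : u0 < x - d by rewrite ltrBrDr -ltrBrDl.
  have [p [ap /andP[p0 p1]]] := appears_dense dA xd (ltW xdu) (ltW x1).
  have [/(_ p1) hp _] := h p q ap aq.
  move: q0; rewrite gt_max => /andP[q0 _].
  have : q < y.
    apply: hp; split=> //; have := f_lt (x - d) p xdu p0; clear -hd; lra.
  by lra.
exists `]u0, u1[%classic, f; split.
- by exists u0, u1.
- apply/definable_fun1E.
  apply: (@dfn_ext _ _ _ (fun v => u0 < v 0%N < u1 /\ forall p q, appears A p -> appears A q ->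
    (p < v 0%N -> S p q -> q < v 1%N) /\ (v 0%N < p -> ~ S p q -> v 1%N <= q))).
    by move=> v; rewrite /= in_itv /=; split=> -[h /fE h']; split=> //; exact: h'.
  by ddec.
- exact: quadratic_C2.
move=> [m [k h]].
(* At three equally spaced points the second difference of an affine function vanishes, while that
   of [f] does not. *)
have e1 := h (u0 + w / 4); have e2 := h (u0 + w / 2); have e3 := h (u0 + w * 3 / 4).
rewrite /= !in_itv /= /w in e1 e2 e3.
have {}e1 := e1 ltac:(lra); have {}e2 := e2 ltac:(lra); have {}e3 := e3 ltac:(lra).
have q1 := fsq (u0 + w / 4); have q2 := fsq (u0 + w / 2); have q3 := fsq (u0 + w * 3 / 4).
rewrite /w -/w in q1 q2 q3 e1 e2 e3; rewrite ?e1 ?e2 ?e3 in q1 q2 q3.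
have : w * w = 0 by nra.
by apply/eqP; rewrite mulf_neq0 // gt_eqF.
Qed.

End CodingC2.

(** * Dense orders of type omega from increasing families of closed nowhere dense sets *)

Section ClosedFamilies.
Variables (R : realType) (M : expansion R).

(** Pigeonhole: each half-open cell of length [c] contains [F x] for at most one [x] in [X], and
    finitely many cells cover the range. *)
Lemma separated_finite (X : R -> Prop) (F : R -> R) (lo hi c : R) : 0 < c ->
  (forall x, X x -> lo <= F x <= hi) ->
  (forall x y, X x -> X y -> x < y -> c <= `|F x - F y|) ->
  exists s : seq R, forall x, X x -> x \in s.
Proof.
move=> c0 bd sep.
pose cell n x := X x /\ n%:R <= (F x - lo) / c < n.+1%:R.
have /choice[pk hpk] : forall n : nat, exists y, forall x, cell n x -> x = y.
  move=> n; have [[y [Xy /andP[y1 y2]]]|none] := pselect (exists y, cell n y); last first.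
    by exists 0 => x nx; case: none; exists x.
  exists y => x [Xx /andP[x1 x2]]; apply: contrapT => /eqP ne.
  have cl z : n%:R <= (F z - lo) / c -> (F z - lo) / c < n.+1%:R ->
      n%:R * c <= F z - lo /\ F z - lo < n%:R * c + c.
    rewrite ler_pdivlMr // ltr_pdivrMr // => h1 h2; split=> //.
    by move: h2; rewrite -natr1 mulrDl mul1r.
  have [x1' x2'] := cl _ x1 x2; have [y1' y2'] := cl _ y1 y2.
  have lt : `|F x - F y| < c by rewrite ltr_norml; lra.
  case/orP: (lt_total ne) => h.
    by have := sep _ _ Xx Xy h; lra.
  by have := sep _ _ Xy Xx h; rewrite distrC; lra.
pose N := (Num.truncn ((hi - lo) / c)).+1.
exists [seq pk n | n <- iota 0 N] => x Xx.
have /andP[b1 b2] := bd _ Xx.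
have q0 : 0 <= (F x - lo) / c by apply: divr_ge0; lra.
have /andP[t1 t2] := truncn_itv q0.
apply/mapP; exists (Num.truncn ((F x - lo) / c)).
  rewrite mem_iota /= add0n ltnS; apply: le_truncn.
  by rewrite ler_pM2r ?invr_gt0 //; lra.
by apply: hpk; split=> //; rewrite t1.
Qed.

Section Family.
Variables (a b : R) (B : R -> R -> Prop).
Hypothesis ab : a < b.
Hypothesis dB : dfn M (fun v => B (v 0%N) (v 1%N)).
Hypothesis anti : forall s t x : R, 0 < s <= t -> B t x -> B s x.
Hypothesis lim : forall t x : R, 0 < t -> (forall s : R, 0 < s < t -> B s x) -> B t x.
Hypothesis bd : forall t x, B t x -> 0 < t <= 1 /\ a < x < b.
Hypothesis clos : forall t x, a < x < b -> ~ B t x ->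
  small (fun d => forall y, `|y - x| < d -> ~ B t y).
Hypothesis nowhere : forall t u v, a <= u -> u < v -> v <= b -> exists x, u < x < v /\ ~ B t x.
Hypothesis dns : forall u v, a <= u -> u < v -> v <= b -> exists t x, B t x /\ u < x < v.

(** Baire category: by monotonicity in [t] the levels [1 / (n + 1)] suffice, and each is closed and
    nowhere dense, so nested intervals escape from all of them. *)
Lemma avoid u v : a <= u -> u < v -> v <= b -> exists x, u < x < v /\ forall t, ~ B t x.
Proof.
move=> au uv vb.
pose T := {ks : nat * (R * R) | [/\ a <= ks.2.1, ks.2.1 < ks.2.2 & ks.2.2 <= b]}.
pose rel (x y : T) := [/\ (sval y).1 = (sval x).1.+1,
  (sval x).2.1 < (sval y).2.1, (sval y).2.2 < (sval x).2.2 &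
  forall z, (sval y).2.1 < z < (sval y).2.2 -> ~ B ((sval x).1.+1%:R^-1) z].
have h0 : [/\ a <= (0%N, (u, v)).2.1, (0%N, (u, v)).2.1 < (0%N, (u, v)).2.2
  & (0%N, (u, v)).2.2 <= b] by [].
have [|f [f0 frel]] := @dependent_choice T rel _ (exist _ _ h0).
  move=> [[k [l m]] /= [al lm mb]].
  suff /cid2[[l' m'] [h1 h2 h3] h4] : exists2 lm' : R * R, [/\ l < lm'.1, lm'.1 < lm'.2 & lm'.2 < m] &
      forall z, lm'.1 < z < lm'.2 -> ~ B (k.+1%:R^-1) z.
    have h5 : [/\ a <= (k.+1, (l', m')).2.1, (k.+1, (l', m')).2.1 < (k.+1, (l', m')).2.2
      & (k.+1, (l', m')).2.2 <= b] by split=> /=; simpl in *; lra.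
    by exists (exist (fun ks : nat * (R * R) => [/\ a <= ks.2.1, ks.2.1 < ks.2.2 & ks.2.2 <= b])
      (k.+1, (l', m')) h5); split.
  have [x [/andP[lx xm] nB]] := nowhere (k.+1%:R^-1) al lm mb.
  have [|||d [d0 [hd [d1 d2]]]] := small_ex (small_and (clos _ nB)
     (small_and (small_lt (c := x - l) _) (small_lt (c := m - x) _))); try lra.
  exists (x - d, x + d) => /=; first by split; lra.
  by move=> z zd; apply: hd; rewrite ltr_norml; lra.
have fk k : (sval (f k)).1 = k.
  by elim: k => [|k IH]; [rewrite f0|have [-> _ _ _] := frel k; rewrite IH].
have [x [hx _]] := @nested_point R (fun k => (sval (f k)).2.1) (fun k => (sval (f k)).2.2)
  (fun k => let: And4 _ h _ _ := frel k in h) (fun k => let: And4 _ _ h _ := frel k in h)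
  (fun k => let: And3 _ h _ := svalP (f k) in h).
exists x; split; first by have := hx 0%N; rewrite f0.
move=> t tx; have [/andP[t0 _] _] := bd tx.
have [n] := ltr_add_invr (y := 0) (x := t) t0; rewrite add0r => nt.
have [_ _ _ /(_ x (hx n.+1))] := frel n; rewrite fk; apply.
by apply: anti tx; rewrite invr_gt0 ltr0n ltW.
Qed.

(** [m] is the supremum of the levels met in [[u, v]], and [x] is the supremum of the [z] such that
    some level below [m] is missed on [[u, z)]. Closedness puts [x] on every level below [m], and
    [lim] then on [m] itself, so [x] is the leftmost point of highest level. *)
Lemma top_level u v : a < u -> u < v -> v < b -> (exists t x, B t x /\ u <= x <= v) ->
  exists m x, [/\ B m x, u <= x <= v,
    forall y, u <= y < x -> ~ B m y & forall t y, u <= y <= v -> m < t -> ~ B t y].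
Proof.
move=> au uv vb [t1 [x1 [B1 x1uv]]].
pose L := [set t : R | exists x, B t x /\ u <= x <= v].
have supL : has_sup L.
  split; first by exists t1, x1.
  by exists 1 => t [x [/bd[/andP[_ h]]]].
pose m := sup L.
have t1m : t1 <= m by apply: ub_le_sup; [case: supL|exists x1].
have [/andP[t10 _] _] := bd B1.
have m0 : 0 < m by lra.
have above t y : u <= y <= v -> m < t -> ~ B t y.
  move=> yuv mt ty; have : t <= m by apply: ub_le_sup; [case: supL|exists y].
  by lra.
have below s : 0 < s -> s < m -> exists y, B s y /\ u <= y <= v.
  move=> s0 /(sup_gt supL.1)[t [y [ty yuv]] st]; exists y; split=> //.
  by apply: anti ty; rewrite s0 ltW.
pose Z := [set z : R | u <= z <= v /\ exists s, 0 < s < m /\ forall y, u <= y < z -> ~ B s y].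
have Zu : Z u.
  split; first by rewrite lexx ltW.
  by exists (m / 2); split; [lra|move=> y yu; lra].
have supZ : has_sup Z by split; [exists u|exists v => z [/andP[]]].
pose x := sup Z.
have ux : u <= x by apply: ub_le_sup => //; case: supZ.
have xv : x <= v by apply: ge_sup; [case: supZ|move=> z [/andP[]]].
have axb : a < x < b by lra.
exists m, x; split=> //.
- apply: lim => // s /andP[s0 sm]; apply: contrapT => ns.
  have [d [d0 hd]] := small_ex (clos axb ns).
  have xd : x - d < x by lra.
  have [z [zuv [s' [/andP[s'0 s'm] hs']]] xz] := sup_gt supZ.1 xd.
  have [y [By /andP[uy yv]]] := below (Num.max s s') ltac:(by rewrite lt_max s0)
    ltac:(by rewrite gt_max sm).
  (* The larger of [s] and [s'] is missed on all of [[u, x + d)]: to the left of [z] because of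
     [s'], and near [x] because of [s]. So a point to the right of [x] would belong to [Z]. *)
  have nB w : u <= w < x + d -> ~ B (Num.max s s') w.
    move=> /andP[uw wx] Bw; have [wz|zw] := ltP w z.
      by apply: (hs' w); [rewrite uw|apply: anti Bw; rewrite s'0 le_max lexx orbT].
    apply: (hd w); first by rewrite ltr_norml; lra.
    by apply: anti Bw; rewrite s0 le_max lexx.
  have xdy : x + d <= y by rewrite leNgt; apply/negP => h; apply: (nB y); rewrite ?uy.
  have Zx : Z (x + d / 2).
    split; first by lra.
    exists (Num.max s s'); split; first by rewrite lt_max s0 gt_max sm.
    by move=> w hw; apply: nB; lra.
  have : x + d / 2 <= x by apply: ub_le_sup => //; case: supZ.
  by lra.
- by rewrite ux.
- move=> y /andP[uy yx] my; have [z [zuv [s [/andP[s0 sm] hs]]] yz] := sup_gt supZ.1 yx.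
  by apply: (hs y); [rewrite uy|apply: anti my; rewrite s0 ltW].
Qed.

(** Within distance [t] the point [x] has the highest level, ties being broken in favour of the
    point on the left. Without ties, two such points are at least [t] apart. *)
Definition isolated_top t x : Prop :=
  [/\ 0 < t, B t x & forall y, x - t < y < x + t -> y <> x ->
    (exists s, B s x /\ ~ B s y) \/
    ((forall s, B s x -> B s y) /\ (forall s, B s y -> B s x) /\ x < y)].

(** Two points closer than [t] cannot both win against each other, so every level of [isolated_top]
    is finite. Density comes from the leftmost highest point of a small interval. *)
Lemma closed_family_dense : dense_family M a b isolated_top.
Proof.
split=> //; split.
- apply: (@dfn_ext _ _ _ (fun v => 0 < v 0%N /\ B (v 0%N) (v 1%N) /\
    forall y, v 1%N - v 0%N < y < v 1%N + v 0%N -> y <> v 1%N ->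
    (exists s, B s (v 1%N) /\ ~ B s y) \/
    ((forall s, B s (v 1%N) -> B s y) /\ (forall s, B s y -> B s (v 1%N)) /\ v 1%N < y))).
    by move=> v; split=> [[]|[? []]].
  by ddec.
- move=> t; have [t0|t0] := ltP 0 t; last first.
    by exists [::] => x []; rewrite ltNge t0.
  apply: (@separated_finite _ id a b t) => //.
    by move=> x [_ /bd[_]]; lra.
  move=> x y [_ _ hx] [_ _ hy] xy; rewrite leNgt; apply/negP => /ltr_normlP[h1 h2].
  have cmp s s' : B s x -> ~ B s y -> B s' y -> ~ B s' x -> False.
    move=> sx nsy s'y ns'x; have [/andP[s0 _] _] := bd sx; have [/andP[s'0 _] _] := bd s'y.
    have [ss'|s's] := leP s s'.
      by apply: nsy; apply: anti s'y; rewrite s0.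
    by apply: ns'x; apply: anti sx; rewrite s'0 ltW.
  have [||[s [sx nsy]]|[xy1 [yx1 _]]] := hx y; [lra|by apply/eqP; rewrite gt_eqF| |].
    have [||[s' [s'y ns'x]]|[_ [yx _]]] := hy x; [lra|by apply/eqP; rewrite lt_eqF| |].
      exact: cmp sx nsy s'y ns'x.
    by apply: nsy; exact: yx.
  have [||[s' [s'y ns'x]]|[_ [_ yx]]] := hy x; [lra|by apply/eqP; rewrite lt_eqF| |lra].
  by apply: ns'x; apply: yx1.
- move=> s t x st [t0 tx hx]; have /andP[s0 s_t] := st.
  split=> //; first exact: anti tx.
  by move=> y yx; apply: hx; lra.
- by move=> t x [t0 /bd[_]].
- move=> p q ap pq qb.
  have [t1 [x1 [B1 /andP[px1 x1q]]]] := dns ap pq qb.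
  have [_ /andP[ax1 x1b]] := bd B1.
  (* The ends [u] and [v] lie on no level, so the highest level over [[u, v]] is attained in the
     interior. *)
  have [u [/andP[pu ux1] nu]] := @avoid p x1 ap px1 (ltW x1b).
  have [v [/andP[x1v vq] nv]] := @avoid x1 q (ltW ax1) x1q qb.
  have [||||m [x [mx /andP[ux xv] left top]]] := @top_level u v; try lra.
    by exists t1, x1; split=> //; lra.
  have [/andP[m0 _] _] := bd mx.
  have {}ux : u < x by rewrite lt_neqAle ux andbT; apply/eqP => h; apply: (nu m); rewrite h.
  have {}xv : x < v by rewrite lt_neqAle xv andbT; apply/eqP => h; apply: (nv m); rewrite -h.
  have [||t [t0 [tm [tu tv]]]] := small_ex (small_and (small_lt m0)
    (small_and (small_lt (c := x - u) _) (small_lt (c := v - x) _))); try lra.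
  exists t, x; split; last by lra.
  split=> //; first by apply: anti mx; rewrite t0 ltW.
  move=> y yx ne; have [my|nmy] := pselect (B m y); last by left; exists m.
  have yuv : u <= y <= v by lra.
  have lvl z w s : u <= z <= v -> B m w -> B s z -> B s w.
    move=> zuv mw sz; have [/andP[s0 _] _] := bd sz.
    have sm : s <= m by rewrite leNgt; apply/negP => ms; exact: top ms sz.
    by apply: anti mw; rewrite s0.
  right; split; first by move=> s; apply: lvl => //; lra.
  split; first by move=> s; apply: lvl.
  rewrite lt_neqAle; apply/andP; split; first by apply/eqP => h; exact: ne.
  by rewrite leNgt; apply/negP => yx'; apply: (left y) => //; lra.
Qed.

End Family.
End ClosedFamilies.

(* [lra] is slow when the context contains hypotheses other than equations and inequalities. *)
Ltac keep_comparisons := repeat match goal with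
  | H : ?T |- _ => lazymatch T with
      | is_true _ => fail
      | _ = _ => fail
      | _ => lazymatch type of T with Prop => clear H end
      end
  end.
Ltac slra := first [keep_comparisons; lra | lra].

(** * Second differences and convexity on a subinterval *)

Section Convexity.
Variables (R : realType) (M : expansion R).
Implicit Types (g D : R -> R) (a b x y z : R).

Definition contat g x := forall k, 0 < k ->
  small (fun d => forall y, `|y - x| < d -> `|g y - g x| < k).

Lemma contatP g x : contat g x <-> {for x, continuous g}.
Proof.
split=> [h|h k k0].
  apply/cvgrPdist_lt => k /h[d [d0 hd]].
  exists (d / 2) => /=; first slra.
  move=> y; rewrite /ball /= => xy; rewrite distrC; apply: (hd (d / 2)); first slra.
  by rewrite distrC.
have /cvgrPdist_lt/(_ _ k0)[d /= d0 hd] := h.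
exists d; split=> // e /andP[e0 ed] y ye; rewrite distrC; apply: hd.
by rewrite /ball /= distrC; apply: lt_trans ye ed.
Qed.

Lemma contat_within g p r : (forall x, p <= x <= r -> contat g x) ->
  {within `[p, r], continuous g}.
Proof.
move=> h; apply: continuous_in_subspaceT => x; rewrite inE /= in_itv /=.
by move/h/contatP.
Qed.

(** Only comparisons of sums are asked to be definable, because the values of [g] may stand for
    elements of a definable field rather than for reals of the structure. Four terms on each side
    fit both second differences and kinks. *)
Definition sum4_definable g : Prop :=
  forall t0 t1 t2 t3 s0 s1 s2 s3 : (nat -> R) -> R,
    dterm M t0 -> dterm M t1 -> dterm M t2 -> dterm M t3 ->
    dterm M s0 -> dterm M s1 -> dterm M s2 -> dterm M s3 ->
    dfn M (fun v => is_true (g (t0 v) + g (t1 v) + g (t2 v) + g (t3 v) <=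
                    g (s0 v) + g (s1 v) + g (s2 v) + g (s3 v))).

Lemma sum4_definableN g : sum4_definable g -> sum4_definable (fun x => - g x).
Proof.
move=> h t0 t1 t2 t3 s0 s1 s2 s3 *.
apply: dfn_ext (h s0 s1 s2 s3 t0 t1 t2 t3 _ _ _ _ _ _ _ _) => // v.
by rewrite -!opprD lerN2.
Qed.

Definition convex_oo a b g := forall x y z, a < x -> x < y -> y < z -> z < b ->
  (g y - g x) * (z - y) <= (g z - g y) * (y - x).

Lemma nonconvex_local_max a b g : (forall x, a < x < b -> contat g x) ->
  ~ convex_oo a b g ->
  exists x, a < x < b /\ small (fun h => [/\ a < x - h, x + h < b & g (x + h) + g (x - h) <= g x + g x]).
Proof.
move=> cg /existsNP[p /existsNP[y /existsNP[r]]].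
move=> /not_implyP[ap /not_implyP[py /not_implyP[yr /not_implyP[rb]]]] /negP; rewrite -ltNge => ncv.
pose c := (g r - g p) / (r - p).
have cE : c * (r - p) = g r - g p by rewrite /c; field; rewrite subr_eq0 gt_eqF; slra.
pose G t := g t - c * t.
have Grp : G r = G p by rewrite /G; nra.
have Gy : G p < G y.
  rewrite -subr_gt0 -(pmulr_rgt0 _ (_ : 0 < r - p)); last slra.
  have -> : (r - p) * (G y - G p) = (g y - g p) * (r - y) - (g r - g y) * (y - p).
    rewrite /G; have -> : (r - p) * (g y - c * y - (g p - c * p)) =
      (r - p) * (g y - g p) - (c * (r - p)) * (y - p) by ring.
    by rewrite cE; ring.
  slra.
have cG : {within `[p, r], continuous G}.
  apply: contat_within => x xpr; apply/contatP.
  apply: cvgB; first by apply/contatP; apply: cg; slra.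
  by apply: cvgM; [exact: cvg_cst|exact: cvg_id].
have pr : p <= r by slra.
have [x] := EVT_max pr cG; rewrite in_itv /= => /andP[px xr] hmax.
have Gyx : G y <= G x by apply: hmax; rewrite in_itv /=; slra.
have {}px : p < x by rewrite lt_neqAle px andbT; apply/eqP => h; move: Gyx; rewrite -h; slra.
have {}xr : x < r by rewrite lt_neqAle xr andbT; apply/eqP => h; move: Gyx; rewrite h; slra.
exists x; split; first slra.
have [||d [d0 hd]] := small_and (small_lt (c := x - p) _) (small_lt (c := r - x) _); try slra.
exists d; split=> // h hh; have [h1 h2] := hd _ hh; have /andP[h0 _] := hh.
have ph : p < x - h by rewrite ltrBrDr -ltrBrDl.
have hr : x + h < r by rewrite -ltrBrDl.
have /andP[xh1 xh2] : x - h < x < x + h by rewrite ltrBlDr ltrDl h0.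
split; [exact: lt_trans ph|exact: lt_trans rb|].
have := hmax (x + h); have := hmax (x - h); rewrite !in_itv /G /=.
rewrite (ltW ph) (ltW hr) (ltW (lt_trans xh1 xr)) (ltW (lt_trans px xh2)) => /(_ isT) q1 /(_ isT) q2.
clear -q1 q2; slra.
Qed.

(** If [g] fell below a chord, then [g] minus the chord plus a small multiple of the parabola
    [(u - p) * (r - u)] would still have an interior minimum. There the second differences of [g]
    would be at least [2 * k * h ^ 2], hence positive. *)
Lemma midconcave_concave a b g t : 0 < t -> (forall x, a < x < b -> contat g x) ->
  (forall x h, 0 < h < t -> a < x - h -> x + h < b -> g (x + h) + g (x - h) <= g x + g x) ->
  convex_oo a b (fun x => - g x).
Proof.
move=> t0 cg mid p y r ap py yr rb; rewrite leNgt; apply/negP => ncv.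
pose c := (g r - g p) / (r - p).
have cE : c * (r - p) = g r - g p by rewrite /c; field; rewrite subr_eq0 gt_eqF; slra.
(* Half of the coefficient at which the parabola would close the gap between [g y] and the chord;
   hence [H y < H p] below. *)
pose k := (g p + c * (y - p) - g y) / ((y - p) * (r - y)) / 2.
have yy : 0 < (y - p) * (r - y) by apply: mulr_gt0; slra.
have num : 0 < g p + c * (y - p) - g y.
  rewrite -(pmulr_rgt0 _ (_ : 0 < r - p)); last slra.
  have -> : (r - p) * (g p + c * (y - p) - g y) =
     (r - p) * (g p - g y) + (c * (r - p)) * (y - p) by ring.
  by rewrite cE; slra.
have k0 : 0 < k by rewrite /k divr_gt0 // divr_gt0.
pose H u := g u - c * u + k * ((u - p) * (r - u)).
have Hpr : H p = H r by rewrite /H; nra.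
have Hy : H y < H p.
  have ky : k * ((y - p) * (r - y)) = (g p + c * (y - p) - g y) / 2.
    by rewrite /k; field; rewrite !subr_eq0 !gt_eqF.
  by rewrite /H ky; nra.
have cH : {within `[p, r], continuous H}.
  apply: contat_within => x xpr; apply/contatP.
  apply: cvgD; first apply: cvgB; first by apply/contatP; apply: cg; slra.
    by apply: cvgM; [exact: cvg_cst|exact: cvg_id].
  apply: cvgM; [exact: cvg_cst|apply: cvgM; apply: cvgB; by [exact: cvg_id|exact: cvg_cst]].
have pr : p <= r by slra.
have [x] := EVT_min pr cH; rewrite in_itv /= => /andP[px xr] hmin.
have Hyx : H x <= H y by apply: hmin; rewrite in_itv /=; slra.
have {}px : p < x by rewrite lt_neqAle px andbT; apply/eqP => h; move: Hyx; rewrite -h; slra.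
have {}xr : x < r by rewrite lt_neqAle xr andbT; apply/eqP => h; move: Hyx; rewrite h; slra.
have [||h [h0 [h1 [h2 h3]]]] := small_ex (small_and (small_lt t0)
  (small_and (small_lt (c := x - p) _) (small_lt (c := r - x) _))); try slra.
have ph : p < x - h by rewrite ltrBrDr -ltrBrDl.
have hr : x + h < r by rewrite -ltrBrDl.
have xh : x - h < x < x + h by rewrite ltrBlDr ltrDl h0.
have /andP[xh1 xh2] := xh.
have := hmin (x + h); have := hmin (x - h); rewrite !in_itv /H /=.
rewrite (ltW ph) (ltW hr) (ltW (lt_trans xh1 xr)) (ltW (lt_trans px xh2)) => /(_ isT) q1 /(_ isT) q2.
have m : g (x + h) + g (x - h) <= g x + g x.
  by apply: mid; [rewrite h0|exact: lt_trans ph|exact: lt_trans rb].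
have kh : 0 < k * (h * h) by apply: mulr_gt0 => //; apply: mulr_gt0.
have e : k * ((x + h - p) * (r - (x + h))) + k * ((x - h - p) * (r - (x - h))) =
  2 * (k * ((x - p) * (r - x))) - 2 * (k * (h * h)) by ring.
slra.
Qed.

(** If [g] is neither convex nor concave on any subinterval, the sets [B t] satisfy the hypotheses
    of [closed_family_dense]: a level with interior would make [g] concave there, and failure of
    convexity yields local maxima relative to chords. *)
Lemma generic_convex a b g : a < b -> (forall x, a < x < b -> contat g x) ->
  sum4_definable g ->
  (exists A, dense_family M a b A) \/
  exists u v, [/\ a <= u, u < v, v <= b & convex_oo u v g \/ convex_oo u v (fun x => - g x)].
Proof.
move=> ab cg dg.
have [?|none] := pselect (exists u v, [/\ a <= u, u < v, v <= b &
    convex_oo u v g \/ convex_oo u v (fun x => - g x)]); [by right|left].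
(* The terms [g x + g x] on both sides pad the inequality to four summands, and the cap [t <= 1]
   bounds the levels. *)
pose B t x := (0 < t /\ t <= 1 /\ a < x < b) /\ forall h, 0 < h < t -> a < x - h -> x + h < b ->
  g (x + h) + g (x - h) + g x + g x <= g x + g x + g x + g x.
have BE t x : 0 < t -> t <= 1 -> a < x < b ->
  (forall h, 0 < h < t -> a < x - h -> x + h < b -> g (x + h) + g (x - h) <= g x + g x) -> B t x.
  by move=> t0 t1 xab hB; split=> // h h1 h2 h3; have := hB h h1 h2 h3; slra.
exists (isolated_top B); apply: closed_family_dense => //.
- rewrite /B; apply: dfn_and; first by ddec.
  apply: (@dfn_all _ _ (fun h v => _)); do 3 (apply: dfn_imp; first by ddec).
  by apply: dg; ddec.
- move=> s t x /andP[s0 st] [[t0 [t1 xab]] hB]; split; first by split=> //; split=> //; slra.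
  by move=> h hh; apply: hB; slra.
- move=> t x t0 hB; have [[_ [_ xab]] _] := hB (t / 2) ltac:(slra).
  have t1 : t <= 1.
    rewrite leNgt; apply/negP => t1.
    have [[_ [h _]] _] := hB ((t + 1) / 2) ltac:(slra); slra.
  split=> // h /andP[h0 ht]; have [_ ] := hB ((h + t) / 2) ltac:(slra).
  by apply; slra.
- by move=> t x [[-> [-> ->]]].
- move=> t x xab nB.
  have [tt|ntt] := pselect (0 < t /\ t <= 1); last first.
    by apply: small_true => d y _ [[h1 [h2 _]] _]; exact: (ntt (conj h1 h2)).
  have : exists h, [/\ 0 < h < t, a < x - h, x + h < b & g x + g x < g (x + h) + g (x - h)].
    apply: contrapT => ne; apply: nB; apply: BE; try by case: tt.
    move=> h h1 h2 h3; rewrite leNgt; apply/negP => h4; apply: ne; by exists h.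
  move=> [h [hh h1 h2 h3]].
  pose k := (g (x + h) + g (x - h) - g x - g x) / 4.
  have k0 : 0 < k by rewrite /k; slra.
  have := small_and (cg x xab _ k0) (small_and (cg (x + h) ltac:(slra) _ k0)
     (small_and (cg (x - h) ltac:(slra) _ k0) (small_and
     (small_lt (c := x - h - a) ltac:(slra)) (small_lt (c := b - x - h) ltac:(slra))))).
  apply: small_mono => d _ [c1 [c2 [c3 [d1 d2]]]] y yx [[_ [_ yab]] /(_ h hh) hy].
  have /ltr_normlP[y1 y2] := yx.
  have {}hy := hy ltac:(slra) ltac:(slra).
  have /ltr_normlP[e1 e2] := c1 _ yx.
  have /ltr_normlP[e3 e4] := c2 (y + h) ltac:(by rewrite (_ : y + h - (x + h) = y - x) //; ring).
  have /ltr_normlP[e5 e6] := c3 (y - h) ltac:(by rewrite (_ : y - h - (x - h) = y - x) //; ring).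
  rewrite /k in e1 e2 e3 e4 e5 e6; slra.
- move=> t u v au uv vb; apply: contrapT => nex; apply: none; exists u, v; split=> //; right.
  have hB x : u < x < v -> B t x.
    by move=> xuv; apply: contrapT => nB; apply: nex; exists x.
  have [[t0 _] _] := hB ((u + v) / 2) ltac:(slra).
  apply: (@midconcave_concave _ _ _ t) => //.
    by move=> x xuv; apply: cg; slra.
  move=> x h hh h1 h2; have [_ /(_ h hh)] := hB x ltac:(slra).
  by move=> /(_ ltac:(slra) ltac:(slra)); slra.
- move=> u v au uv vb.
  have [||x [xuv [d [d0 hd]]]] := @nonconvex_local_max u v g.
  - by move=> x xuv; apply: cg; slra.
  - by move=> cv; apply: none; exists u, v; split=> //; left.
  have [d1|d1] := leP d 1; [exists d, x|exists 1, x]; split=> //; apply: BE => //; try slra.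
    by move=> h hh _ _; have [] := hd h hh.
  by move=> h hh _ _; have [] := hd h ltac:(slra).
Qed.

End Convexity.

(** * One-sided derivatives and kinks of convex functions *)

Section Kinks.
Variables (R : realType) (M : expansion R).
Implicit Types (g D : R -> R) (a b x y z c h : R).

Lemma is_derive_eps g x (D : R) :
  (forall k, 0 < k -> small (fun d => forall h, `|h| < d -> `|g (x + h) - g x - D * h| <= k * `|h|)) <->
  is_derive x 1 g D.
Proof.
split=> H.
  suff cv : (fun h : R => h^-1 *: ((g \o shift x) (h *: 1) - g x)) @ 0^' --> D.
    by constructor; [apply/cvg_ex; exists D|apply/cvg_lim].
  apply/cvgrPdist_le => k /H[d [d0 hd]].
  have d20 : 0 < d / 2 by lra.
  exists (d / 2) => //= h; rewrite /ball /= sub0r normrN => hh h0.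
  rewrite /shift /= /GRing.scale /= mulr1 [h + x]addrC.
  have {}h0 : 0 < `|h| by rewrite normr_gt0.
  rewrite -(ler_pM2r h0) -normrM.
  have -> : (D - h^-1 * (g (x + h) - g x)) * h = - (g (x + h) - g x - D * h).
    by field; rewrite -normr_gt0.
  by rewrite normrN; apply: (hd (d / 2)) => //; lra.
move=> k k0; case: H => dg Dg.
have /cvgrPdist_le/(_ _ k0) : (fun h : R => h^-1 *: ((g \o shift x) (h *: 1) - g x)) @ 0^' --> D.
  by rewrite -Dg; exact: dg.
move=> [d /= d0 hd]; exists d; split=> // e /andP[e0 ed] h he.
have [->|h0] := eqVneq h 0; first by rewrite mulr0 addr0 subrr subr0 normr0 mulr0.
have := hd h; rewrite /ball /= sub0r normrN => /(_ (lt_trans he ed) h0).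
rewrite /shift /= /GRing.scale /= mulr1 [h + x]addrC.
have hp : 0 < `|h| by rewrite normr_gt0.
rewrite -(ler_pM2r hp) -normrM.
have -> : (D - h^-1 * (g (x + h) - g x)) * h = - (g (x + h) - g x - D * h).
  by field.
by rewrite normrN.
Qed.

Section Convex.
Variables (a b : R) (g : R -> R).
Hypothesis ab : a < b.
Hypothesis cg : forall x, a < x < b -> contat g x.
Hypothesis cv : convex_oo a b g.

(** The right and left derivatives: slopes of a convex function are monotone in the step, so the
    one-sided limits are an infimum and a supremum. *)
Definition Dp x := inf [set q : R | exists h, [/\ 0 < h, x + h < b & q = (g (x + h) - g x) / h]].
Definition Dm x := sup [set q : R | exists h, [/\ 0 < h, a < x - h & q = (g x - g (x - h)) / h]].

Let cross x h h' : 0 < h -> 0 < h' -> a < x - h' -> x + h < b ->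
  (g x - g (x - h')) / h' <= (g (x + h) - g x) / h.
Proof.
move=> h0 h'0 ax xb; rewrite ler_pdivlMr // mulrAC ler_pdivrMr //.
have := @cv (x - h') x (x + h); rewrite opprB [x + (h' - x)]addrC subrK.
rewrite [x + h - x]addrC addKr; apply; lra.
Qed.

Let slope_mono x h h' : a < x -> 0 < h -> h < h' -> x + h' < b ->
  (g (x + h) - g x) * h' <= (g (x + h') - g x) * h.
Proof.
move=> ax h0 hh xb; have := @cv x (x + h) (x + h') ax ltac:(lra) ltac:(lra) xb.
have -> : x + h' - (x + h) = h' - h by ring.
have -> : x + h - x = h by ring.
by nra.
Qed.

Let slope_monol x h h' : x < b -> 0 < h -> h < h' -> a < x - h' ->
  (g x - g (x - h')) * h <= (g x - g (x - h)) * h'.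
Proof.
move=> xb h0 hh ax; have := @cv (x - h') (x - h) x ax ltac:(lra) ltac:(lra) xb.
have -> : x - (x - h) = h by ring.
have -> : x - h - (x - h') = h' - h by ring.
by nra.
Qed.

Let has_infp x : a < x < b ->
  has_inf [set q : R | exists h, [/\ 0 < h, x + h < b & q = (g (x + h) - g x) / h]].
Proof.
move=> /andP[ax xb]; split.
  exists ((g (x + (b - x) / 2) - g x) / ((b - x) / 2)), ((b - x) / 2); split=> //; lra.
exists ((g x - g (x - (x - a) / 2)) / ((x - a) / 2)) => _ [h [h0 xh ->]].
by apply: cross; lra.
Qed.

Let has_supm x : a < x < b ->
  has_sup [set q : R | exists h, [/\ 0 < h, a < x - h & q = (g x - g (x - h)) / h]].
Proof.
move=> /andP[ax xb]; split.
  exists ((g x - g (x - (x - a) / 2)) / ((x - a) / 2)), ((x - a) / 2); split=> //; lra.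
exists ((g (x + (b - x) / 2) - g x) / ((b - x) / 2)) => _ [h [h0 xh ->]].
by apply: cross; lra.
Qed.

Lemma Dp_le x h : a < x -> 0 < h -> x + h < b -> Dp x * h <= g (x + h) - g x.
Proof.
move=> ax h0 xb; rewrite -ler_pdivlMr //; apply: ge_inf; last by exists h.
by apply: (has_infp _).2; lra.
Qed.

Lemma Dm_ge x h : x < b -> 0 < h -> a < x - h -> g x - g (x - h) <= Dm x * h.
Proof.
move=> ax h0 xb; rewrite -ler_pdivrMr //; apply: ub_le_sup; last by exists h.
by apply: (has_supm _).2; lra.
Qed.

Lemma Dp_lt x c : a < x < b -> Dp x < c ->
  small (fun h => x + h < b /\ g (x + h) - g x < c * h).
Proof.
move=> /[dup] xab /andP[ax xb] /(inf_lt (has_infp xab).1)[_ [h [h0 xh ->]]].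
rewrite ltr_pdivrMr // => hc; exists h; split=> // e /andP[e0 eh]; split; first lra.
have := slope_mono ax e0 eh xh; rewrite -(ltr_pM2r h0) => s.
by apply: (le_lt_trans s); rewrite mulrAC ltr_pM2r.
Qed.

Lemma Dm_gt x c : a < x < b -> c < Dm x ->
  small (fun h => a < x - h /\ c * h < g x - g (x - h)).
Proof.
move=> /[dup] xab /andP[ax xb] /(sup_gt (has_supm xab).1)[_ [h [h0 xh ->]]].
rewrite ltr_pdivlMr // => hc; exists h; split=> // e /andP[e0 eh]; split; first lra.
have := slope_monol xb e0 eh xh; rewrite -(ltr_pM2r h0) => s.
by apply: lt_le_trans s; rewrite mulrAC ltr_pM2r.
Qed.

Lemma Dm_le_Dp x : a < x < b -> Dm x <= Dp x.
Proof.
move=> xab; rewrite leNgt; apply/negP => lt.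
have [h [h0 [[h1 h2] [h3 h4]]]] := small_ex (small_and
  (@Dp_lt x ((Dp x + Dm x) / 2) xab ltac:(lra)) (@Dm_gt x ((Dp x + Dm x) / 2) xab ltac:(lra))).
have := cross h0 h0 h3 h1; rewrite ler_pM2r ?invr_gt0 //; lra.
Qed.

Lemma Dp_le_Dm x y : a < x -> x < y -> y < b -> Dp x <= Dm y.
Proof.
move=> ax xy yb; have := @Dp_le x (y - x) ax ltac:(lra) ltac:(lra).
have := @Dm_ge y (y - x) yb ltac:(lra) ltac:(lra).
rewrite subKr [x + (y - x)]addrC subrK => h1 h2.
have p : 0 < y - x by lra.
by rewrite -(ler_pM2r p); exact: le_trans h1.
Qed.

Lemma Dp_mono x y : a < x -> x <= y -> y < b -> Dp x <= Dp y.
Proof.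
move=> ax; rewrite le_eqVlt => /orP[/eqP->//|xy] yb.
by apply: le_trans (Dp_le_Dm ax xy yb) _; apply: Dm_le_Dp; lra.
Qed.

(** A slope below [c] from [z] to [z + h] stays below [c] when its left end is moved to a nearby
    [y], and it bounds [Dp y] from above. *)
Lemma Dp_right_continuous z c : a < z < b -> Dp z < c ->
  small (fun d => forall y, z < y < z + d -> y < b /\ Dp y < c).
Proof.
move=> zab zc; have [h [h0 [zh hc]]] := small_ex (Dp_lt zab zc).
(* Half of the gap absorbs [g y - g z], and the other half absorbs [c * (y - z)]. *)
have k0 : 0 < (c * h - (g (z + h) - g z)) / 2 / (1 + `|c|).
  by apply: divr_gt0; [lra|rewrite ltr_pwDl].
have k1 : 0 < (c * h - (g (z + h) - g z)) / 2 by lra.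
have := small_and (cg zab k1) (small_and (small_lt k0) (small_lt h0)).
apply: small_mono => d d0 [d1 [d2 d3]] y /andP[zy yd]; split; first lra.
have /ltr_normlP[e1 e2] := d1 y ltac:(rewrite ltr_norml; lra).
have hy : 0 < z + h - y by lra.
have := @Dp_le y (z + h - y) ltac:(lra) hy ltac:(lra).
have -> : y + (z + h - y) = z + h by ring.
move=> D1; rewrite -(ltr_pM2r hy); apply: le_lt_trans D1 _.
have : c * (y - z) <= (c * h - (g (z + h) - g z)) / 2.
  move: d2; rewrite ltr_pdivlMr ?ltr_pwDl // => d2.
  have n0 : 0 <= `|c| by [].
  have cn : c <= `|c| by exact: ler_norm.
  by nra.
lra.
Qed.

Lemma Dm_left_continuous z c : a < z < b -> c < Dm z ->
  small (fun d => forall y, z - d < y < z -> a < y /\ c < Dm y).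
Proof.
move=> zab zc; have [h [h0 [zh hc]]] := small_ex (Dm_gt zab zc).
have k0 : 0 < (g z - g (z - h) - c * h) / 2 / (1 + `|c|).
  by apply: divr_gt0; [lra|rewrite ltr_pwDl].
have k1 : 0 < (g z - g (z - h) - c * h) / 2 by lra.
have := small_and (cg zab k1) (small_and (small_lt k0) (small_lt h0)).
apply: small_mono => d d0 [d1 [d2 d3]] y /andP[zy yd]; split; first lra.
have /ltr_normlP[e1 e2] := d1 y ltac:(rewrite ltr_norml; lra).
have hy : 0 < y - (z - h) by lra.
have := @Dm_ge y (y - (z - h)) ltac:(lra) hy ltac:(lra).
have -> : y - (y - (z - h)) = z - h by ring.
move=> D1; rewrite -(ltr_pM2r hy); apply: lt_le_trans D1.
have : c * (y - z) <= (g z - g (z - h) - c * h) / 2.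
  move: d2; rewrite ltr_pdivlMr ?ltr_pwDl // => d2.
  have n0 : 0 <= `|c| by [].
  have cn : - c <= `|c| by rewrite -normrN; exact: ler_norm.
  by nra.
lra.
Qed.

Definition C1_on p q f D := (forall x, p < x < q -> is_derive x 1 f (D x) /\ contat D x) /\
  ((forall x y, p < x -> x <= y -> y < q -> D x <= D y) \/
   (forall x y, p < x -> x <= y -> y < q -> D y <= D x)).

(** Without kinks the two one-sided derivatives coincide, and right continuity of one together with
    left continuity of the other gives continuity. *)
Lemma no_kink_C1 p q : a <= p -> q <= b -> (forall x, p < x < q -> Dp x <= Dm x) ->
  C1_on p q g Dp.
Proof.
move=> ap qb nk; split; last by left=> x y *; apply: Dp_mono; lra.
have DE x : p < x < q -> Dm x = Dp x.
  by move=> xpq; apply/eqP; rewrite eq_le nk // Dm_le_Dp //; lra.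
move=> x xpq; have xab : a < x < b by lra.
split.
  apply/is_derive_eps => k k0.
  have s1 := @Dp_lt x (Dp x + k) xab ltac:(lra).
  have s2 := @Dm_gt x (Dp x - k) xab ltac:(rewrite DE //; lra).
  have := small_and s1 s2.
  move=> [d0 [d00 hd0]]; exists d0; split=> // d' /andP[d'0 d'd] h hh.
  have [h0|h0|<-] := ltgtP 0 h; last by rewrite addr0 mulr0 subrr subr0 normr0 mulr0.
    rewrite (gtr0_norm h0) in hh *.
    have [[h1 h2] _] := hd0 h ltac:(lra); have h3 := @Dp_le x h ltac:(lra) h0 h1.
    by rewrite ler_norml; lra.
  rewrite (ltr0_norm h0) in hh *.
  have [_ [h1 h2]] := hd0 (- h) ltac:(lra); have h3 := @Dm_ge x (- h) ltac:(lra) ltac:(lra) h1.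
  rewrite DE // !opprK in h2 h3.
  by rewrite ler_norml; lra.
move=> k k0.
have s1 := @Dp_right_continuous x (Dp x + k) xab ltac:(lra).
have s2 := @Dm_left_continuous x (Dp x - k) xab ltac:(rewrite DE //; lra).
have := small_and (small_and s1 s2) (small_and (small_lt (c := x - p) ltac:(lra)) (small_lt (c := q - x) ltac:(lra))).
apply: small_mono => d d0 [[h1 h2] [h3 h4]] y /ltr_normlP[y1 y2].
have [xy|yx|->] := ltgtP x y; last by rewrite subrr normr0.
  have [yb yk] := h1 y ltac:(lra); have := @Dp_mono x y ltac:(lra) (ltW xy) yb.
  by rewrite ltr_norml; lra.
have [ay yk] := h2 y ltac:(lra); have := @Dp_mono y x ay (ltW yx) ltac:(lra).
by rewrite DE in yk; [rewrite ltr_norml|]; lra.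
Qed.

Hypothesis dg : sum4_definable M g.

(* The right derivative jumps at [x] by at least [Dp y - Dp z]. *)
Definition kink z u v y x := u < x < v /\ exists d, 0 < d /\ forall h, 0 < h < d ->
  g (y + h) + g z + g x + g x <= g (x + h) + g (x - h) + g y + g (z + h).

(** Divide the inequality of [kink] by a small [h]. The supposed deficit is split into three parts
    because three one-sided slopes, two at [x] and one at [z], are only approximated. *)
Lemma kink_jump z u v y x : a <= u -> v <= b -> a < z < b -> a < y < b -> kink z u v y x ->
  Dp y - Dp z <= Dp x - Dm x.
Proof.
move=> au vb zab yab [xuv [d [d0 hd]]]; rewrite leNgt; apply/negP => lt.
pose k := (Dp y - Dp z - (Dp x - Dm x)) / 3.
have k0 : 0 < k by rewrite /k; lra.
have xab : a < x < b by lra.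
have [h [h0 [h1 [[h2 h3] [[h4 h5] [[h6 h7] h8]]]]]] := small_ex (small_and (small_lt d0) (small_and
  (@Dp_lt x (Dp x + k) xab ltac:(lra)) (small_and (@Dm_gt x (Dm x - k) xab ltac:(lra))
  (small_and (@Dp_lt z (Dp z + k) zab ltac:(lra)) (small_lt (c := b - y) ltac:(lra)))))).
have := hd h ltac:(lra); have := @Dp_le y h ltac:(lra) h0 ltac:(lra).
have : (Dp y - Dp z - (Dp x - Dm x)) * h = 3 * (k * h) by rewrite /k; field.
lra.
Qed.

Lemma jump_kink z u v y x : a < z < b -> a < y < b -> a < x < b -> u < x < v ->
  Dp y - Dp z < Dp x - Dm x -> kink z u v y x.
Proof.
move=> /andP[az zb] yab /andP[ax xb] xuv lt; split=> //.
have yk : Dp y < Dp x - Dm x + Dp z by lra.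
have [d [d0 hd]] := small_and (Dp_lt yab yk) (small_and (small_lt (c := b - z) ltac:(lra))
  (small_and (small_lt (c := b - x) ltac:(lra)) (small_lt (c := x - a) ltac:(lra)))).
clear lt yk; exists d; split=> // h hh; have [[h1 h2] [h3 [h4 h5]]] := hd h hh.
have /andP[h0 _] := hh.
have e1 := @Dp_le x h ax h0 ltac:(by rewrite -ltrBrDl).
have e2 := @Dm_ge x h xb h0 ltac:(by rewrite ltrBrDr -ltrBrDl).
have e3 := @Dp_le z h az h0 ltac:(by rewrite -ltrBrDl).
clear h1 h3 h4 h5 hd; lra.
Qed.

(** By convexity the increment [g (y + h) - g y] is nondecreasing in [y] for fixed [h]. *)
Lemma kink_anti z u v y y' x : a < y' -> y' <= y -> y < b -> kink z u v y x -> kink z u v y' x.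
Proof.
move=> ay'; rewrite le_eqVlt => /orP[/eqP->//|lt] yb [xuv [d [d0 hd]]]; split=> //.
have [e [e0 he]] := small_and (small_lt d0) (small_lt (c := b - y) ltac:(lra)).
exists e; split=> // h hh; have [h1 h2] := he h hh; have /andP[h0 _] := hh.
have := hd h ltac:(by rewrite h0).
have yhb : y + h < b by rewrite -ltrBrDl.
have y'h : y' < y' + h by rewrite ltrDl.
have := @cv y' (y' + h) (y + h) ay' y'h ltac:(by rewrite ltrD2r) yhb.
have := @cv y' y (y + h) ay' lt ltac:(by rewrite ltrDl) yhb.
have -> : y + h - y = h by ring.
have -> : y + h - (y' + h) = y - y' by ring.
have -> : y' + h - y' = h by ring.
set g1 := g (y + h); set g2 := g y; set g3 := g y'; set g4 := g (y' + h).
move=> c1 c2; have : (g4 - g3) * (y - y' + h) <= (g1 - g2) * (y - y' + h) by nra.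
rewrite ler_pM2r; last lra.
by clear c1 c2; lra.
Qed.

(** The monotone function [Dp] grows by at least [Dp y - Dp z] on reaching each further kink, and it
    is bounded on [(u, v)]. *)
Lemma kinks_finite z u v y : a < u -> v < b -> a < z < b -> a < y < b -> Dp z < Dp y ->
  exists s : seq R, forall x, kink z u v y x -> x \in s.
Proof.
move=> au vb zab yab lt; have c0 : 0 < Dp y - Dp z by lra.
apply: (@separated_finite R _ Dp (Dp u) (Dp v) _ c0).
  move=> x [/andP[ux xv] _]; apply/andP; split; apply: Dp_mono => //.
  - exact: ltW.
  - exact: lt_trans vb.
  - exact: lt_trans ux.
  - exact: ltW.
move=> x x' [/andP[ux xv] _] kx xx'; have [/andP[ux' x'v] _] := kx.
have h1 := kink_jump (ltW au) (ltW vb) zab yab kx.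
have h2 := Dp_le_Dm (lt_trans au ux) xx' (lt_trans x'v vb).
by rewrite distrC; apply: le_trans (ler_norm _); lra.
Qed.

(** Where [Dp] is constant there are no kinks. Otherwise the kinks of size at least
    [Dp (z + t) - Dp z] form a dense family indexed by [t], unless they miss an interval for every
    [t]; right continuity of [Dp] at [z] then excludes every kink there. *)
Lemma generic_C1_convex : (exists A u v, [/\ a <= u, v <= b & dense_family M u v A]) \/
  exists u v D, [/\ a <= u, u < v, v <= b & C1_on u v g D].
Proof.
have [[z [y [az zy yb flat]]]|nflat] := pselect (exists z y, [/\ a < z, z < y, y < b & Dp y <= Dp z]).
  right; exists z, y, Dp; split; try exact: ltW; first exact: zy.
  apply: no_kink_C1; try exact: ltW; move=> x /andP[zx xy].
  have h1 := @Dp_le_Dm z x az zx (lt_trans xy yb).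
  have h2 := @Dp_mono x y (lt_trans az zx) (ltW xy) yb.
  exact: le_trans h2 (le_trans flat h1).
have Dp_strict z y : a < z -> z < y -> y < b -> Dp z < Dp y.
  by move=> az zy yb; rewrite ltNge; apply/negP => h; apply: nflat; exists z, y.
(* The interval is shrunk so that [Dp u] and [Dp v] bound [Dp] on it. *)
have [u [v [z [au uv vb zab]]]] : exists u v z, [/\ a < u, u < v, v < b & a < z < b].
  have ab' := ab; exists (a + (b - a) / 4), (b - (b - a) / 4), ((a + b) / 2); split; lra.
have /andP[az zb] := zab.
pose A t x := (0 < t /\ z + t < b) /\ kink z u v (z + t) x.
have ztab t : 0 < t -> z + t < b -> a < z + t < b.
  by move=> t0 ->; rewrite andbT (lt_trans az) // ltrDl.
have [nd|dns] := pselect (exists p q, [/\ u <= p, p < q, q <= v & forall t x, p < x < q -> ~ A t x]).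
  have [p [q [up pq qv nA]]] := nd; right; exists p, q, Dp.
  have ap : a <= p := le_trans (ltW au) up; have qb : q <= b := le_trans qv (ltW vb).
  split=> //; apply: no_kink_C1 => // x xpq; rewrite leNgt; apply/negP => lt.
  have /andP[px xq] := xpq.
  have lt' : Dp z < Dp z + (Dp x - Dm x) by rewrite ltrDl subr_gt0.
  have [t [t0 ht]] := small_ex (Dp_right_continuous zab lt').
  have [|ztb ztk] := ht (z + t / 2); first lra.
  have t20 : 0 < t / 2 by rewrite divr_gt0.
  apply: (nA (t / 2) x xpq); split=> //; apply: jump_kink => //.
  - exact: ztab.
  - by rewrite (le_lt_trans ap) // (lt_le_trans xq).
  - by rewrite (le_lt_trans up) // (lt_le_trans xq).
  - by rewrite ltrBlDl.
left; exists A, u, v; split; try exact: ltW.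
split=> //; split.
- rewrite /A /kink; apply: dfn_and; first by ddec.
  apply: dfn_and; first by ddec.
  apply: (@dfn_ex _ _ (fun d v => _)); apply: dfn_and; first by ddec.
  apply: (@dfn_all _ _ (fun d v => _)); apply: dfn_imp; first by ddec.
  by apply: dg; ddec.
- move=> t; have [[t0 ztb]|nt] := pselect (0 < t /\ z + t < b); last first.
    by exists [::] => x [].
  have lt : Dp z < Dp (z + t) by apply: Dp_strict; rewrite // ltrDl.
  have [s hs] := kinks_finite au vb zab (ztab _ t0 ztb) lt.
  by exists s => x [_ /hs].
- move=> s t x /andP[s0 st] [[t0 ztb] kx].
  have zsb : z + s < b by rewrite (le_lt_trans _ ztb) // lerD2l.
  split=> //; apply: kink_anti kx => //; last by rewrite lerD2l.
  by case/andP: (ztab _ s0 zsb).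
- by move=> t x [[t0 _] [xuv _]].
- move=> p q up pq qv; apply: contrapT => nex; apply: dns; exists p, q; split=> // t x xpq tx.
  by apply: nex; exists t, x.
Qed.

End Convex.

Lemma C1_onN p q g D : C1_on p q g D -> C1_on p q (fun x => - g x) (fun x => - D x).
Proof.
move=> [h m]; split.
  move=> x /h[dx cx]; split; first exact: is_deriveN.
  move=> k /cx; apply: small_mono => d d0 hd y /hd.
  by rewrite -opprD normrN.
by case: m => m; [right|left] => x y *; rewrite lerN2; apply: m.
Qed.

Lemma generic_C1 a b g : a < b -> (forall x, a < x < b -> contat g x) -> sum4_definable M g ->
  (exists A u v, [/\ a <= u, v <= b & dense_family M u v A]) \/
  exists u v D, [/\ a <= u, u < v, v <= b & C1_on u v g D].
Proof.
move=> ab cg dg.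
have [[A dA]|[u [v [au uv vb cv]]]] := generic_convex ab cg dg.
  by left; exists A, a, b.
have cg' x : u < x < v -> contat g x by move=> xuv; apply: cg; lra.
case: cv => cv.
  have [[A [u' [v' [? ? ?]]]]|[u' [v' [D [? ? ? ?]]]]] := generic_C1_convex uv cg' cv dg.
    by left; exists A, u', v'; split=> //; lra.
  by right; exists u', v', D; split=> //; lra.
have cgN x : u < x < v -> contat (fun x => - g x) x.
  move/cg' => h k /h; apply: small_mono => d d0 hd y /hd.
  by rewrite -opprD normrN.
have [[A [u' [v' [? ? ?]]]]|[u' [v' [D [? ? ? h]]]]] :=
  generic_C1_convex uv cgN cv (sum4_definableN dg).
  by left; exists A, u', v'; split=> //; lra.
right; exists u', v', (fun x => - D x); split=> //; try lra.
by have := C1_onN h; under eq_fun do rewrite opprK.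
Qed.

End Kinks.

(** * From partially defined sums and products of values near 0 to a whole field *)

Section FieldFromSlopes.
Variables (R : realType) (M : expansion R).

Lemma field_type_transport (u v : R) (phi : R -> R) : u < v ->
  (forall x y, u < x -> x < y -> y < v -> phi x < phi y) ->
  (forall c, exists x, u < x < v /\ phi x = c) ->
  dfn M (fun e => [/\ u < e 0%N < v, u < e 1%N < v, u < e 2%N < v &
                      phi (e 2%N) = phi (e 0%N) + phi (e 1%N)]) ->
  dfn M (fun e => [/\ u < e 0%N < v, u < e 1%N < v, u < e 2%N < v &
                      phi (e 2%N) = phi (e 0%N) * phi (e 1%N)]) ->
  field_type M.
Proof.
move=> uv mono /choice[psi hpsi] dadd dmul.
have inj x y : u < x < v -> u < y < v -> phi x = phi y -> x = y.
  move=> /andP[ux xv] /andP[uy yv] e; case: (ltgtP x y) => // xy.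
    by have := mono _ _ ux xy yv; rewrite e ltxx.
  by have := mono _ _ uy xy xv; rewrite e ltxx.
pose op (o : R -> R -> R) x y := psi (o (phi x) (phi y)).
have opE o x y z : (u < x < v /\ u < y < v /\ z = op o x y) <->
    [/\ u < x < v, u < y < v, u < z < v & phi z = o (phi x) (phi y)].
  have [h1 h2] := hpsi (o (phi x) (phi y)).
  split=> [[? [? ->]]|[? ? zI e]]; first by split.
  by split=> //; split=> //; apply: inj => //; rewrite e h2.
exists `]u, v[%classic, (op +%R), (op *%R); split.
- by exists u, v.
- by move=> x y _ _; split; rewrite /= in_itv /=; apply: (hpsi _).1.
- apply/definable_fun2E; apply: dfn_ext dadd => e; rewrite -opE /= !in_itv /=.
  by split=> [[]|[? []]].
- apply/definable_fun2E; apply: dfn_ext dmul => e; rewrite -opE /= !in_itv /=.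
  by split=> [[]|[? []]].
exists phi; split.
- split=> //.
    by move=> x y; rewrite !inE /= !in_itv /=; exact: inj.
  by move=> c _; have [cI cE] := hpsi c; exists (psi c) => //=; rewrite in_itv.
- move=> x y; rewrite /= !in_itv /= => /andP[ux xv] /andP[uy yv].
  split=> h; first exact: mono.
  rewrite ltNge; apply/negP; rewrite le_eqVlt => /orP[/eqP e|yx].
    by move: h; rewrite e ltxx.
  by have := lt_trans h (mono _ _ uy yx xv); rewrite ltxx.
- by move=> x y _ _; have [] := hpsi (phi x + phi y).
- by move=> x y _ _; have [] := hpsi (phi x * phi y).
Qed.

Section Values.
Variables (a b : R) (s : R -> R) (eta : R).
Hypothesis eta0 : 0 < eta.
Hypothesis eta1 : eta <= 2^-1.
Hypothesis s_onto : forall t, `|t| <= eta -> exists x, a < x < b /\ s x = t.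
Hypothesis s_inj : forall x y, a < x < b -> a < y < b -> s x = s y -> x = y.
Hypothesis dadd : dfn M (fun e => [/\ a < e 0%N < b, a < e 1%N < b, a < e 2%N < b &
                      s (e 2%N) = s (e 0%N) + s (e 1%N)]).
Hypothesis dmul : dfn M (fun e => [/\ a < e 0%N < b, a < e 1%N < b, a < e 2%N < b &
                      s (e 2%N) = s (e 0%N) * s (e 1%N)]).

(* The field element [T] is definable when its code, the [x] with [s x = T], is. *)
Definition coded (T : (nat -> R) -> R) := dfn M (fun v => a < v 0%N < b /\ s (v 0%N) = T (fun i => v i.+1)).

Definition bounded_by_eta (T : (nat -> R) -> R) := forall v, `|T v| <= eta.

(** The operands are replaced by their codes under existential quantifiers; the bound by [eta]
    guarantees that these codes exist. *)
Lemma coded_op (o : R -> R -> R) T U :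
  dfn M (fun e => [/\ a < e 0%N < b, a < e 1%N < b, a < e 2%N < b &
                      s (e 2%N) = o (s (e 0%N)) (s (e 1%N))]) ->
  bounded_by_eta T -> bounded_by_eta U -> coded T -> coded U -> coded (fun v => o (T v) (U v)).
Proof.
pose Q x y z := [/\ a < x < b, a < y < b, a < z < b & s z = o (s x) (s y)].
move=> do' bT bU cT cU; have dQ : dfn M (fun e => Q (e 0%N) (e 1%N) (e 2%N)) := do'.
apply: (@dfn_ext _ _ _ (fun v => exists x, (a < x < b /\ s x = T (fun i => v i.+1)) /\
   exists y, (a < y < b /\ s y = U (fun i => v i.+1)) /\ Q x y (v 0%N))).
  move=> v; split=> [[v0 h]|[x [[xI <-] [y [[yI <-] []]]]]//].
  have [x [xI hx]] := s_onto (bT (fun i => v i.+1)).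
  have [y [yI hy]] := s_onto (bU (fun i => v i.+1)).
  by exists x; split=> //; exists y; split=> //; split=> //; rewrite hx hy.
apply: (@dfn_ex _ _ (fun x v => _)); apply: dfn_and.
  exact: (dfn_subst (fun i => if i is j.+1 then j.+2 else 0%N) cT).
apply: (@dfn_ex _ _ (fun x v => _)); apply: dfn_and; last by ddec.
exact: (dfn_subst (fun i => if i is j.+1 then j.+3 else 0%N) cU).
Qed.

Lemma coded_const c : coded (fun=> c).
Proof.
have [[x [xI hx]]|none] := pselect (exists x, a < x < b /\ s x = c).
  apply: (@dfn_ext _ _ _ (fun v => v 0%N = x)); last by ddec.
  by move=> v; split=> [[vI vc]|->//]; apply: s_inj => //; rewrite vc.
by apply: dfn_ext (dfn_cst M False) => v; split=> // h; apply: none; exists (v 0%N).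
Qed.

Lemma coded_eq T U : bounded_by_eta T -> coded T -> coded U -> dfn M (fun v => T v = U v).
Proof.
move=> bT cT cU.
apply: (@dfn_ext _ _ _ (fun v => exists x, (a < x < b /\ s x = T v) /\ (a < x < b /\ s x = U v))).
  move=> v; split=> [<-|[x [[_ <-] [_ ->]]]//].
  by have [x hx] := s_onto (bT v); exists x.
by apply: (@dfn_ex _ _ (fun x v => _)); apply: dfn_and.
Qed.

Lemma bounded_mul T U : bounded_by_eta T -> bounded_by_eta U ->
  forall v, `|T v * U v| <= eta / 2.
Proof.
move=> bT bU v; rewrite normrM; apply: (@le_trans _ _ (eta * 2^-1)) => //.
apply: ler_pM => //; first exact: le_trans (bU v) eta1.
Qed.

End Values.

Lemma ratio_lt (eta X Y : R) : `|X| < eta -> `|Y| < eta -> X < Y ->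
  X / (eta ^+ 2 - X ^+ 2) < Y / (eta ^+ 2 - Y ^+ 2).
Proof.
move=> /ltr_normlP[x1 x2] /ltr_normlP[y1 y2] xy.
have p Z : - Z < eta -> Z < eta -> 0 < eta ^+ 2 - Z ^+ 2 by nra.
rewrite ltr_pdivrMr ?p // mulrAC ltr_pdivlMr ?p //.
have : 0 < (Y - X) * (eta ^+ 2 + X * Y) by apply: mulr_gt0; nra.
nra.
Qed.

Lemma ratio_onto (eta c : R) : 0 < eta -> exists X, `|X| < eta /\ X / (eta ^+ 2 - X ^+ 2) = c.
Proof.
move=> e0; pose r := Num.sqrt (1 + 4 * (c * eta) ^+ 2).
have sq0 : 0 <= (c * eta) ^+ 2 by exact: sqr_ge0.
have r2 : r ^+ 2 = 1 + 4 * (c * eta) ^+ 2 by rewrite sqr_sqrtr //; slra.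
have r0 : 0 <= r by exact: sqrtr_ge0.
have r1 : 0 < 1 + r by slra.
(* The root of [c * X ^ 2 + X = c * eta ^ 2] of smaller absolute value, rationalized so that it also
   covers [c = 0]. *)
exists (2 * c * eta ^+ 2 / (1 + r)).
have Xlt : `|2 * c * eta ^+ 2 / (1 + r)| < eta.
  have cr : `|2 * c * eta| <= r.
    rewrite /r -sqrtr_sqr; apply: ler_wsqrtr.
    have -> : (2 * c * eta) ^+ 2 = 4 * (c * eta) ^+ 2 by ring.
    slra.
  rewrite normrM normfV (gtr0_norm r1) ltr_pdivrMr //.
  rewrite (_ : 2 * c * eta ^+ 2 = 2 * c * eta * eta); last by ring.
  rewrite normrM (gtr0_norm e0) [eta * _]mulrC ltr_pM2r //; slra.
split=> //; set X := _ / _ in Xlt *.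
have p : 0 < eta ^+ 2 - X ^+ 2 by move/ltr_normlP: Xlt => [x1 x2]; nra.
apply: (mulIf (lt0r_neq0 p)); rewrite divfK ?gt_eqF //.
have r2n : (1 + r) * (1 + r) != 0 by rewrite mulf_neq0 // gt_eqF.
apply: (mulIf r2n).
have Xr : X * (1 + r) = 2 * c * eta ^+ 2 by rewrite /X divfK // gt_eqF.
have -> : c * (eta ^+ 2 - X ^+ 2) * ((1 + r) * (1 + r)) =
  c * (eta ^+ 2 * (1 + r) ^+ 2 - (X * (1 + r)) ^+ 2) by ring.
rewrite mulrA Xr.
have -> : eta ^+ 2 * (1 + r) ^+ 2 - (2 * c * eta ^+ 2) ^+ 2 =
  eta ^+ 2 * (1 + 2 * r + r ^+ 2 - 4 * (c * eta) ^+ 2) by ring.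
by rewrite r2; ring.
Qed.

Lemma frac_eq (A B C D : R) : B != 0 -> D != 0 -> A / B = C / D <-> A * D = B * C.
Proof.
move=> B0 D0; split=> [h|h].
  by apply/eqP; rewrite [B * C]mulrC -eqr_div //; apply/eqP.
by apply/eqP; rewrite eqr_div // [C * B]mulrC; apply/eqP.
Qed.

(** Sums and products are available only as long as the results are values of [s]. With denominators
    cleared, the operations on the fractions [X / (eta ^ 2 - X ^ 2)] become equations between terms
    that never leave [[-eta, eta]]. *)
Lemma field_of_values a b p (s : R -> R) : a < p < b -> s p = 0 ->
  (forall x y, a < x -> x < y -> y < b -> s x < s y) ->
  (forall x, a < x < b -> contat s x) ->
  dfn M (fun e => [/\ a < e 0%N < b, a < e 1%N < b, a < e 2%N < b &
                      s (e 2%N) = s (e 0%N) + s (e 1%N)]) ->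
  dfn M (fun e => [/\ a < e 0%N < b, a < e 1%N < b, a < e 2%N < b &
                      s (e 2%N) = s (e 0%N) * s (e 1%N)]) ->
  field_type M.
Proof.
move=> /andP[ap pb] sp mono cs dadd dmul.
pose x1 := (a + p) / 2; pose x2 := (p + b) / 2.
have [ax1 x1p] : a < x1 /\ x1 < p by rewrite /x1; split; slra.
have [px2 x2b] : p < x2 /\ x2 < b by rewrite /x2; split; slra.
have s1 : s x1 < 0 by rewrite -sp; apply: mono.
have s2 : 0 < s x2 by rewrite -sp; apply: mono.
(* The bounds by [- s x1] and [s x2] let the intermediate value theorem reach all of [[-eta, eta]],
   and the bound [1 / 2] makes products small enough to be added. *)
pose eta := Num.min 2^-1 (Num.min (- s x1) (s x2)).
have eta0 : 0 < eta by rewrite /eta !lt_min; slra.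
have eta1 : eta <= 2^-1 by rewrite /eta ge_min lexx.
have eta2 : eta <= - s x1 by rewrite /eta !ge_min lexx orbT.
have eta3 : eta <= s x2 by rewrite /eta !ge_min lexx !orbT.
clearbody x1 x2 eta.
have s_inj x y : a < x < b -> a < y < b -> s x = s y -> x = y.
  move=> /andP[ux xv] /andP[uy yv] e; case: (ltgtP x y) => // xy.
    by have := mono _ _ ux xy yv; rewrite e ltxx.
  by have := mono _ _ uy xy xv; rewrite e ltxx.
have s_ltE x y : a < x < b -> a < y < b -> (s x < s y) = (x < y).
  move=> /andP[ux xv] /andP[uy yv]; case: (ltgtP x y) => xy.
  - exact: mono.
  - by apply/negbTE; rewrite -leNgt ltW // mono.
  - by rewrite xy ltxx.
have s_onto t : `|t| <= eta -> exists x, a < x < b /\ s x = t.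
  rewrite ler_norml => /andP[t1 t2].
  have x12 : x1 <= x2 by slra.
  have [||x] := @IVT R s x1 x2 t x12.
  - by apply: contat_within => x xx; apply: cs; slra.
  - by rewrite ge_min le_max; apply/andP; split; apply/orP; [left|right]; slra.
  by rewrite in_itv /= => xx <-; exists x; split=> //; slra.
have [u [uI su]] : exists x, a < x < b /\ s x = - eta by apply: s_onto; rewrite normrN gtr0_norm.
have [w [wI sw]] : exists x, a < x < b /\ s x = eta by apply: s_onto; rewrite gtr0_norm.
have pI : a < p < b by slra.
have uw : u < w by rewrite -s_ltE // su sw; slra.
have IE x : a < x < b -> (u < x < w) = (`|s x| < eta).
  by move=> xI; rewrite ltr_norml -su -sw !s_ltE.
have Iab x : u < x < w -> a < x < b by slra.
(* Outside [(u, w)] the default value is [0], which has the code [p]; so [cut] is bounded and coded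
   for all valuations. *)
pose cut x := if `[< u < x < w >] then s x else 0.
have cut_lt x : `|cut x| < eta.
  rewrite /cut; case: asboolP => h; last by rewrite normr0.
  by rewrite -IE //; exact: Iab.
have cutE x : u < x < w -> cut x = s x by rewrite /cut; case: asboolP.
(* The bookkeeping of sizes: a product of two [ok] terms is [half], and a sum or difference of two
   [half] terms is [ok]. *)
pose ok T := bounded_by_eta eta T /\ coded a b s T.
pose half (T : (nat -> R) -> R) := (forall v, `|T v| <= eta / 2) /\ coded a b s T.
have half_ok T : half T -> ok T by move=> [h c]; split=> // v; have := h v; slra.
have ok_mul T U : ok T -> ok U -> half (fun v => T v * U v).
  move=> [bT cT] [bU cU]; split; first exact: bounded_mul.
  exact: (coded_op (o := fun x y => x * y) s_onto).
have half_add T U : half T -> half U -> ok (fun v => T v + U v).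
  move=> hT hU; split=> [v|].
    by have := hT.1 v; have := hU.1 v; have := ler_normD (T v) (U v); slra.
  by apply: (coded_op (o := fun x y => x + y) s_onto) => //; case: (half_ok _ hT); case: (half_ok _ hU).
have half_sub T U : half T -> half U -> ok (fun v => T v - U v).
  move=> hT hU; split=> [v|].
    by have := hT.1 v; have := hU.1 v; have := ler_normB (T v) (U v); slra.
  apply: (coded_op (o := fun x y => x - y) s_onto); try by case: (half_ok _ hT); case: (half_ok _ hU).
  pose Q x y z := [/\ a < x < b, a < y < b, a < z < b & s z = s x + s y].
  have dQ : dfn M (fun e => Q (e 0%N) (e 1%N) (e 2%N)) := dadd.
  apply: (@dfn_ext _ _ _ (fun e => Q (e 2%N) (e 1%N) (e 0%N))); last by ddec.
  by move=> e; split=> -[? ? ? h]; split=> //; rewrite h; ring.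
have ok_cut k : ok (fun v => cut (v k)).
  split=> [v|]; first exact: ltW.
  apply: (@dfn_ext _ _ _ (fun v => (u < v k.+1 < w /\ v 0%N = v k.+1) \/
     (~ (u < v k.+1 < w) /\ v 0%N = p))); last by ddec.
  move=> v; rewrite /cut; case: asboolP => h.
    split=> [[vI e]|[[_ ->]|[]//]]; last by split=> //; exact: Iab.
    by left; split=> //; apply: s_inj => //; exact: Iab.
  split=> [[vI e]|[[]//|[_ ->]]]; last by split.
  by right; split=> //; apply: s_inj => //; rewrite sp.
pose e2 := eta * eta.
have half_e2 : half (fun=> e2).
  split; last exact: coded_const.
  by move=> v; rewrite /e2 gtr0_norm; nra.
pose d T := fun v : nat -> R => e2 - T v * T v.
have ok_d k : ok (d (fun v => cut (v k))).
  by apply: half_sub => //; apply: ok_mul.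
have e2E X : e2 - X * X = eta ^+ 2 - X ^+ 2 by rewrite /e2 !expr2.
have d0 x : e2 - cut x * cut x != 0.
  have /ltr_normlP[c1 c2] := cut_lt x; rewrite gt_eqF // /e2; nra.
apply: (@field_type_transport u w (fun x => cut x / (e2 - cut x * cut x))) => //.
- move=> x y ux xy yw; rewrite !e2E; apply: ratio_lt => //.
  have xI : u < x < w by rewrite ux (lt_trans xy).
  have yI : u < y < w by rewrite yw (lt_trans ux).
  have /andP[ax _] := Iab _ xI; have /andP[_ yb] := Iab _ yI.
  by rewrite !cutE //; exact: mono.
- move=> c; have [X [Xe <-]] := ratio_onto c eta0.
  have [x [xI xX]] := s_onto X (ltW Xe).
  have xuw : u < x < w by rewrite IE // xX.
  by exists x; split=> //; rewrite e2E cutE // xX.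
- apply: (@dfn_ext _ _ _ (fun v => (u < v 0%N < w /\ u < v 1%N < w /\ u < v 2%N < w) /\
    cut (v 2%N) * (d (fun v => cut (v 0%N)) v * d (fun v => cut (v 1%N)) v) =
    (d (fun v => cut (v 2%N)) v) * (cut (v 0%N) * d (fun v => cut (v 1%N)) v +
       cut (v 1%N) * d (fun v => cut (v 0%N)) v))).
    move=> v; rewrite addf_div ?d0 //.
    have := frac_eq (cut (v 2%N)) (cut (v 0%N) * (e2 - cut (v 1%N) * cut (v 1%N)) +
       cut (v 1%N) * (e2 - cut (v 0%N) * cut (v 0%N))) (d0 (v 2%N)) (mulf_neq0 (d0 (v 0%N)) (d0 (v 1%N))).
    by rewrite /d; move=> [h1 h2]; split=> [[? ? ? /h1 ?]|[[? [? ?]] /h2 ?]].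
  apply: dfn_and; first by ddec.
  have := ok_mul _ _ (ok_cut 2%N) (half_ok _ (ok_mul _ _ (ok_d 0%N) (ok_d 1%N))).
  have := ok_mul _ _ (ok_d 2%N) (half_add _ _ (ok_mul _ _ (ok_cut 0%N) (ok_d 1%N))
    (ok_mul _ _ (ok_cut 1%N) (ok_d 0%N))).
  by move=> /half_ok[_ h1] /half_ok[h2 h3]; exact: (coded_eq s_onto h2 h3 h1).
- apply: (@dfn_ext _ _ _ (fun v => (u < v 0%N < w /\ u < v 1%N < w /\ u < v 2%N < w) /\
    cut (v 2%N) * (d (fun v => cut (v 0%N)) v * d (fun v => cut (v 1%N)) v) =
    (d (fun v => cut (v 2%N)) v) * (cut (v 0%N) * cut (v 1%N)))).
    move=> v; rewrite mulf_div.
    have := frac_eq (cut (v 2%N)) (cut (v 0%N) * cut (v 1%N)) (d0 (v 2%N)) (mulf_neq0 (d0 (v 0%N)) (d0 (v 1%N))).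
    by rewrite /d; move=> [h1 h2]; split=> [[? ? ? /h1 ?]|[[? [? ?]] /h2 ?]].
  apply: dfn_and; first by ddec.
  have := ok_mul _ _ (ok_cut 2%N) (half_ok _ (ok_mul _ _ (ok_d 0%N) (ok_d 1%N))).
  have := ok_mul _ _ (ok_d 2%N) (half_ok _ (ok_mul _ _ (ok_cut 0%N) (ok_cut 1%N))).
  by move=> /half_ok[_ h1] /half_ok[h2 h3]; exact: (coded_eq s_onto h2 h3 h1).
Qed.

End FieldFromSlopes.

(** * Germs of increments and their slopes *)

Section Slopes.
Variables (R : realType) (M : expansion R).
Implicit Types (u w : R -> R) (c e : R).

(** [u] vanishes at [0] and has derivative [c] there; the case [h = 0] forces [u 0 = 0]. *)
Definition slope0 u c := forall k, 0 < k ->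
  small (fun d => forall h, `|h| < d -> `|u h - c * h| <= k * `|h|).

Lemma slope0_add u w c e : slope0 u c -> slope0 w e -> slope0 (fun h => u h + w h) (c + e).
Proof.
move=> hu hw k k0; have k2 : 0 < k / 2 by lra.
apply: small_mono (small_and (hu _ k2) (hw _ k2)) => d d0 [h1 h2] h hd.
have := h1 h hd; have := h2 h hd.
have -> : u h + w h - (c + e) * h = (u h - c * h) + (w h - e * h) by ring.
have := ler_normD (u h - c * h) (w h - e * h); lra.
Qed.

Lemma slope0_opp u c : slope0 u c -> slope0 (fun h => - u h) (- c).
Proof.
move=> hu k /hu; apply: small_mono => d d0 H h /H.
by rewrite -normrN opprB mulNr opprK addrC.
Qed.

Lemma slope0_lt u w c e : slope0 u c -> slope0 w e -> c < e -> small (fun h => u h < w h).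
Proof.
move=> hu hw ce; have k0 : 0 < (e - c) / 3 by lra.
have [d [d0 hd]] := small_and (hu _ k0) (hw _ k0).
have d2 : 0 < d / 2 < d by lra.
have [h1 h2] := hd _ d2.
exists (d / 2); split; first lra.
move=> h /andP[h0 hh]; have := h1 h; have := h2 h; rewrite gtr0_norm // => /(_ hh) a /(_ hh) b.
move: a b; rewrite !ler_norml => /andP[a1 a2] /andP[b1 b2].
have p : 0 < (e - c) / 3 * h by apply: mulr_gt0.
have : e * h - c * h = 3 * ((e - c) / 3 * h) by field.
lra.
Qed.

Lemma slope0_comp u w c e : slope0 u c -> slope0 w e -> slope0 (fun h => u (w h)) (c * e).
Proof.
move=> hu hw k k0.
(* [k1] controls the error of [u] and [k2] that of [w], each contributing at most [k / 2 * |h|]. The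
   bound [k2 <= 1] yields [|w h| <= (1 + |e|) * |h|]. *)
pose k1 := k / 2 / (1 + `|e|); pose k2 := Num.min 1 (k / 2 / (1 + `|c|)).
have e0 : 0 <= `|e| by []. have c0 : 0 <= `|c| by [].
have k10 : 0 < k1 by rewrite /k1; do 2 (apply: divr_gt0; last lra); lra.
have kc0 : 0 < k / 2 / (1 + `|c|) by do 2 (apply: divr_gt0; last lra); lra.
have k20 : 0 < k2 by rewrite /k2 lt_min kc0 ltr01.
have [d1 [d10 h1]] := hu _ k10.
have d12 : 0 < d1 / 2 < d1 by lra.
have {h1} H1 := h1 _ d12.
have q0 : 0 < d1 / 2 / (1 + `|e|) by apply: divr_gt0; lra.
apply: small_mono (small_and (hw _ k20) (small_lt q0)) => d d0 [H2 dd] h hd.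
have w1 := H2 _ hd.
have h0 : 0 <= `|h| by [].
have k21 : k2 <= 1 by rewrite /k2 ge_min lexx.
have k2c : k2 <= k / 2 / (1 + `|c|) by rewrite /k2 ge_min lexx orbT.
have w2 : `|w h| <= (1 + `|e|) * `|h|.
  have := ler_normD (w h - e * h) (e * h); rewrite subrK normrM; nra.
have w3 : `|w h| < d1 / 2.
  apply: le_lt_trans w2 _; rewrite mulrC -ltr_pdivlMr; last lra.
  exact: lt_trans hd dd.
have := H1 _ w3.
have -> : u (w h) - c * e * h = (u (w h) - c * w h) + c * (w h - e * h) by ring.
have := ler_normD (u (w h) - c * w h) (c * (w h - e * h)); rewrite (normrM c) => n1 n2.
have n3 : k1 * `|w h| <= k / 2 * `|h|.
  apply: le_trans (ler_wpM2l (ltW k10) w2) _.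
  by rewrite mulrA /k1 divfK // gt_eqF //; lra.
have n4 : `|c| * `|w h - e * h| <= k / 2 * `|h|.
  apply: le_trans (ler_wpM2l c0 w1) _; rewrite mulrA ler_wpM2r //.
  move: k2c; rewrite ler_pdivlMr; last lra.
  by move=> k2c; nra.
lra.
Qed.

Lemma dfn_small (P : R -> (nat -> R) -> Prop) :
  dfn M (fun v => P (v 0%N) (fun i => v i.+1)) -> dfn M (fun v => small (fun h => P h v)).
Proof.
move=> dP; rewrite /small; apply: (@dfn_ex _ _ (fun d v => _)); apply: dfn_and; first by ddec.
apply: (@dfn_all _ _ (fun d v => _)); apply: dfn_imp; first by ddec.
exact: (dfn_subst (fun i => if i is j.+1 then j.+2 else 0%N) dP).
Qed.

Section C1.
Variables (a b : R) (f D : R -> R).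
Hypothesis ab : a < b.
Hypothesis df : dfn M (fun v => v 0%N = f (v 1%N)).
Hypothesis fD : forall x, a < x < b -> is_derive x 1 f (D x).
Hypothesis cD : forall x, a < x < b -> contat D x.
Hypothesis Dlt : forall x y, a < x -> x < y -> y < b -> D x < D y.

Let p := (a + b) / 2.
Definition gam x h := f (x + h) - f x - (f (p + h) - f p).
Definition slp x := D x - D p.

Let pab : a < p < b.
Proof. by have ab' := ab; rewrite /p; lra. Qed.

Lemma gam_slope x : a < x < b -> slope0 (gam x) (slp x).
Proof.
move=> xab; have h z : a < z < b -> slope0 (fun h => f (z + h) - f z) (D z).
  by move=> /fD/is_derive_eps.
exact: slope0_add (h _ xab) (slope0_opp (h _ pab)).
Qed.

Lemma slp_lt x y : a < x -> x < y -> y < b -> slp x < slp y.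
Proof. by move=> ax xy yb; have := Dlt ax xy yb; rewrite /slp; lra. Qed.

Lemma slp_cont x : a < x < b -> contat slp x.
Proof.
move/cD => h k /h; apply: small_mono => d d0 H y /H; rewrite /slp.
by have -> : D y - D p - (D x - D p) = D y - D x by ring.
Qed.

(** Strictly ordered slopes give ordered germs. Conversely, if [slp z] differed from [c], continuity
    of [slp] would give a [w] near [z], on the side of [c], whose slope still lies on the wrong side
    of [c]. *)
Lemma slope_compare u c z : slope0 u c -> a < z < b ->
  slp z = c <-> forall w : R, a < w < b ->
    (z < w -> small (fun h => u h < gam w h)) /\ (w < z -> small (fun h => gam w h < u h)).
Proof.
move=> uc zab; split=> [zc w wab|H].
  split=> zw; apply: slope0_lt; try exact: uc; try exact: gam_slope.
    by rewrite -zc; apply: slp_lt; lra.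
  by rewrite -zc; apply: slp_lt; lra.
case: (ltgtP (slp z) c) => // lt.
  have k0 : 0 < c - slp z by lra.
  have [d [d0 [h1 h2]]] := small_ex (small_and (slp_cont zab k0) (small_lt (c := b - z) ltac:(lra))).
  have wab : a < z + d / 2 < b by lra.
  have /ltr_normlP[_ w1] : `|slp (z + d / 2) - slp z| < c - slp z.
    by apply: h1; rewrite addrC addKr gtr0_norm; lra.
  have [/(_ ltac:(lra)) s1 _] := H _ wab.
  have s2 : small (fun h => gam (z + d / 2) h < u h).
    by apply: slope0_lt (gam_slope wab) uc _; lra.
  by have [h [_ [q1 q2]]] := small_ex (small_and s1 s2); have := lt_trans q1 q2; rewrite ltxx.
have k0 : 0 < slp z - c by lra.
have [d [d0 [h1 h2]]] := small_ex (small_and (slp_cont zab k0) (small_lt (c := z - a) ltac:(lra))).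
have wab : a < z - d / 2 < b by lra.
have /ltr_normlP[w1 _] : `|slp (z - d / 2) - slp z| < slp z - c.
  by apply: h1; rewrite addrC addKr normrN gtr0_norm; lra.
have [_ /(_ ltac:(lra)) s1] := H _ wab.
have s2 : small (fun h => u h < gam (z - d / 2) h).
  by apply: slope0_lt uc (gam_slope wab) _; lra.
by have [h [_ [q1 q2]]] := small_ex (small_and s1 s2); have := lt_trans q1 q2; rewrite ltxx.
Qed.

Lemma dterm_gam t1 t2 : dterm M t1 -> dterm M t2 -> dterm M (fun v => gam (t1 v) (t2 v)).
Proof. by move=> d1 d2; have df' := df; rewrite /gam; ddec. Qed.

Lemma dfn_slope (u : R -> R -> R -> R) (o : R -> R -> R) :
  (forall x y, a < x < b -> a < y < b -> slope0 (u x y) (o (slp x) (slp y))) ->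
  (forall t1 t2 t3, dterm M t1 -> dterm M t2 -> dterm M t3 ->
     dterm M (fun v => u (t1 v) (t2 v) (t3 v))) ->
  dfn M (fun v => [/\ a < v 0%N < b, a < v 1%N < b, a < v 2%N < b &
                      slp (v 2%N) = o (slp (v 0%N)) (slp (v 1%N))]).
Proof.
move=> hu du.
apply: (@dfn_ext _ _ _ (fun v => (a < v 0%N < b /\ a < v 1%N < b /\ a < v 2%N < b) /\
  forall w : R, a < w < b ->
    (v 2%N < w -> small (fun h => u (v 0%N) (v 1%N) h < gam w h)) /\
    (w < v 2%N -> small (fun h => gam w h < u (v 0%N) (v 1%N) h)))).
  move=> v; split=> [[h0 h1 h2 h3]|[[h0 [h1 h2]] h3]].
    by split=> //; apply/(slope_compare (hu _ _ h0 h1) h2).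
  by split=> //; apply/(slope_compare (hu _ _ h0 h1) h2).
apply: dfn_and; first by ddec.
apply: (@dfn_all _ _ (fun x v => _)); apply: dfn_imp; first by ddec.
by apply: dfn_and; (apply: dfn_imp; first by ddec);
  apply: (@dfn_small (fun h v => _)); apply: dfn_lt;
  try (apply: dterm_gam; ddec); apply: du; ddec.
Qed.

Lemma C1_field_type : field_type M.
Proof.
apply: (@field_of_values _ _ a b p slp); rewrite ?pab //.
- by rewrite /slp subrr.
- exact: slp_lt.
- exact: slp_cont.
- apply: (dfn_slope (u := fun x y h => gam x h + gam y h) (o := fun x y => x + y)).
    by move=> x y xab yab; apply: slope0_add; exact: gam_slope.
  by move=> *; apply: dterm_add; exact: dterm_gam.
(* By the chain rule at [0], composition of germs multiplies slopes. *)
- apply: (dfn_slope (u := fun x y h => gam x (gam y h)) (o := fun x y => x * y)).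
    by move=> x y xab yab; apply: (slope0_comp (u := gam x)); exact: gam_slope.
  by move=> *; do 2 apply: dterm_gam => //.
Qed.

End C1.

Lemma monotone_C1_field_type (a b : R) (f D : R -> R) : a < b -> dfn M (fun v => v 0%N = f (v 1%N)) ->
  (forall x, a < x < b -> is_derive x 1 f (D x) /\ contat D x) ->
  (forall x y, a < x -> x < y -> y < b -> D x < D y) \/
  (forall x y, a < x -> x < y -> y < b -> D y < D x) -> field_type M.
Proof.
move=> ab df h [mono|mono].
  by apply: (@C1_field_type a b f D) => // x /h[].
apply: (@C1_field_type a b (fun x => - f x) (fun x => - D x)) => //.
- apply: (@dterm_opp _ _ (fun v => f (v 0%N))); exact: df.
- by move=> x /h[dx _]; exact: is_deriveN.
- move=> x /h[_ cx] k /cx; apply: small_mono => d d0 hd y /hd.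
  by rewrite -opprD normrN.
- by move=> x y *; rewrite ltrN2; exact: mono.
Qed.

End Slopes.

(** * Locality of derivatives and of continuity *)

Section Local.
Variable R : realType.
Implicit Types (f g : R -> R) (x : R).

Lemma is_derive_local f g x (D : R) : small (fun d => forall y, `|y - x| < d -> f y = g y) ->
  is_derive x 1 g D -> is_derive x 1 f D.
Proof.
move=> [d [d0 hd]] /is_derive_eps hg; apply/is_derive_eps => k /hg sm.
have fx y : `|y - x| < d -> f y = g y.
  move=> yd; have n0 : 0 <= `|y - x| by [].
  by apply: (hd ((`|y - x| + d) / 2)); lra.
apply: small_mono (small_and sm (small_lt d0)) => e e0 [he ed] h hh.
rewrite !fx ?subrr ?normr0 //; last by rewrite addrC addKr (lt_trans hh).
exact: he.
Qed.

Lemma contat_local f g x : small (fun d => forall y, `|y - x| < d -> f y = g y) ->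
  contat g x -> contat f x.
Proof.
move=> [d [d0 hd]] hg k /hg sm.
have fx y : `|y - x| < d -> f y = g y.
  move=> yd; have n0 : 0 <= `|y - x| by [].
  by apply: (hd ((`|y - x| + d) / 2)); lra.
apply: small_mono (small_and sm (small_lt d0)) => e e0 [he ed] h hh.
rewrite !fx ?subrr ?normr0 //; last by rewrite (lt_trans hh).
exact: he.
Qed.

Lemma near_open (a b x : R) (P : R -> Prop) : a < x < b -> (forall y, a < y < b -> P y) ->
  small (fun d => forall y, `|y - x| < d -> P y).
Proof.
move=> xab h; have [||d [d0 hd]] := small_and (small_lt (c := x - a) _) (small_lt (c := b - x) _); try lra.
exists d; split=> // e he y /ltr_normlP[y1 y2]; have [h1 h2] := hd _ he; apply: h; lra.
Qed.

Lemma is_derive_contat f x (D : R) : is_derive x 1 f D -> contat f x.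
Proof.
by move=> h; apply/contatP; apply: differentiable_continuous; apply/derivable1_diffP; apply: ex_derive.
Qed.

Lemma C2_oo (a b : R) f f1 f2 :
  (forall t, a < t < b -> is_derive t 1 f (f1 t)) ->
  (forall t, a < t < b -> is_derive t 1 f1 (f2 t)) ->
  (forall t, a < t < b -> contat f2 t) -> C2 `]a, b[%classic f.
Proof.
move=> h1 h2 h3.
have e1 t : a < t < b -> f^`()%classic t = f1 t.
  by move=> /h1 h; rewrite derive1E derive_val.
have d1 t : a < t < b -> is_derive t 1 (f^`()%classic) (f2 t).
  move=> tab; apply: is_derive_local (h2 _ tab); exact: near_open e1.
have e2 t : a < t < b -> f^`(2)%classic t = f2 t.
  by move=> /d1 h; rewrite /= derive1E derive_val.
split=> [x|x|]; rewrite ?/=.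
- by rewrite in_itv /= => /h1 h; apply: ex_derive.
- by rewrite in_itv /= => /d1 h; apply: ex_derive.
apply: continuous_in_subspaceT => x; rewrite inE /= in_itv /= => xab.
by apply/contatP; apply: contat_local (h3 _ xab); exact: near_open e2.
Qed.

End Local.

(** * Definability in terms of a definable field on an interval *)

Section Field.
Variables (R : realType) (M : expansion R).

(* [Phi] extends the isomorphism from the interval [(a, b)] to the reals by a constant;
   [psi] is its inverse. *)
Definition field_data (a b : R) (Phi psi : R -> R) : Prop :=
  [/\ a < b, forall c, a < psi c < b /\ Phi (psi c) = c, forall x, a < x < b -> psi (Phi x) = x
    & forall x y, a < x -> x < y -> y < b -> Phi x < Phi y] /\
  [/\ dfn M (fun v => v 0%N = psi (Phi (v 1%N) + Phi (v 2%N))),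
      dfn M (fun v => v 0%N = psi (Phi (v 1%N) * Phi (v 2%N)))
    & dfn M (fun v => is_true (Phi (v 0%N) <= Phi (v 1%N)))].

Lemma field_typeP : field_type M -> exists a b Phi psi, field_data a b Phi psi.
Proof.
move=> [I [oplus [otimes [[a [b [ab ->]]] clo dadd dmul]]]] [phi [bij mono padd pmul]].
have [fun_phi inj_phi surj_phi] := bij.
have IE x : `]a, b[%classic x = (a < x < b) by rewrite /= in_itv.
have toI x : a < x < b -> `]a, b[%classic x by rewrite IE.
have /choice[psi hpsi] : forall c : R, exists x, a < x < b /\ phi x = c.
  by move=> c; have [x] := surj_phi c Logic.I; rewrite IE => xI <-; exists x.
have psiK x : a < x < b -> psi (phi x) = x.
  move=> xI; have [yI e] := hpsi (phi x).
  by apply: inj_phi => //; rewrite inE IE.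
(* Points outside the interval are sent to the zero of the field, which makes the field operations
   total and keeps them definable. *)
pose iota x := if `[< a < x < b >] then x else psi 0.
have iotaI x : a < iota x < b by rewrite /iota; case: asboolP => // _; case: (hpsi 0).
have iotaE x : a < x < b -> iota x = x by rewrite /iota; case: asboolP.
have diota : dfn M (fun v => v 0%N = iota (v 1%N)).
  by apply: (@dterm_ite _ M (fun v => is_true (a < v 0%N < b)) (fun v => v 0%N) (fun=> psi 0)); ddec.
have dop (op : R -> R -> R) (o : R -> R -> R) :
    (forall x y, a < x < b -> a < y < b -> a < op x y < b) ->
    (forall x y, a < x < b -> a < y < b -> phi (op x y) = o (phi x) (phi y)) ->
    definable_fun2 M `]a, b[%classic op ->
    dfn M (fun v => v 0%N = psi (o (phi (iota (v 1%N))) (phi (iota (v 2%N))))).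
  move=> cl hop /definable_fun2E dop.
  pose Q x y z := [/\ `]a, b[%classic x, `]a, b[%classic y & z = op x y].
  have dQ : dfn M (fun v => Q (v 0%N) (v 1%N) (v 2%N)) := dop.
  apply: (@dfn_ext _ _ _ (fun v => Q (iota (v 1%N)) (iota (v 2%N)) (v 0%N))); last by ddec.
  move=> v; rewrite -hop // psiK; last exact: cl.
  by rewrite /Q !IE; split=> [->|[]//]; split.
exists a, b, (fun x => phi (iota x)), psi; split.
  split=> //.
  - by move=> c; have [cI cE] := hpsi c; rewrite iotaE.
  - by move=> x xI; rewrite iotaE // psiK.
  - move=> x y ax xy yb; rewrite !iotaE; try lra.
    have xI : a < x < b by lra.
    have yI : a < y < b by lra.
    exact: (mono _ _ (toI _ xI) (toI _ yI)).1.
split.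
- apply: (dop oplus +%R) => // x y xI yI; rewrite -IE; apply (clo _ _ (toI _ xI) (toI _ yI)).
- apply: (dop otimes *%R) => // x y xI yI; rewrite -IE; apply (clo _ _ (toI _ xI) (toI _ yI)).
apply: (@dfn_ext _ _ _ (fun v => iota (v 0%N) <= iota (v 1%N))); last by ddec.
move=> v; rewrite !leNgt; split=> /negP h; apply/negP => h'; apply: h.
  exact: (mono _ _ (toI _ (iotaI _)) (toI _ (iotaI _))).1.
exact: (mono _ _ (toI _ (iotaI _)) (toI _ (iotaI _))).2.
Qed.

Section Data.
Variables (a b : R) (Phi psi : R -> R).
Hypothesis FD : field_data a b Phi psi.

Lemma psi_in c : a < psi c < b. Proof. by have [[_ h _ _] _] := FD; case: (h c). Qed.
Lemma psiK c : Phi (psi c) = c. Proof. by have [[_ h _ _] _] := FD; case: (h c). Qed.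
Lemma PhiK x : a < x < b -> psi (Phi x) = x. Proof. by have [[_ _ h _] _] := FD; exact: h. Qed.
Lemma Phi_lt x y : a < x -> x < y -> y < b -> Phi x < Phi y.
Proof. by have [[_ _ _ h] _] := FD; exact: h. Qed.

Lemma Phi_ltE x y : a < x < b -> a < y < b -> (Phi x < Phi y) = (x < y).
Proof.
move=> /andP[ux xv] /andP[uy yv]; case: (ltgtP x y) => xy.
- exact: Phi_lt.
- by apply/negbTE; rewrite -leNgt ltW // Phi_lt.
- by rewrite xy ltxx.
Qed.

Lemma psi_lt c d : (psi c < psi d) = (c < d).
Proof. by rewrite -Phi_ltE ?psi_in // !psiK. Qed.

Lemma Phi_cont x : a < x < b -> contat Phi x.
Proof.
move=> xab k k0.
have := near_open (a := psi (Phi x - k)) (b := psi (Phi x + k)) (x := x)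
  (P := fun y => `|Phi y - Phi x| < k).
have xE : psi (Phi x) = x by exact: PhiK.
apply; first by rewrite -{2 3}xE !psi_lt; lra.
move=> y /andP[y1 y2].
have /andP[l1 _] := psi_in (Phi x - k); have /andP[_ l2] := psi_in (Phi x + k).
have yab : a < y < b by lra.
move: y1 y2; rewrite -(PhiK yab) !psi_lt => y1 y2.
by rewrite psiK ltr_norml; lra.
Qed.

Lemma psi_cont c : contat psi c.
Proof.
move=> k k0; have /andP[ac cb] := psi_in c.
pose y1 := Num.max ((a + psi c) / 2) (psi c - k); pose y2 := Num.min ((b + psi c) / 2) (psi c + k).
have h1 : a < y1 by rewrite /y1 lt_max; apply/orP; left; lra.
have h2 : y1 < psi c by rewrite /y1 gt_max; apply/andP; split; lra.
have h3 : y2 < b by rewrite /y2 gt_min; apply/orP; left; lra.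
have h4 : psi c < y2 by rewrite /y2 lt_min; apply/andP; split; lra.
have h5 : psi c - k <= y1 by rewrite /y1 le_max lexx orbT.
have h6 : y2 <= psi c + k by rewrite /y2 ge_min lexx orbT.
have y1I : a < y1 < b by lra. have y2I : a < y2 < b by lra.
apply: (near_open (a := Phi y1) (b := Phi y2)).
  by rewrite -[c]psiK !Phi_ltE ?psi_in // h2.
move=> d /andP[]; rewrite -{1 2}[d]psiK !Phi_ltE ?psi_in // => d1 d2.
by rewrite ltr_norml; lra.
Qed.

(** [T v] is regarded as an element of the field, represented in the interval by [psi (T v)]. *)
Definition fterm (T : (nat -> R) -> R) := dterm M (fun v => psi (T v)).

Lemma fterm_const c : fterm (fun=> c).
Proof. exact: dterm_const. Qed.

Lemma fterm_add T U : fterm T -> fterm U -> fterm (fun v => T v + U v).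
Proof.
move=> dT dU; have [_ [dadd _ _]] := FD.
have -> : (fun v => T v + U v) = (fun v => Phi (psi (T v)) + Phi (psi (U v))).
  by apply/funext => v; rewrite !psiK.
exact: (dterm_app2 (F := fun x y => psi (Phi x + Phi y))).
Qed.

Lemma fterm_mul T U : fterm T -> fterm U -> fterm (fun v => T v * U v).
Proof.
move=> dT dU; have [_ [_ dmul _]] := FD.
have -> : (fun v => T v * U v) = (fun v => Phi (psi (T v)) * Phi (psi (U v))).
  by apply/funext => v; rewrite !psiK.
exact: (dterm_app2 (F := fun x y => psi (Phi x * Phi y))).
Qed.

Lemma fterm_opp T : fterm T -> fterm (fun v => - T v).
Proof.
move=> dT; have -> : (fun v => - T v) = (fun v => -1 * T v) by apply/funext => v; rewrite mulN1r.
by apply: fterm_mul => //; exact: fterm_const.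
Qed.

Lemma fterm_Phi t : dterm M t -> fterm (fun v => Phi (t v)).
Proof.
move=> dt; have [_ [dadd _ _]] := FD.
(* For [t v] outside the interval, [psi (Phi (t v))] is not [t v]; writing it as a field sum with
   the zero [psi 0] covers that case too. *)
have -> : (fun v => Phi (t v)) = (fun v => Phi (t v) + Phi (psi 0)).
  by apply/funext => v; rewrite psiK addr0.
by apply: (dterm_app2 (F := fun x y => psi (Phi x + Phi y))) => //; exact: dterm_const.
Qed.

Lemma fterm_le T U : fterm T -> fterm U -> dfn M (fun v => is_true (T v <= U v)).
Proof.
move=> dT dU; have [_ [_ _ dle]] := FD.
apply: (@dfn_ext _ _ _ (fun v => is_true (Phi (psi (T v)) <= Phi (psi (U v))))).
  by move=> v; rewrite !psiK.
exact: (dfn_rel2 (Q := fun x y => is_true (Phi x <= Phi y))).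
Qed.

Lemma fterm_lt T U : fterm T -> fterm U -> dfn M (fun v => is_true (T v < U v)).
Proof.
move=> dT dU; apply: dfn_ext (dfn_not (fterm_le dU dT)) => v.
by rewrite ltNge; split=> /negP.
Qed.

Lemma fterm_sum4 g : (forall t, dterm M t -> fterm (fun v => g (t v))) -> sum4_definable M g.
Proof.
move=> dg t0 t1 t2 t3 s0 s1 s2 s3 *.
by apply: fterm_le; do ?apply: fterm_add; apply: dg.
Qed.

(** [G eps] is field multiplication by [o + eps], shifted by [- o]. At [eps = 0] the factor is the
    field zero, so [G eps x] tends to [0]; for small positive [eps] the factor is nonzero, so
    [G eps] is injective. *)
Lemma field_dense_C2 u v A : a <= u -> v <= b -> dense_family M u v A -> has_C2_nonaffine M.
Proof.
move=> au vb dA; pose o := psi 0.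
have oI : a < o < b := psi_in 0.
pose G eps x := psi (Phi (o + eps) * Phi x) - o.
have G00 x : G 0 x = 0 by rewrite /G addr0 psiK mul0r subrr.
have Gcont x eps : a < o + eps < b -> contat (G ^~ x) eps.
  move=> eI; apply/contatP; apply: cvgB; last exact: cvg_cst.
  apply: (@continuous_comp _ _ _ (fun eps => Phi (o + eps) * Phi x) psi); last by apply/contatP; exact: psi_cont.
  apply: cvgM; last exact: cvg_cst.
  apply: (@continuous_comp _ _ _ (fun eps => o + eps) Phi); last by apply/contatP; exact: Phi_cont.
  by apply: cvgD; [exact: cvg_cst|exact: cvg_id].
apply: (coding_C2 (G := G) dA).
- have dt : fterm (fun v => Phi (o + v 0%N) * Phi (v 1%N)).
    by apply: fterm_mul; apply: fterm_Phi; ddec.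
  exact: (dterm_add dt (dterm_const M (- o))).
- move=> x xuv k k0; have := Gcont x 0 _ k k0; rewrite addr0 => /(_ oI)[d [d0 hd]].
  exists (d / 2); split; first lra.
  move=> e he; have := hd (d / 2) ltac:(lra) e; rewrite G00 !subr0; apply.
  by rewrite gtr0_norm; lra.
- move=> x xuv; have /small_lt : 0 < b - o by lra.
  by apply: small_mono => e e0 eb; apply: Gcont; lra.
move=> s hs d d0; have [|eps [e0 [e1 e2]]] := small_ex (small_and (small_lt d0) (small_lt (c := b - o) _)); try lra.
exists eps; split; first by rewrite e0.
move=> x y /hs xs /hs ys ne; rewrite /G => /addIr e; apply: ne.
have xab : a < x < b by lra. have yab : a < y < b by lra.
rewrite -(PhiK xab) -(PhiK yab); congr psi.
apply: (@mulfI _ (Phi (o + eps))).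
  have : Phi o < Phi (o + eps) by apply: Phi_lt; lra.
  by rewrite psiK => h; rewrite gt_eqF.
by rewrite -[LHS]psiK -[RHS]psiK e.
Qed.

End Data.
End Field.

(** * From a definable field to a C2 function that is not affine *)

Section FieldC2.
Variables (R : realType) (M : expansion R).

(* Its conjugate by [Phi] has exactly two fixed points between [Phi^-1 u1] and [Phi^-1 u4],
   hence is not affine there. *)
Section Quartic.
Variables u1 u2 u3 u4 : R.
Hypotheses (h12 : u1 < u2) (h23 : u2 < u3) (h34 : u3 < u4).

Definition quartic u := let k := ((u4 - u1) * (u4 - u1) * (u4 - u1))^-1 / 2 in
  u + k * ((u - u1) * (u - u2) * ((u - u3) * (u - u4))).

Lemma quartic_fix u : quartic u = u <-> u = u1 \/ u = u2 \/ u = u3 \/ u = u4.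
Proof.
have k0 : ((u4 - u1) * (u4 - u1) * (u4 - u1))^-1 / 2 != 0.
  have := h12; have := h23; have := h34 => a1 a2 a3.
  by rewrite mulf_neq0 ?invr_eq0 ?mulf_neq0 // subr_eq0 gt_eqF //; slra.
rewrite /quartic; split=> [/eqP|]; last first.
  by case=> [|[|[|]]] ->; ring.
rewrite -subr_eq0 addrC addKr mulf_eq0 (negbTE k0) /= !mulf_eq0 !subr_eq0.
by move=> /orP[/orP[]|/orP[]] /eqP; tauto.
Qed.

(** With [L = u4 - u1] the coefficient is [1 / (2 * L ^ 3)]. Three factors of size at most [L] then
    contribute at most [1 / 2], so the distance to either end is multiplied by at least [1 / 2]. *)
Lemma quartic_in u : u1 < u < u4 -> u1 < quartic u < u4.
Proof.
have [a1 a2 a3] := And3 h12 h23 h34; move=> /andP[l r].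
pose L := u4 - u1; have L0 : 0 < L by rewrite /L; slra.
have LLL : 0 < L * L * L by do 2 apply: mulr_gt0 => //.
have bd x y z : `|x| <= L -> `|y| <= L -> `|z| <= L -> `|(L * L * L)^-1 / 2 * (x * y * z)| <= 2^-1.
  move=> hx hy hz; set k := (L * L * L)^-1 / 2.
  have k0 : 0 <= k by rewrite /k divr_ge0 // invr_ge0 ltW.
  have <- : k * (L * L * L) = 2^-1 by rewrite /k mulrAC mulVf ?mul1r // gt_eqF.
  rewrite normrM (ger0_norm k0) ler_wpM2l // !normrM.
  by do 2 (apply: ler_pM => //).
have lem x : u1 <= x <= u4 -> `|u - x| <= L by move=> ?; rewrite ler_norml /L; slra.
apply/andP; split; rewrite -subr_gt0 /quartic /= -/L.
  have := bd _ _ _ (lem u2 ltac:(slra)) (lem u3 ltac:(slra)) (lem u4 ltac:(slra)).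
  rewrite ler_norml => /andP[b1 b2].
  have -> : u + (L * L * L)^-1 / 2 * ((u - u1) * (u - u2) * ((u - u3) * (u - u4))) - u1 =
    (u - u1) * (1 + (L * L * L)^-1 / 2 * ((u - u2) * (u - u3) * (u - u4))) by ring.
  by apply: mulr_gt0; slra.
have := bd _ _ _ (lem u1 ltac:(slra)) (lem u2 ltac:(slra)) (lem u3 ltac:(slra)).
rewrite ler_norml => /andP[b1 b2].
have -> : u4 - (u + (L * L * L)^-1 / 2 * ((u - u1) * (u - u2) * ((u - u3) * (u - u4)))) =
  (u4 - u) * (1 + (L * L * L)^-1 / 2 * ((u - u1) * (u - u2) * (u - u3))) by ring.
by apply: mulr_gt0; slra.
Qed.

Lemma quartic_derive : exists F1 F2 : R -> R,
  [/\ forall u : R, is_derive u 1 quartic (F1 u), forall u : R, is_derive u 1 F1 (F2 u)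
    & continuous F2].
Proof.
rewrite /quartic; set k := _ / 2.
exists (fun u => 1 + k * ((2 * u - u1 - u2) * ((u - u3) * (u - u4)) +
                       (u - u1) * (u - u2) * (2 * u - u3 - u4))).
exists (fun u => k * (2 * ((u - u3) * (u - u4)) + 2 * ((2 * u - u1 - u2) * (2 * u - u3 - u4))
     + (u - u1) * (u - u2) * 2)).
split=> u.
- by apply: is_derive_eq; rewrite /= /GRing.scale /=; ring.
- by apply: is_derive_eq; rewrite /= /GRing.scale /=; ring.
have cB (c : R) : continuous_at u (fun u : R => u - c).
  by apply: cvgB; [exact: cvg_id|exact: cvg_cst].
have c2 (c d : R) : continuous_at u (fun u : R => 2 * u - c - d).
  by do 2 (apply: cvgB; last exact: cvg_cst); apply: cvgM; [exact: cvg_cst|exact: cvg_id].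
apply: cvgM; first exact: cvg_cst.
apply: cvgD; first apply: cvgD.
- by apply: cvgM; [exact: cvg_cst|apply: cvgM; exact: cB].
- by apply: cvgM; [exact: cvg_cst|apply: cvgM; exact: c2].
- by apply: cvgM; [apply: cvgM; exact: cB|exact: cvg_cst].
Qed.

End Quartic.

Section Data.
Variables (a b : R) (Phi psi : R -> R).
Hypothesis FD : field_data M a b Phi psi.

Lemma psi_derive (x D : R) : a < x < b -> is_derive x 1 Phi D -> D != 0 ->
  is_derive (Phi x) 1 psi D^-1.
Proof.
move=> xab dP D0.
have nb : \forall y \near x, a < y < b.
  have [d [d0 hd]] := near_open xab (fun y (h : a < y < b) => h).
  apply/nbhs_ballP; exists (d / 2) => /=; first slra.
  by move=> y; rewrite /ball /= distrC; apply: hd; slra.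
apply: is_derive_inverse => //.
  by apply: filterS nb => y; exact: (PhiK FD).
by apply: filterS nb => y yab; apply/contatP; exact: Phi_cont FD _ yab.
Qed.

(** Since [Phi] is C2 with positive derivative, the conjugate [f] of the quartic by [Phi] is C2 by
    the chain and inverse function rules. The four points lie inside [(u, v)] and [f] preserves
    [(t1, t4)], so the derivatives at [f t] are available as well. *)
Lemma Phi_C2 u v (D E : R -> R) : a <= u -> u < v -> v <= b ->
  (forall x, u < x < v -> [/\ is_derive x 1 Phi (D x), is_derive x 1 D (E x), contat E x & 0 < D x]) ->
  has_C2_nonaffine M.
Proof.
move=> au uv vb H; pose w := (v - u) / 5.
pose t1 := u + w; pose t2 := u + 2 * w; pose t3 := u + 3 * w; pose t4 := u + 4 * w.
have [ut1 t12] : u < t1 /\ t1 < t2 by rewrite /t1 /t2 /w; split; slra.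
have [t23 t34] : t2 < t3 /\ t3 < t4 by rewrite /t3 /t2 /t4; split; rewrite /w; slra.
have t4v : t4 < v by rewrite /t4 /w; slra.
clearbody t1 t2 t3 t4; clear w.
have P12 : Phi t1 < Phi t2 by apply: (Phi_lt FD); slra.
have P23 : Phi t2 < Phi t3 by apply: (Phi_lt FD); slra.
have P34 : Phi t3 < Phi t4 by apply: (Phi_lt FD); slra.
pose F := quartic (Phi t1) (Phi t2) (Phi t3) (Phi t4).
pose f t := psi (F (Phi t)).
have PhiI x y : a < x < b -> a < y < b -> (Phi x < Phi y) = (x < y) := Phi_ltE FD (x := x) (y := y).
have fI t : t1 < t < t4 -> t1 < f t < t4.
  move=> /andP[h1 h4].
  have := @quartic_in _ _ _ _ P12 P23 P34 (Phi t) _; rewrite !PhiI; try slra.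
  rewrite h1 h4 -/F => /(_ isT)/andP[q1 q4].
  rewrite -(PhiI t1 (f t)) -?(PhiI (f t) t4) /f ?(psiK FD) ?q1 //; try slra; exact: psi_in FD _.
have [F1 [F2 [dF dF1 cF2]]] := quartic_derive (Phi t1) (Phi t2) (Phi t3) (Phi t4).
have inV t : t1 < t < t4 -> u < t < v by slra.
have df t : t1 < t < t4 -> is_derive t 1 f (F1 (Phi t) * D t * (D (f t))^-1).
  move=> tI; have [dP _ _ _] := H _ (inV _ tI); have [dPf _ _ Df0] := H _ (inV _ (fI _ tI)).
  have ftab : a < f t < b by have := inV _ (fI _ tI); slra.
  have dpsi := psi_derive ftab dPf (lt0r_neq0 Df0).
  have e : Phi (f t) = F (Phi t) by rewrite /f (psiK FD).
  rewrite e in dpsi.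
  have dFt := dF (Phi t).
  have d1 : is_derive t 1 (F \o Phi) (F1 (Phi t) * D t) by exact: is_derive1_comp.
  have := @is_derive1_comp _ psi (F \o Phi) t _ _ dpsi d1.
  by rewrite mulrC.
pose f1 t := F1 (Phi t) * D t * (D (f t))^-1.
pose f2 t := F1 (Phi t) * D t * (- (D (f t)) ^- 2 * (E (f t) * f1 t)) +
   (D (f t))^-1 * (F1 (Phi t) * E t + D t * (F2 (Phi t) * D t)).
have df1 t : t1 < t < t4 -> is_derive t 1 f1 (f2 t).
  move=> tI; have [dP dD _ _] := H _ (inV _ tI); have [_ dDf _ Df0] := H _ (inV _ (fI _ tI)).
  have dft := df _ tI; have dF1t := dF1 (Phi t).
  have e1 : is_derive t 1 (F1 \o Phi) (F2 (Phi t) * D t) by exact: is_derive1_comp.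
  have e2 : is_derive t 1 (D \o f) (E (f t) * f1 t) by exact: is_derive1_comp.
  have e3 : is_derive t 1 (fun y => ((D \o f) y)^-1) (- ((D \o f) t) ^- 2 *: (E (f t) * f1 t)).
    by apply: is_deriveV => //; rewrite gt_eqF.
  have e4 := is_deriveM e1 dD.
  exact: is_deriveM e4 e3.
have cPhi t : t1 < t < t4 -> continuous_at t Phi.
  by move=> tI; apply/contatP; apply: (Phi_cont FD); slra.
have cf t : t1 < t < t4 -> continuous_at t f.
  by move=> tI; apply/contatP; exact: is_derive_contat (df _ tI).
have cf2 t : t1 < t < t4 -> contat f2 t.
  move=> tI; have [_ dD cE _] := H _ (inV _ tI); have [_ dDf cEf Df0] := H _ (inV _ (fI _ tI)).
  have cD : continuous_at t D by apply/contatP; exact: is_derive_contat dD.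
  have cDf : continuous_at t (D \o f).
    by apply: continuous_comp; [exact: cf|apply/contatP; exact: is_derive_contat dDf].
  have cE' : continuous_at t E by apply/contatP.
  have cEf' : continuous_at t (E \o f) by apply: continuous_comp; [exact: cf|apply/contatP].
  have cF1 : continuous_at t (F1 \o Phi).
    by apply: continuous_comp; [exact: cPhi|apply/contatP; exact: is_derive_contat (dF1 _)].
  have cF2' : continuous_at t (F2 \o Phi) by apply: continuous_comp; [exact: cPhi|exact: cF2].
  have cf1 : continuous_at t f1 by apply/contatP; exact: is_derive_contat (df1 _ tI).
  have cV : continuous_at t (fun t => (D (f t))^-1).
    by apply: cvgV => //; rewrite gt_eqF.
  apply/contatP; apply: cvgD; apply: cvgM.
  - exact: cvgM.
  - apply: cvgM; last exact: cvgM.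
    apply: cvgN; apply: cvgV; first by rewrite expf_neq0 // gt_eqF.
    by apply: (@continuous_comp _ _ _ (D \o f) (fun x => x ^+ 2)) => //; exact: exprn_continuous.
  - exact: cV.
  - by apply: cvgD; apply: cvgM => //; apply: cvgM.
exists `]t1, t4[%classic, f; split.
- by exists t1, t4; split=> //; slra.
- apply/definable_fun1E; apply: (@dfn_ext _ _ _ (fun v => t1 < v 0%N < t4 /\ v 1%N = f (v 0%N))).
    by move=> x; rewrite /= in_itv.
  apply: dfn_and; first by ddec.
  apply: dfn_eq; first by ddec.
  have dPhi : fterm M psi (fun v => Phi (v 0%N)) by apply: (fterm_Phi FD); ddec.
  have dc (c : R) : fterm M psi (fun v => Phi (v 0%N) - c).
    by apply: (fterm_add FD) => //; exact: fterm_const.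
  suff : fterm M psi (fun v => F (Phi (v 0%N))) by [].
  rewrite /F /quartic /=; apply: (fterm_add FD) => //; apply: (fterm_mul FD).
    exact: fterm_const.
  by do 2 (apply: (fterm_mul FD) => //).
- exact: C2_oo df df1 cf2.
(* An affine map fixing [t2] and [t3] fixes their midpoint, while [F] has no fixed point strictly
   between [Phi t2] and [Phi t3]. *)
move=> [m [c hm]]; clear -FD P12 P23 P34 ut1 t12 t23 t34 t4v au vb hm.
have ft x : t1 < x < t4 -> Phi (f x) = Phi x -> f x = x.
  move=> xI e; have xab : a < x < b by slra.
  by rewrite -[LHS](PhiK FD) ?(psi_in FD) // e (PhiK FD).
have f_2 : f t2 = t2.
  by apply: ft; [slra|rewrite /f (psiK FD); apply/quartic_fix => //; tauto].
have f_3 : f t3 = t3.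
  by apply: ft; [slra|rewrite /f (psiK FD); apply/quartic_fix => //; tauto].
have e2 := hm t2; have e3 := hm t3; have em := hm ((t2 + t3) / 2).
rewrite /= !in_itv /= in e2 e3 em; rewrite {}f_2 in e2; rewrite {}f_3 in e3.
have tmE : f ((t2 + t3) / 2) = (t2 + t3) / 2.
  clear hm ft; have {}e2 := e2 ltac:(slra); have {}e3 := e3 ltac:(slra).
  by rewrite em; slra.
have fm : F (Phi ((t2 + t3) / 2)) = Phi ((t2 + t3) / 2) by rewrite -{2}tmE /f (psiK FD).
clear -FD P12 P23 P34 ut1 t23 t12 t34 t4v au vb fm.
have l2 : Phi t2 < Phi ((t2 + t3) / 2) by apply: (Phi_lt FD); slra.
have l3 : Phi ((t2 + t3) / 2) < Phi t3 by apply: (Phi_lt FD); slra.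
move/quartic_fix: fm => /(_ P12 P23 P34); clear -FD P12 P23 P34 l2 l3.
by move=> [|[|[|]]] h; slra.
Qed.

(** Increments of [Phi] are field elements while the step [h] is a real; a quotient of two
    derivatives compares increments only. It is the field element [Phi e] at which
    [Phi e * (Phi (p + h) - Phi p)] passes from below to above [Phi (x + h) - Phi x] for small
    [h]. *)
Lemma fterm_derivative u v p (D : R -> R) : a <= u -> u < v -> v <= b -> u < p < v ->
  (forall x, u < x < v -> is_derive x 1 Phi (D x)) -> 0 < D p ->
  forall t, dterm M t -> fterm M psi (fun w => if `[< u < t w < v >] then D (t w) / D p else 0).
Proof.
move=> au uv vb pI dP Dp0.
pose lam x := if `[< u < x < v >] then D x / D p else 0.
have sl x : u < x < v -> slope0 (fun h => Phi (x + h) - Phi x) (D x).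
  by move=> /dP/is_derive_eps.
pose cmp x c := forall e, a < e < b ->
  (e < c -> small (fun h => Phi e * (Phi (p + h) - Phi p) < Phi (x + h) - Phi x)) /\
  (c < e -> small (fun h => Phi (x + h) - Phi x < Phi e * (Phi (p + h) - Phi p))).
have slc e : slope0 (fun h => Phi e * (Phi (p + h) - Phi p)) (Phi e * D p).
  apply: (slope0_comp (u := fun y => Phi e * y)); last exact: sl.
  by move=> k k0; apply: small_true => d h _; rewrite subrr normr0 mulr_ge0 // ltW.
have cmpE x c : u < x < v -> a < c < b -> c = psi (D x / D p) <-> cmp x c.
  move=> xI cI; have cE : c = psi (D x / D p) <-> Phi c * D p = D x.
    split=> [->|<-]; first by rewrite (psiK FD) divfK // gt_eqF.
    by rewrite mulfK ?gt_eqF // (PhiK FD).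
  rewrite cE; split=> [e1 e eI|hc].
    split=> ec; apply: slope0_lt; try exact: slc; try exact: sl.
      by rewrite -e1 ltr_pM2r // (Phi_ltE FD).
    by rewrite -e1 ltr_pM2r // (Phi_ltE FD).
  (* If [Phi c] and [D x / D p] differed, the field element halfway between them would compare in
     the wrong way. *)
  pose m := (Phi c + D x / D p) / 2.
  have mI := psi_in FD m.
  have cm1 : D x / D p * D p = D x by rewrite divfK // gt_eqF.
  have [h1 h2] := hc _ mI.
  case: (ltgtP (Phi c * D p) (D x)) => // lt.
    have lt' : Phi c < D x / D p by rewrite ltr_pdivlMr.
    have /h2 s1 : c < psi m by rewrite -(Phi_ltE FD) // (psiK FD) /m; slra.
    have s2 : small (fun h => Phi (psi m) * (Phi (p + h) - Phi p) < Phi (x + h) - Phi x).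
      apply: slope0_lt (slc _) (sl _ xI) _.
      by rewrite (psiK FD) -cm1 ltr_pM2r // /m; slra.
    by have [h [_ [q1 q2]]] := small_ex (small_and s1 s2); have := lt_trans q1 q2; rewrite ltxx.
  have lt' : D x / D p < Phi c by rewrite ltr_pdivrMr.
  have /h1 s1 : psi m < c by rewrite -(Phi_ltE FD) // (psiK FD) /m; slra.
  have s2 : small (fun h => Phi (x + h) - Phi x < Phi (psi m) * (Phi (p + h) - Phi p)).
    apply: slope0_lt (sl _ xI) (slc _) _.
    by rewrite (psiK FD) -cm1 ltr_pM2r // /m; slra.
  by have [h [_ [q1 q2]]] := small_ex (small_and s1 s2); have := lt_trans q1 q2; rewrite ltxx.
have dlam : dfn M (fun w => w 0%N = psi (lam (w 1%N))).
  apply: (@dfn_ext _ _ _ (fun w => ((u < w 1%N < v /\ a < w 0%N < b) /\ cmp (w 1%N) (w 0%N)) \/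
     (~ (u < w 1%N < v) /\ w 0%N = psi 0))).
    move=> w; rewrite /lam; case: asboolP => wI.
      split=> [e|[[[_ wab] /cmpE->//]|[]//]].
      have wab : a < w 0%N < b by rewrite e; exact: psi_in FD _.
      by left; split=> //; apply/cmpE.
    by split=> [->|[[[]]//|[_ ->]]//]; right.
  apply: dfn_or; last by ddec.
  apply: dfn_and; first by ddec.
  apply: (@dfn_all _ _ (fun e w => _)); apply: dfn_imp; first by ddec.
  have ft t : dterm M t -> fterm M psi (fun w => Phi (t w)) := fterm_Phi FD (t := t).
  apply: dfn_and; (apply: dfn_imp; first by ddec); apply: (@dfn_small _ _ (fun h w => _));
    apply: (fterm_lt FD (T := fun v => _) (U := fun v => _));
    do ?apply: (fterm_mul FD (T := fun v => _) (U := fun v => _));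
    do ?apply: (fterm_add FD (T := fun v => _) (U := fun v => _));
    do ?apply: (fterm_opp FD (T := fun v => _));
    try (apply: ft; ddec).
by move=> t dt; apply: (dterm_app1 (F := fun x => psi (lam x))).
Qed.

(** The dichotomy is used twice: first for [Phi], and then for the quotient of its derivative by a
    fixed value. Either a dense family appears or [Phi] gains one more derivative. *)
Lemma field_data_C2 : has_C2_nonaffine M.
Proof.
have [[ab _ _ _] _] := FD.
have cP x : a < x < b -> contat Phi x := fun h => Phi_cont FD h.
have sP : sum4_definable M Phi by apply: (fterm_sum4 FD) => t; exact: fterm_Phi FD _.
have [[A [u [v [au vb dA]]]]|[u [v [D [au uv vb [dP mono]]]]]] := generic_C1 ab cP sP.
  have h := field_dense_C2 FD au vb dA; exact: h.
(* [Phi] is strictly increasing, so the mean value theorem makes its derivative positive somewhere,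
   hence by continuity on a subinterval. *)
have [x0 [x0I Dx0]] : exists x0, u < x0 < v /\ 0 < D x0.
  apply: contrapT => nex.
  pose c := u + (v - u) / 3; pose d := u + (v - u) * 2 / 3.
  have [uc cd] : u < c /\ c < d by rewrite /c /d; split; slra.
  have dv : d < v by rewrite /d; slra.
  have lt : Phi c < Phi d by apply: (Phi_lt FD); slra.
  have [||x] := @MVT R Phi D c d cd.
  - by move=> x; rewrite in_itv /= => xI; have [] := dP x ltac:(slra).
  - by apply: contat_within => x xI; apply: cP; slra.
  rewrite in_itv /= => xI e.
  apply: nex; exists x; split; first slra.
  by rewrite -(pmulr_lgt0 _ (_ : 0 < d - c)) -?e; slra.
have [D0 cD0] := dP _ x0I.
have [d [d0 [hd [d1 d2]]]] := small_ex (small_and (cD0 _ Dx0)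
  (small_and (small_lt (c := x0 - u) ltac:(slra)) (small_lt (c := v - x0) ltac:(slra)))).
pose u' := x0 - d; pose v' := x0 + d.
have [uu' u'x] : u < u' /\ u' < x0 by rewrite /u'; split; slra.
have [v'v xv'] : v' < v /\ x0 < v' by rewrite /v'; split; slra.
have Dpos x : u' < x < v' -> 0 < D x.
  move=> xI; have : `|D x - D x0| < D x0 by apply: hd; rewrite ltr_norml; move: xI; rewrite /u' /v'; slra.
  by move=> /ltr_normlP[]; slra.
clearbody u' v'; clear d d0 hd d1 d2.
pose lam x := if `[< u' < x < v' >] then D x / D x0 else 0.
have lamE x : u' < x < v' -> lam x = D x / D x0 by rewrite /lam; case: asboolP.
have clam x : u' < x < v' -> contat lam x.
  move=> xI; apply: (contat_local (g := fun x => D x / D x0)); first exact: near_open lamE.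
  apply/contatP; apply: cvgM; last exact: cvg_cst.
  by apply/contatP; have [] := dP x ltac:(slra).
have u'v' : u' < v' by slra.
have au' : a <= u' by slra.
have v'b : v' <= b by slra.
have dlam : sum4_definable M lam.
  apply: (fterm_sum4 FD); apply: (fterm_derivative (u := u') (v := v') (p := x0)) => //; first slra.
  by move=> x xI; have [] := dP x ltac:(slra).
have [[A [u2 [v2 [au2 vb2 dA]]]]|[u2 [v2 [E [au2 uv2 vb2 [dlamE _]]]]]] := generic_C1 u'v' clam dlam.
  by apply: (field_dense_C2 FD _ _ dA); slra.
apply: (@Phi_C2 u2 v2 D (fun x => D x0 * E x)); try slra.
move=> x xI; have [dl cE] := dlamE _ xI.
have [dx _] := dP x ltac:(slra).
split=> //.
- have dl' : is_derive x 1 (fun y => D x0 *: lam y) (D x0 *: E x) by exact: is_deriveZ.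
  apply: is_derive_local dl'; apply: (near_open xI) => y yI.
  by rewrite lamE; [rewrite /GRing.scale /= mulrC divfK // gt_eqF|slra].
- by apply/contatP; apply: cvgM; [exact: cvg_cst|apply/contatP].
- by apply: Dpos; slra.
Qed.

End Data.

Lemma field_type_C2 : field_type M -> has_C2_nonaffine M.
Proof. by move/field_typeP => [a [b [Phi [psi FD]]]]; exact: field_data_C2 FD. Qed.

End FieldC2.

(** * The implications between the three conditions *)

Section Assembly.
Variables (R : realType) (M : expansion R).

Definition patch0 (a b : R) (f : R -> R) x := if `[< a < x < b >] then f x else 0.

Lemma patch0E a b f x : a < x < b -> patch0 a b f x = f x.
Proof. by rewrite /patch0; case: asboolP. Qed.

Lemma dfn_patch0 a b f : definable_fun1 M `]a, b[%classic f ->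
  dfn M (fun v => v 0%N = patch0 a b f (v 1%N)).
Proof.
move=> /definable_fun1E df.
pose Q x y := `]a, b[%classic x /\ y = f x.
have dQ : dfn M (fun v => Q (v 0%N) (v 1%N)) := df.
apply: (@dfn_ext _ _ _ (fun v => Q (v 1%N) (v 0%N) \/ (~ (a < v 1%N < b) /\ v 0%N = 0))); last by ddec.
move=> v; rewrite /Q /patch0 /= in_itv /=; case: asboolP => h; split; tauto.
Qed.

Lemma definable_fun1_sub a b u v f : a <= u -> v <= b ->
  definable_fun1 M `]a, b[%classic f -> definable_fun1 M `]u, v[%classic f.
Proof.
move=> au vb /dfn_patch0 df; apply/definable_fun1E.
apply: (@dfn_ext _ _ _ (fun w => u < w 0%N < v /\ w 1%N = patch0 a b f (w 0%N))); last by ddec.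
by move=> w; rewrite /= in_itv /=; split=> -[h]; rewrite patch0E //; slra.
Qed.

Lemma mvt (p q : R) (f D : R -> R) : p < q -> (forall x, p <= x <= q -> is_derive x 1 f (D x)) ->
  exists c, p < c < q /\ f q - f p = D c * (q - p).
Proof.
move=> pq h; have [||c] := @MVT R f D p q pq.
- by move=> x; rewrite in_itv /= => xI; apply: h; slra.
- by apply: contat_within => x xI; apply: is_derive_contat (h x xI).
by rewrite in_itv /= => cI e; exists c.
Qed.

Lemma deriv_pos_lt (u v : R) (f D : R -> R) : (forall x, u < x < v -> is_derive x 1 f (D x) /\ 0 < D x) ->
  forall x y, u < x -> x < y -> y < v -> f x < f y.
Proof.
move=> h x y ux xy yv; have [|c [cI e]] := @mvt x y f D xy.
  by move=> z zI; have [] := h z ltac:(slra).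
have [_ Dc] := h c ltac:(slra).
by rewrite -subr_gt0 e; apply: mulr_gt0; slra.
Qed.

(** A second derivative vanishing everywhere would make [f] affine. Around a point where it does not
    vanish it keeps its sign, so the first derivative is strictly monotone. *)
Lemma C2_monotone a b (f : R -> R) : C2 `]a, b[%classic f -> ~ affine_on `]a, b[%classic f ->
  exists u v, [/\ a <= u, u < v, v <= b,
    forall x, u < x < v -> is_derive x 1 f (f^`()%classic x) /\ contat (f^`()%classic) x &
    (forall x y, u < x -> x < y -> y < v -> f^`()%classic x < f^`()%classic y) \/
    (forall x y, u < x -> x < y -> y < v -> f^`()%classic y < f^`()%classic x)].
Proof.
move=> [d1 d2 c2] naff.
set f1 := f^`()%classic in d2 *; set f2 := f^`(2)%classic in c2.
have e1 x : a < x < b -> is_derive x 1 f (f1 x).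
  by move=> xI; rewrite /f1 derive1E; apply: DeriveDef => //; apply: d1; rewrite /= in_itv.
have e2 x : a < x < b -> is_derive x 1 f1 (f2 x).
  by move=> xI; rewrite /f2 /= -/f1 derive1E; apply: DeriveDef => //; apply: d2; rewrite /= in_itv.
have {}c2 x : a < x < b -> contat f2 x.
  move=> xI; apply/contatP; move: c2; rewrite continuous_open_subspace; last exact: interval_open.
  by apply; rewrite inE /= in_itv.
clear d1 d2; clearbody f1 f2.
have ce1 x : a < x < b -> contat f1 x by move=> /e2; exact: is_derive_contat.
have [x0 [x0I f20]] : exists x, a < x < b /\ f2 x != 0.
  apply: contrapT => nex.
  have z x : a < x < b -> f2 x = 0.
    by move=> xI; apply/eqP; apply: contrapT => /negP h; apply: nex; exists x.
  have cst x y : a < x -> x < y -> y < b -> f1 y = f1 x.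
    move=> ax xy yb; have [|c [cI e]] := @mvt x y f1 f2 xy.
      by move=> w wI; apply: e2; slra.
    by apply/eqP; rewrite -subr_eq0 e z ?mul0r //; slra.
  have [ab|ab] := ltP a b; last first.
    by apply: naff; exists 0, 0 => x; rewrite /= in_itv /=; slra.
  pose m := (a + b) / 2; have mI : a < m < b by rewrite /m; slra.
  have fm x : a < x < b -> f1 x = f1 m.
    move=> xI; case: (ltgtP x m) => [xm|mx|->//].
      by apply/esym/cst; slra.
    by apply: cst; slra.
  apply: naff; exists (f1 m), (f m - f1 m * m) => x; rewrite /= in_itv /= => xI.
  case: (ltgtP x m) => [xm|mx|->]; last by ring.
    have [|c [cI e]] := @mvt x m f f1 xm; first by move=> w wI; apply: e1; slra.
    by move: e; rewrite fm; slra.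
  have [|c [cI e]] := @mvt m x f f1 mx; first by move=> w wI; apply: e1; slra.
  by move: e; rewrite fm; slra.
have k0 : 0 < `|f2 x0| by rewrite normr_gt0.
have [d [d0 [hd [h1 h2]]]] := small_ex (small_and (c2 _ x0I _ k0)
  (small_and (small_lt (c := x0 - a) ltac:(slra)) (small_lt (c := b - x0) ltac:(slra)))).
exists (x0 - d), (x0 + d); split; try slra.
  by move=> x xI; split; [apply: e1|apply: ce1]; slra.
have hd' x : x0 - d < x < x0 + d -> `|f2 x - f2 x0| < `|f2 x0|.
  by move=> xI; apply: hd; rewrite ltr_norml; slra.
case: (ltgtP 0 (f2 x0)) => [pos|neg|e]; last by move: f20; rewrite -e eqxx.
  left; apply: (@deriv_pos_lt _ _ f1 f2) => x xI; split; first by apply: e2; slra.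
  by have := hd' x xI; rewrite (gtr0_norm pos) => /ltr_normlP[]; slra.
right=> x y *; rewrite -ltrN2.
apply: (@deriv_pos_lt (x0 - d) (x0 + d) (fun x => - f1 x) (fun x => - f2 x)) => // z zI; split.
  by apply: is_deriveN; apply: e2; slra.
by have := hd' z zI; rewrite (ltr0_norm neg) => /ltr_normlP[]; slra.
Qed.

Lemma C2_field_type : has_C2_nonaffine M -> field_type M.
Proof.
move=> [_ [f [[a [b [ab ->]]] df C2f naff]]].
have [u [v [au uv vb h mono]]] := C2_monotone C2f naff.
apply: (@monotone_C1_field_type R M u v (patch0 a b f) (f^`()%classic)) => //.
  exact: dfn_patch0.
move=> x xI; have [dx cx] := h x xI; split=> //.
apply: is_derive_local dx; apply: (near_open xI) => y yI.
by rewrite patch0E //; slra.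
Qed.

(** Where the derivative is strictly monotone, increments from two different points have different
    slopes at [0], hence differ for all small positive steps. *)
Lemma C2_nonrepetitious : has_C2_nonaffine M ->
  exists (I : set R) (f : R -> R),
    [/\ bounded_open_interval I, definable_fun1 M I f,
        {within I, continuous f} & ~ repetitious I f].
Proof.
move=> [_ [f [[a [b [ab ->]]] df C2f naff]]].
have [u [v [au uv vb h mono]]] := C2_monotone C2f naff.
exists `]u, v[%classic, f; split.
- by exists u, v.
- exact: definable_fun1_sub df.
- apply: continuous_in_subspaceT => x; rewrite inE /= in_itv /= => /h[dx _].
  by apply/contatP; exact: is_derive_contat dx.
move=> /(_ `]u, v[%classic)[|//|d [x [y]]]; first by exists u, v.
rewrite /= !in_itv /= => -[d0 xI yI dxy eps].
have sl z : u < z < v -> slope0 (fun h => f (z + h) - f z) (f^`()%classic z).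
  by move=> /h[/is_derive_eps].
have xy : x < y by slra.
have ne z w : small (fun h => f (z + h) - f z < f (w + h) - f w) ->
    (forall e, 0 <= e -> e < d -> f (z + e) - f z = f (w + e) - f w) -> False.
  move=> s he; have [e [e0 [lt ed]]] := small_ex (small_and s (small_lt d0)).
  by move: lt; rewrite he ?ltxx // ltW.
case: mono => mono.
  apply: (ne x y).
    by apply: slope0_lt (sl _ xI) (sl _ yI) _; apply: mono; slra.
  by move=> e e0 ed; have [] := eps e e0 ed.
apply: (ne y x).
  by apply: slope0_lt (sl _ yI) (sl _ xI) _; apply: mono; slra.
by move=> e e0 ed; have [] := eps e e0 ed.
Qed.

(** * Continuous functions that are not repetitious *)

Section NonRepetitious.
Variables (a b c d : R) (f : R -> R).
Hypotheses (ac : a <= c) (cd : c < d) (db : d <= b).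
Hypothesis df : dfn M (fun v => v 0%N = f (v 1%N)).
Hypothesis cf : forall x, c < x < d -> contat f x.
Hypothesis nrep : forall e x y, 0 < e -> c < x -> x < y -> y + e < d -> e < y - x ->
  exists t, [/\ 0 <= t, t < e & f (x + t) - f x <> f (y + t) - f y].

(** If the increments from [x] and [y] agree at the step [m], then [nrep] at [x + m] and [y + m]
    gives a further step [t] at which they differ, so those from [x] and [y] differ at [m + t].
    Continuity extends this to an interval of steps. *)
Lemma increments_differ x y al be : c < x -> x < y -> y + be < d -> 0 <= al -> al < be ->
  exists al' be', [/\ al <= al', al' < be', be' <= be &
    forall t, al' < t < be' -> f (x + t) - f x <> f (y + t) - f y].
Proof.
move=> cx xy yd al0 ab; have cd' := cd.
pose m := (al + be) / 2.
have [am mb] : al < m /\ m < be by rewrite /m; split; slra.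
clearbody m.
have [s [s0 [s1 s2]]] := small_ex (small_and (small_lt (c := be - m) ltac:(slra)) (small_lt (c := y - x) ltac:(slra))).
have [t [t0 ts ne]] := @nrep s (x + m) (y + m) s0 ltac:(slra) ltac:(slra) ltac:(slra) ltac:(slra).
have [w [wI wne]] : exists w, al < w < be /\ f (x + w) - f x <> f (y + w) - f y.
  have [e|] := pselect (f (x + m) - f x = f (y + m) - f y); last by exists m; split=> //; slra.
  exists (m + t); split; first slra.
  by move=> e'; apply: ne; rewrite -!addrA; slra.
pose k := `|(f (x + w) - f x) - (f (y + w) - f y)| / 2.
have k0 : 0 < k.
  by apply: divr_gt0 => //; rewrite normr_gt0 subr_eq0; apply/eqP.
have [r [r0 [c1 [c2 [r1 r2]]]]] := small_ex (small_and (cf (x := x + w) ltac:(slra) k0)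
  (small_and (cf (x := y + w) ltac:(slra) k0) (small_and (small_lt (c := w - al) ltac:(slra))
   (small_lt (c := be - w) ltac:(slra))))).
exists (w - r), (w + r); split; try slra.
move=> z zI e.
have /ltr_normlP[a1 a2] := c1 (x + z) ltac:(rewrite ltr_norml; slra).
have /ltr_normlP[b1 b2] := c2 (y + z) ltac:(rewrite ltr_norml; slra).
have : `|(f (x + w) - f x) - (f (y + w) - f y)| < 2 * k by rewrite ltr_norml; slra.
by rewrite /k; slra.
Qed.

Lemma increments_all_differ (L : seq (R * R)) al be : 0 <= al -> al < be ->
  (forall p, p \in L -> [/\ c < p.1, p.1 < p.2 & p.2 + be < d]) ->
  exists al' be', [/\ al <= al', al' < be', be' <= be &
    forall t p, p \in L -> al' < t < be' -> f (p.1 + t) - f p.1 <> f (p.2 + t) - f p.2].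
Proof.
elim: L al be => [|[x y] L IH] al be al0 ab hL; first by exists al, be; split.
have [p pL|al1 [be1 [h1 h2 h3 h4]]] := IH al be al0 ab.
  by apply: hL; rewrite inE pL orbT.
have [/= cx xy yd] := hL (x, y) (mem_head _ _).
have [||al2 [be2 [g1 g2 g3 g4]]] := @increments_differ x y al1 be1 cx xy _ _ h2; try slra.
exists al2, be2; split; try slra.
move=> t p; rewrite inE => /orP[/eqP-> tI|pL tI]; first exact: g4.
by apply: h4 => //; slra.
Qed.

Lemma nonrepetitious_dense_C2 u v A : c <= u -> v <= d -> dense_family M u v A -> has_C2_nonaffine M.
Proof.
move=> cu vd dA.
apply: (coding_C2 (G := fun eps x => f (x + eps) - f x) dA).
- by have df' := df; apply: (@dfn_eq _ _ (fun v => v 0%N)); ddec.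
- move=> x xI k k0; have [e [e0 he]] := cf (x := x) ltac:(slra) k0.
  exists (e / 2); split; first slra.
  move=> t tI; apply: (he (e / 2)); first slra.
  by rewrite addrC addKr gtr0_norm; slra.
- move=> x xI; have /small_lt : 0 < d - x by slra.
  apply: small_mono => t t0 td k k0.
  apply: small_mono (cf (x := x + t) ltac:(slra) k0) => r r0 h t' /= ht'.
  have -> : f (x + t') - f x - (f (x + t) - f x) = f (x + t') - f (x + t) by ring.
  by apply: h; have -> : x + t' - (x + t) = t' - t by ring.
move=> s hs e e0.
have [r [r0 [r1 r2]]] : exists r, 0 < r /\ r < e /\ forall x, x \in s -> x + r < d.
  apply: small_ex; apply: small_and; first exact: small_lt.
  apply: small_seq => x xs; have xI := hs x xs.
  have /small_lt : 0 < d - x by slra.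
  by apply: small_mono => w _; slra.
have [||p|al [be [h1 h2 h3 h4]]] :=
  @increments_all_differ [seq p <- [seq (x, y) | x <- s, y <- s] | p.1 < p.2] 0 r => //.
  rewrite mem_filter => /andP[lt /allpairsP[[x y] /= [xs ys pE]]].
  rewrite pE /= in lt *; have xI := hs x xs; have := r2 y ys; split; slra.
exists ((al + be) / 2); split; first slra.
have lem x y : x \in s -> y \in s -> x < y ->
    f (x + (al + be) / 2) - f x <> f (y + (al + be) / 2) - f y.
  move=> xs ys xy; apply: (h4 ((al + be) / 2) (x, y)); last slra.
  rewrite mem_filter /= xy /=; apply/allpairsP; exists (x, y); split=> //.
move=> x y xs ys ne; case: (ltgtP x y) => // xy; first exact: lem.
by move=> e1; apply: (lem y x ys xs xy).
Qed.

(** When [f] is C1 with monotone derivative on a subinterval, the monotonicity is strict: on an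
    interval of constant derivative the increments of [f] would not depend on the base point,
    against [nrep]. *)
Lemma nonrepetitious_C2 : has_C2_nonaffine M.
Proof.
have cd' := cd; have df' := df.
have sf : sum4_definable M f.
  by move=> *; apply: dfn_le; do ?apply: dterm_add; apply: (dterm_app1 df').
have [[A [u [v [cu vd dA]]]]|[u [v [D [cu uv vd [dD mono]]]]]] := generic_C1 cd cf sf.
  have h := nonrepetitious_dense_C2 cu vd dA; exact: h.
apply: field_type_C2; apply: (@monotone_C1_field_type R M u v f D) => //.
have ne x y : u < x -> x < y -> y < v -> (forall z, x <= z <= y -> D z = D x) -> False.
  move=> ux xy yv hD.
  have lin p q : x <= p -> p <= q -> q <= y -> f q - f p = D x * (q - p).
    move=> xp; rewrite le_eqVlt => /orP[/eqP->|pq] qy; first by rewrite !subrr mulr0.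
    have [|w [wI ->]] := @mvt p q f D pq; first by move=> z zI; have [] := dD z ltac:(slra).
    by rewrite hD //; slra.
  (* With the base points [x] and [x + 2 * h], all steps below [h] stay inside [[x, y]]. *)
  pose h := (y - x) / 4.
  have [t [t0 th]] := @nrep h x (x + 2 * h) ltac:(rewrite /h; slra) ltac:(slra)
    ltac:(rewrite /h; slra) ltac:(rewrite /h; slra) ltac:(rewrite /h; slra).
  rewrite /h in th *; apply.
  have -> := lin x (x + t) ltac:(slra) ltac:(slra) ltac:(slra).
  have -> := lin (x + 2 * ((y - x) / 4)) (x + 2 * ((y - x) / 4) + t) ltac:(slra) ltac:(slra) ltac:(slra).
  ring.
case: mono => mono; [left|right] => x y ux xy yv; rewrite lt_neqAle; apply/andP; split;
  try (by apply: mono => //; exact: ltW); apply/eqP => e; apply: (ne x y) => // z zI;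
  have m1 := mono x z ltac:(slra) ltac:(slra) ltac:(slra);
  have m2 := mono z y ltac:(slra) ltac:(slra) ltac:(slra); slra.
Qed.

End NonRepetitious.

Lemma not_repetitious_C2 (I : set R) (f : R -> R) : bounded_open_interval I ->
  definable_fun1 M I f -> {within I, continuous f} -> ~ repetitious I f -> has_C2_nonaffine M.
Proof.
move=> [a [b [ab ->]]] df cf /existsNP[_ /not_implyP[[c [d [cd ->]]] /not_implyP[sub nex]]].
have [ac db] : a <= c /\ d <= b.
  have sub' x : c < x < d -> a < x < b by move=> xI; have := sub x; rewrite /= !in_itv /=; apply.
  split; rewrite leNgt; apply/negP => lt.
    (* If [c < a], this point of [(c, d)] lies to the left of [a]. *)
    pose x := Num.min ((c + d) / 2) ((a + c) / 2).
    have x1 : x <= (c + d) / 2 by rewrite /x ge_min lexx.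
    have x2 : x <= (a + c) / 2 by rewrite /x ge_min lexx orbT.
    have x3 : c < x by rewrite /x lt_min; apply/andP; split; slra.
    by have := sub' x ltac:(slra); slra.
  pose x := Num.max ((c + d) / 2) ((b + d) / 2).
  have x1 : (c + d) / 2 <= x by rewrite /x le_max lexx.
  have x2 : (b + d) / 2 <= x by rewrite /x le_max lexx orbT.
  have x3 : x < d by rewrite /x gt_max; apply/andP; split; slra.
  by have := sub' x ltac:(slra); slra.
apply: (@nonrepetitious_C2 c d (patch0 a b f) cd (dfn_patch0 df)).
  move=> x xI; apply: (contat_local (g := f)).
    by apply: (near_open xI) => y yI; rewrite patch0E //; slra.
  apply/contatP; move: cf; rewrite continuous_open_subspace; last exact: interval_open.
  by apply; rewrite inE /= in_itv /=; slra.
move=> e x y e0 cx xy yd exy; apply: contrapT => ne; apply: nex.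
exists e, x, y; split=> //; rewrite /= ?in_itv /=; try slra.
move=> t t0 te; split; rewrite /= ?in_itv /=; try slra.
apply: contrapT => ft; apply: ne; exists t; split=> //.
by rewrite !patch0E //; slra.
Qed.

End Assembly.

Theorem theoremA (R : realType) (M : expansion R) :
  [<-> field_type M;
       exists (I : set R) (f : R -> R),
         [/\ bounded_open_interval I, definable_fun1 M I f,
             {within I, continuous f} & ~ repetitious I f];
       exists (I : set R) (f : R -> R),
         [/\ bounded_open_interval I, definable_fun1 M I f,
             C2 I f & ~ affine_on I f]].
Proof.
tfae.
- by move/field_type_C2/C2_nonrepetitious.
- by move=> [I [f [bI df cf nrep]]]; exact: not_repetitious_C2 nrep.
- exact: C2_field_type.
Qed.
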